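(* Let $n\ge2$, $s\in(0,\frac12)$ and let $E\subset\mathbb R^n$ be a Lebesgue measurable set. Then $$\limsup_{t\to0^+}\frac1t\,\mathcal E^s_t(E)<+\infty\iff \mathrm P_{2s}(E)<+\infty.$$
   Context: For $s\in(0,1)$ and $t>0$, $P^s(\cdot,t)$ is the fundamental solution of the fractional heat equation $\partial_t v+(-\Delta)^s v=0$ on $\mathbb R^n$, i.e. $P^s(z,t)=(2\pi)^{-n}\int_{\mathbb R^n}e^{-t|\xi|^{2s}}e^{i\langle z,\xi\rangle}\,d\xi$; it is positive and $\int_{\mathbb R^n}P^s(z,t)\,dz=1$. For measurable $E\subset\mathbb R^n$, with $E^c=\mathbb R^n\setminus E$, $$\mathcal E^s_t(E)=\int_E\int_{E^c}P^s(x-y,t)\,dy\,dx\in[0,+\infty],\qquad \mathrm P_{2s}(E)=\int_E\int_{E^c}\frac{1}{|x-y|^{n+2s}}\,dx\,dy\in[0,+\infty].$$ *)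

(* Defs.v *)
From HB Require Import structures.
From mathcomp Require Import all_boot all_order all_algebra.
From mathcomp Require Import complex.
From mathcomp Require Import all_classical all_reals all_analysis.

Set Implicit Arguments.
Unset Strict Implicit.
Unset Printing Implicit Defensive.

Import Order.TTheory GRing.Theory Num.Theory.
Import numFieldNormedType.Exports.

Local Open Scope classical_set_scope.
Local Open Scope ring_scope.

(* The n-dimensional Lebesgue measure on Borel sets is the n-fold product of
   [lebesgue_measure], transported along (a, x) |-> a :: x; [n.-tuple] carries the library's product sigma-algebra. *)
Section cons_measure.
Context {R : realType} d (T : measurableType d) (n : nat).
Variable lam : {sigma_finite_measure set T -> \bar R}.
Variable mu : {sigma_finite_measure set (n.-tuple T) -> \bar R}.

Definition cons_pair (p : T * n.-tuple T) : n.+1.-tuple T :=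
  [the n.+1.-tuple T of p.1 :: p.2].

Definition uncons (x : n.+1.-tuple T) : T * n.-tuple T :=
  (thead x, [tuple of behead x]).

Lemma cons_pairK : cancel cons_pair uncons.
Proof. by case=> a x; congr pair; apply/val_inj. Qed.

Lemma unconsK : cancel uncons cons_pair.
Proof. by move=> x; rewrite [RHS]tuple_eta; apply/val_inj. Qed.

Lemma measurable_cons_pair : measurable_fun setT cons_pair.
Proof. exact: measurable_cons. Qed.

Lemma measurable_uncons : measurable_fun setT uncons.
Proof.
apply/measurable_fun_pair; first exact: measurable_tnth.
exact: measurable_behead.
Qed.

Definition cons_measure : set (n.+1.-tuple T) -> \bar R :=
  pushforward (lam \x mu)%E cons_pair.

Let preimage_cons_pair (A : set (n.+1.-tuple T)) :
  measurable A -> measurable (cons_pair @^-1` A).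
Proof. by move=> mA; rewrite -[X in measurable X]setTI; exact: measurable_cons_pair. Qed.

Let cons_measure0 : cons_measure set0 = 0%E.
Proof. by rewrite /cons_measure /pushforward preimage_set0 measure0. Qed.

Let cons_measure_ge0 A : (0 <= cons_measure A)%E.
Proof. by rewrite /cons_measure /pushforward; exact: measure_ge0. Qed.

Let cons_measure_sigma_additive : semi_sigma_additive cons_measure.
Proof.
move=> F mF tF mUF; rewrite /cons_measure /pushforward preimage_bigcup.
apply: measure_semi_sigma_additive.
- by move=> k; exact: preimage_cons_pair.
- apply/trivIsetP => /= i j _ _ ij; rewrite -preimage_setI.
  by move/trivIsetP : tF => /(_ _ _ _ _ ij) ->//; rewrite preimage_set0.
- by rewrite -preimage_bigcup; exact: preimage_cons_pair.
Qed.

HB.instance Definition _ := isMeasure.Build _ _ _ cons_measure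
  cons_measure0 cons_measure_ge0 cons_measure_sigma_additive.

Let cons_measure_sigma_finite : sigma_finite setT cons_measure.
Proof.
have /sigma_finiteP[F [TF ndF Foo]] := sigma_finiteT lam.
have /sigma_finiteP[G [TG ndG Goo]] := sigma_finiteT mu.
exists (fun k => uncons @^-1` (F k `*` G k)).
  apply/esym; rewrite -subTset => x _.
  have [i _ Fi] : (\bigcup_i F i) (uncons x).1 by rewrite -TF.
  have [j _ Gj] : (\bigcup_i G i) (uncons x).2 by rewrite -TG.
  exists (maxn i j) => //; split.
  - by move: Fi; exact/subsetPset/ndF/leq_maxl.
  - by move: Gj; exact/subsetPset/ndG/leq_maxr.
move=> k; have [mF Fk] := Foo k; have [mG Gk] := Goo k; split.
  rewrite -[X in measurable X]setTI; apply: measurable_uncons => //.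
  exact: measurableX.
rewrite /cons_measure /pushforward -comp_preimage (_ : _ \o _ = id); last first.
  by apply/funext => p; exact: cons_pairK.
rewrite preimage_id product_measure1E// lte_mul_pinfty// ge0_fin_numE//.
Qed.

HB.instance Definition _ := Measure_isSigmaFinite.Build _ _ _ cons_measure
  cons_measure_sigma_finite.

End cons_measure.

Fixpoint borel_lebesgue (R : realType) (n : nat) :
    {sigma_finite_measure set (n.-tuple (measurableTypeR R)) -> \bar R} :=
  match n return
    {sigma_finite_measure set (n.-tuple (measurableTypeR R)) -> \bar R} with
  | 0 => [the {sigma_finite_measure set _ -> \bar R} of
           \d_([tuple] : 0.-tuple (measurableTypeR R))]
  | n'.+1 => [the {sigma_finite_measure set _ -> \bar R} of
               cons_measure (@lebesgue_measure R) (borel_lebesgue R n')]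
  end.

(* R^n equipped with the (complete) sigma-algebra of Lebesgue measurable sets:
   the Caratheodory-measurable sets of the Lebesgue outer measure. *)
Definition Rn (R : realType) (n : nat) :=
  caratheodory_type (mu_ext (borel_lebesgue R n)).

HB.instance Definition _ (R : realType) (n : nat) := Measurable.on (Rn R n).

Definition lebesgue (R : realType) (n : nat) : set (Rn R n) -> \bar R :=
  @completed_measure_extension _ _ _ (borel_lebesgue R n).

HB.instance Definition _ (R : realType) (n : nat) :=
  Measure.on (@lebesgue R n).

Section euclidean.
Context {R : realType} {n : nat}.
Implicit Types x y : n.-tuple R.

Definition vsub x y : n.-tuple R := [tuple tnth x i - tnth y i | i < n].

Definition inner x y : R := \sum_(i < n) tnth x i * tnth y i.

Definition enorm x : R := Num.sqrt (inner x x).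

End euclidean.

Definition cintegral d (T : measurableType d) (R : realType)
    (mu : {measure set T -> \bar R}) (f : T -> R[i]) : R[i] :=
  Complex (\int[mu]_x complex.Re (f x)) (\int[mu]_x complex.Im (f x)).

(* e^{i theta} *)
Definition expi (R : realType) (theta : R) : R[i] :=
  Complex (cos theta) (sin theta).

Section fractional.
Context {R : realType} {n : nat}.
Local Notation leb := (@lebesgue R n).

(* [complex.Re] only changes the type from R[i] to R: the integral is real
   because the imaginary part of the integrand is odd in xi. *)
Definition heat_kernel (s : R) (z : Rn R n) (t : R) : R :=
  complex.Re
    ((((2 * pi) ^- n)%:C * cintegral leb (fun xi : Rn R n =>
       (expR (- t * enorm xi `^ (2 * s)))%:C * expi (inner z xi)))%C).

Definition heat_content (s t : R) (E : set (Rn R n)) : \bar R :=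
  (\int[leb]_(x in E) \int[leb]_(y in ~` E)
     (heat_kernel s (vsub x y) t)%:E)%E.

(* The fractional perimeter P_{2s}.  Division by zero never occurs since
   x and y range over disjoint sets. *)
Definition fractional_perimeter (s : R) (E : set (Rn R n)) : \bar R :=
  (\int[leb]_(y in E) \int[leb]_(x in ~` E)
     (1 / (enorm (vsub x y) `^ (n%:R + 2 * s)))%:E)%E.

End fractional.

(* Main.v *)
From HB Require Import structures.
Require Import Defs.
From mathcomp Require Import all_boot all_order all_algebra.
From mathcomp Require Import ring lra.
From mathcomp Require Import all_classical all_reals all_analysis measurable_realfun.
Import Order.TTheory GRing.Theory Num.Theory.
Import numFieldNormedType.Exports.
Set Implicit Arguments.
Unset Strict Implicit.
Unset Printing Implicit Defensive.
Local Open Scope classical_set_scope.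
Local Open Scope ring_scope.

(** Write [q = |xi|^2], and let [p_d] be the Gaussian heat kernel at time [d], so that
    [(2 pi)^n p_d(z)] is the integral of [e^(-d q) cos <z, xi>] over [xi]. Put
    [theta(y) = y^(-1/s)]. Integration over [y > 0] and scaling give, with constants
    [kappa, C > 0] ([bernstein], [exists_jump_constant]),
      [int (1 - e^(-theta(y) q)) dy = kappa q^s],
      [int p_(theta(y))(z) dy = C / |z|^(n + 2 s)].
    Hence [kappa q^s] is the limit of [N - nu_N], where [nu_N] is the integral of
    [e^(-theta(y) q)] over [0 < y <= N], and [e^(-t kappa q^s)] is the limit of
    [e^(-t N) e^(t nu_N)]. The exponential series of [t nu_N] has nonnegative coefficients
    and its powers are positive mixtures of Gaussian symbols: this exhibits the fractional
    heat kernel as a limit of positive mixtures of the [p_d], and every estimate is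
    obtained from the Gaussian one by following this construction.

    The estimates are carried by a class of symbols [f]. Let [D] be a set of pairs
    [(x, y)] and [g] a bound for the Gaussian contents, that is, the integrals of
    [(2 pi)^n p_d(x - y)] over [D]. The symbol [f] is [admissible] with constants [A] and
    [M] if for all [d > 0] the transform of [e^(-d q) f] is nonnegative and its integral
    over [D] is at most [A g(d) + M]. The damping [e^(-d q)] makes every integral over
    [xi] converge. The class is stable under sums, nonnegative multiples and bounded
    limits. It is also stable under multiplication by [nu_N], as soon as
    [g(d + d') <= g(d) + g(d')]: the cost is [G], a bound for the integral of
    [g(theta(y))]. This subadditivity holds for [D = E x E^c]
    ([gaussian_content_subadditive]): in the convolution [p_d * p_d'] a two-step path from
    [E] to its complement crosses between the two sets in one of its steps.

    If the perimeter is finite, [G] is a multiple of it. The [j]-th power of [nu_N] costs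
    at most [j N^(j-1) G], so that [e^(t nu_N)] costs at most [t G e^(t N)] and
    [e^(-t kappa q^s)] at most [t G], with [A = 1]. Moreover [g(d)] is at most a constant
    times [d^s], so the damping can be removed by letting [d] tend to [0]: the heat
    content is bounded by a constant times [t] for every [t > 0]
    ([heat_content_le_perimeter]).

    Conversely, removing the linear term of the exponential series leaves nonnegative
    coefficients, so that [e^(-t kappa q^s) - t nu_N e^(-t (kappa q^s + nu_N))] still has a
    nonnegative transform. Dividing by [t] and letting [t] tend to [0], the kernel divided
    by [t] is asymptotically at least the transform of [nu_N], which is [(2 pi)^n] times
    the integral of [p_(theta(y))] over [0 < y <= N]. Fatou's lemma transfers the bound on
    the heat contents to these integrals over [E x E^c], uniformly in [N], and [N] tending
    to infinity gives the perimeter ([fractional_perimeter_lty]). *)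

(** * Gaussian integrals on the line *)

Section real_line.
Context {R : realType}.
Local Notation mu := (@lebesgue_measure R).

Lemma measurable_affine (c d : R) :
  measurable_fun [set: measurableTypeR R] (fun x : measurableTypeR R => c * x + d : measurableTypeR R).
Proof.
by apply: measurable_funD => //; apply: measurable_funM.
Qed.

Lemma ge0_integral_affine (c d : R) (f : measurableTypeR R -> \bar R) :
  0 < c -> measurable_fun setT f -> (forall x, 0 <= f x)%E ->
  (\int[mu]_x f (c * x + d)%R = c^-1%:E * \int[mu]_x f x)%E.
Proof.
move=> c0 mf f0.
pose phi (x : measurableTypeR R) : measurableTypeR R := c * x + d.
have mphi : measurable_fun setT phi by exact: measurable_affine.
pose m : {measure set (measurableTypeR R) -> \bar R} :=
  mscale (NngNum (ltW c0)) (pushforward mu phi).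
have mE A : measurable A -> mu A = m mphi A.
  apply: lebesgue_measure_unique => X [[a b] _ <-] /=.
  rewrite /m /= /mscale/= /pushforward.
  have -> : (phi @^-1` `]a, b]) = `](a - d) / c, (b - d) / c]%classic.
    apply/seteqP; split => x /=; rewrite !in_itv/= ltr_pdivrMr// ler_pdivlMr//;
    by rewrite ltrBlDr lerBrDr (mulrC x).
  rewrite !lebesgue_measure_itv/= !lte_fin ltr_pM2r ?invr_gt0// ltrD2r.
  case: ifPn => _; last by rewrite mule0.
  by rewrite -!EFinB -EFinM; congr EFin; field; rewrite gt_eqF.
rewrite [in RHS](eq_measure_integral (m mphi)); last by move=> A mA _; exact: mE.
rewrite ge0_integral_mscale//= ge0_integral_pushforward//=.
by rewrite muleA -EFinM mulVf ?gt_eqF// mul1e preimage_setT; exact: eq_integral.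
Qed.

Lemma integrable_oneDsqrV : mu.-integrable setT (fun x : R => ((oneDsqr x)^-1)%:E).
Proof.
apply/integrableP; split.
  apply/measurable_EFinP; apply: continuous_measurable_fun.
  exact: continuous_oneDsqrV.
rewrite (eq_integral (fun x : measurableTypeR R => ((oneDsqr (x : R))^-1)%:E)); last first.
  by move=> x _; rewrite gee0_abs// lee_fin invr_ge0 oneDsqr_ge0.
rewrite ge0_symfun_integralT//.
- rewrite (_ : [set x | _] = `[0, +oo[%classic); last first.
    by apply/seteqP; split => x/=; rewrite in_itv/= andbT.
  by rewrite integral0y_oneDsqr -EFinM ltry.
- exact: continuous_oneDsqrV.
- by move=> x /=; rewrite /oneDsqr sqrrN.
Qed.

Lemma integral_gauss (tau m : R) : 0 < tau ->
  (\int[mu]_x (expR (- (tau * (x - m) ^+ 2)))%:E = (Num.sqrt (pi / tau))%:E)%E.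
Proof.
move=> t0.
have st0 : 0 < Num.sqrt tau by rewrite sqrtr_gt0.
rewrite (_ : Num.sqrt (pi / tau) = (Num.sqrt tau)^-1 * Num.sqrt pi); last first.
  by rewrite sqrtrM ?pi_ge0// sqrtrV 1?mulrC// ltW.
rewrite EFinM -integralT_gauss.
rewrite -(@ge0_integral_affine _ (- (Num.sqrt tau * m)) (fun x => (gauss_fun x)%:E))//.
- apply: eq_integral => x _; rewrite /gauss_fun; congr (expR _)%:E.
  by rewrite -mulrBr exprMn sqr_sqrtr// ltW.
- by apply/measurable_EFinP; exact: measurable_gauss_fun.
- by move=> x; rewrite lee_fin gauss_fun_ge0.
Qed.

(** The fundamental theorem on the intervals [[-n, n]], and dominated convergence. *)
Lemma integral_derive_eq0 (h h' : R -> R) :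
  (forall x : R, is_derive x 1 h (h' x)) -> continuous h' ->
  mu.-integrable setT (EFin \o h') ->
  h n.+1%:R @[n --> \oo] --> (0 : R) -> h (- n.+1%:R) @[n --> \oo] --> (0 : R) ->
  (\int[mu]_x (h' x)%:E = 0)%E.
Proof.
move=> dh ch' ih' hp hn.
pose I n : set (measurableTypeR R) := `[- n.+1%:R, n.+1%:R]%classic.
have mh' : measurable_fun [set: R] h' by exact: continuous_measurable_fun.
have E n : (\int[mu]_x ((EFin \o h') \_ (I n)) x = (h n.+1%:R - h (- n.+1%:R))%:E)%E.
  rewrite -integral_mkcond (@continuous_FTC2 _ h' h)//.
  - by rewrite -subr_gt0 opprK addr_gt0.
  - exact: continuous_subspaceT.
  - have ch : continuous h.
      by move=> x; apply/differentiable_continuous/derivable1_diffP; apply: ex_derive.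
    split=> [x _||]; first exact: ex_derive.
      exact/cvg_at_right_filter/ch.
    exact/cvg_at_left_filter/ch.
  - by move=> x _; rewrite derive1E; apply: derive_val.
have C1 : (\int[mu]_x ((EFin \o h') \_ (I n)) x)%E @[n --> \oo] --> (\int[mu]_x (h' x)%:E)%E.
  apply: (@dominated_cvg _ _ _ mu setT measurableT _ _ (abse \o (EFin \o h'))) => //.
  - move=> n; apply/(measurable_restrictT _ _).1; first exact: measurable_itv.
    by apply/measurable_EFinP; apply: measurable_funTS.
  - move=> x _; apply: cvg_near_cst.
    exists (Num.trunc `|x|) => // n /= xn.
    rewrite patchE mem_set//= /I /= in_itv/= -ler_norml.
    apply: (@le_trans _ _ (Num.trunc `|x|).+1%:R); first exact/ltW/truncnS_gt.
    by rewrite ler_nat.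
  - exact: integrable_abse.
  - by move=> n x _; rewrite patchE; case: ifPn => //= _; rewrite normr0 lee_fin.
apply/(cvg_unique _ C1); first exact: ereal_hausdorff.
rewrite /mkset; under eq_cvg do rewrite E.
apply: cvg_EFin; first exact: nearW.
by rewrite -[X in _ --> X](subr0 (0 : R)); exact: cvgB.
Qed.

Lemma integrable_gauss (tau : R) : 0 < tau ->
  mu.-integrable setT (fun x => (expR (- (tau * x ^+ 2)))%:E).
Proof.
move=> t0; apply/integrableP; split.
  apply/measurable_EFinP; apply: measurableT_comp => //.
  by apply: measurableT_comp => //; apply: measurable_funM => //; exact: measurable_funX.
rewrite (eq_integral (fun x : measurableTypeR R => (expR (- (tau * (x - 0) ^+ 2)))%:E)).
  by rewrite integral_gauss// ltry.
by move=> x _; rewrite gee0_abs ?subr0// lee_fin expR_ge0.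
Qed.

(** As a function of [z], the integral [F] satisfies [F' = - (z / (2 * tau)) * F]:
    differentiate under the integral sign and integrate by parts. The phase [phi] lets
    the formula be used one coordinate at a time in several variables. *)
Lemma gauss_fourier (tau z phi : R) : 0 < tau ->
  (\int[mu]_x (expR (- (tau * x ^+ 2)) * cos (z * x + phi))%:E =
   (cos phi * Num.sqrt (pi / tau) * expR (- z ^+ 2 / (4 * tau)))%:E)%E.
Proof.
move=> t0.
pose e (x : R) := expR (- (tau * x ^+ 2)).
pose f (z x : R) := e x * cos (z * x + phi).
pose f' (z x : R) := - (x * e x * sin (z * x + phi)).
(* an integrable bound for the integrand and for its derivative in [z] *)
pose G (x : R) := (2 + 2 / tau) * expR (- (tau / 2 * x ^+ 2)).
have de (x : R) : is_derive x 1 e (- (2 * tau * x) * e x).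
  by rewrite /e; apply: is_derive_eq; rewrite /GRing.scale/=; ring.
have df (w x : R) : is_derive w 1 (f ^~ x) (f' w x).
  by rewrite /f; apply: is_derive_eq; rewrite /f' /GRing.scale/=; ring.
have dh (w x : R) : is_derive x 1 (fun x => e x * sin (w * x + phi)) 
   (- (2 * tau * x) * e x * sin (w * x + phi) + w * f w x).
  have ds : is_derive x 1 (fun x : R => sin (w * x + phi)) (w * cos (w * x + phi)).
    by apply: is_derive_eq; rewrite /GRing.scale/=; ring.
  apply: (is_derive_eq (is_deriveM (de x) ds)).
  by rewrite /f /GRing.scale/=; ring.
have ce : continuous e.
  by move=> x; apply/differentiable_continuous/derivable1_diffP; apply: ex_derive.
have e0 x : 0 <= e x by exact: expR_ge0.
have cl w : continuous (fun x : R => w * x + phi).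
  by move=> x; apply: cvgD; [apply: cvgMr; exact: cvg_id | exact: cvg_cst].
have cs w : continuous (fun x : R => sin (w * x + phi)).
  by move=> x; apply: (continuous_comp (cl w x)); exact: continuous_sin.
have cf w : continuous (f w).
  move=> x; apply: cvgM; first exact: ce.
  by apply: (continuous_comp (cl w x)); exact: continuous_cos.
have cf' w : continuous (f' w).
  move=> x; apply: cvgN; apply: cvgM; last exact: cs.
  by apply: cvgM; [exact: cvg_id | exact: ce].
have G0 x : 0 <= G x by rewrite mulr_ge0 ?expR_ge0// addr_ge0// divr_ge0// ltW.
have iG : mu.-integrable setT (EFin \o G).
  rewrite (_ : _ \o _ = fun x : measurableTypeR R => (2 + 2 / tau)%:E * (expR (- (tau / 2 * x ^+ 2)))%:E)%E; last first.
    by apply/funext => x; rewrite -EFinM.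
  by apply: integrableZl => //; apply: integrable_gauss; rewrite divr_gt0.
have eG x : (1 + `|x|) * e x <= G x.
  rewrite /G /e; set u := tau / 2 * x ^+ 2.
  have -> : - (tau * x ^+ 2) = - u + - u by rewrite /u; field.
  rewrite expRD mulrA ler_wpM2r ?expR_ge0// -ler_pdivlMr ?expR_gt0// -expRN opprK.
  apply: (@le_trans _ _ ((2 + 2 / tau) * (1 + u))); last first.
    by rewrite ler_wpM2l ?expR_ge1Dx// addr_ge0// divr_ge0// ltW.
  have -> : (2 + 2 / tau) * (1 + u) = 2 + x ^+ 2 + (2 * u + 2 / tau).
    by rewrite /u; field; rewrite gt_eqF.
  rewrite ler_wpDr//.
    by rewrite addr_ge0// ?divr_ge0 ?(ltW t0)// mulr_ge0// mulr_ge0 ?sqr_ge0// divr_ge0// ltW.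
  have := sqr_ge0 (`|x| - 1); rewrite sqrrB real_normK ?num_real// mulr1 expr1n.
  have := normr_ge0 x; lra.
have fG w x : `|f w x| <= G x.
  apply: le_trans (eG x); rewrite /f normrM (ger0_norm (e0 x)) mulrC ler_wpM2r//.
  by rewrite (le_trans (cos_max _))// lerDl.
have f'G w x : `|f' w x| <= G x.
  apply: le_trans (eG x); rewrite /f' normrN normrM normrM (ger0_norm (e0 x)).
  rewrite -[leRHS]mulr1 ler_pM ?mulr_ge0 ?sin_max//.
  by rewrite ler_wpM2r// lerDr.
have i_f w : mu.-integrable setT (EFin \o f w).
  apply: (le_integrable _ _ _ iG) => //.
    by apply/measurable_EFinP; exact: continuous_measurable_fun.
  by move=> x _ /=; rewrite lee_fin (ger0_norm (G0 _)).
have i_f' w : mu.-integrable setT (EFin \o f' w).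
  apply: (le_integrable _ _ _ iG) => //.
    by apply/measurable_EFinP; exact: continuous_measurable_fun.
  by move=> x _ /=; rewrite lee_fin (ger0_norm (G0 _)).
pose F w := \int[mu]_x f w x.
have dF (w : R) : is_derive w 1 F (- (w / (2 * tau)) * F w).
  have Iw : (`]w - 1, w + 1[%classic : set R) w.
    by rewrite /= in_itv/= ltrBlDr ltrDl ltr01.
  have d1 v x : partial1of2 f v x = f' v x.
    by rewrite partial1of2E; apply: derive_val.
  apply: DeriveDef.
    apply: (@derivable_under_integral _ _ _ mu f setT measurableT w (w - 1) (w + 1) Iw _ _ G) => //.
    by move=> v x _ _; rewrite d1.
  rewrite -derive1E (@differentiation_under_integral _ _ _ mu f setT measurableT w (w - 1) (w + 1) Iw _ _ G) => //; last first.
    by move=> v x _ _; rewrite d1.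
  under eq_Rintegral do rewrite d1.
  have hlim (x : nat -> R) : (forall n, `|x n| = n.+1%:R) ->
      e (x n) * sin (w * x n + phi) @[n --> \oo] --> (0 : R).
    move=> xn; pose C : R := 2 + 2 / tau.
    have eC n : `|e (x n) * sin (w * x n + phi)| <= C * harmonic n.
      rewrite normrM (ger0_norm (e0 _)) /harmonic ler_pdivlMr; last first.
        by rewrite ltr0n.
      rewrite mulrAC; apply: (@le_trans _ _ ((1 + `|x n|) * e (x n))).
        rewrite -[leRHS]mulr1 ler_pM ?mulr_ge0// ?sin_max//.
        by rewrite mulrC ler_wpM2r// xn lerDr.
      apply: (le_trans (eG _)).
      rewrite /G -[leRHS]mulr1 ler_wpM2l//.
        by rewrite /C addr_ge0// divr_ge0// ltW.
      by rewrite -expR0 ler_expR oppr_le0 mulr_ge0 ?sqr_ge0// divr_ge0// ltW.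
    have C0 : C * harmonic n @[n --> \oo] --> (0 : R).
      by rewrite -[X in _ --> X](mulr0 C); apply: cvgMr; exact: cvg_harmonic.
    apply/norm_cvg0P; apply: (squeeze_cvgr _ (cvg_cst 0) C0).
    by apply: nearW => n; rewrite normr_ge0 eC.
  have i1 : mu.-integrable setT (EFin \o (fun x => 2 * tau * f' w x)).
    rewrite (_ : _ \o _ = fun x : measurableTypeR R => (2 * tau)%:E * (f' w x)%:E)%E.
      exact: (integrableZl measurableT _ (i_f' w)).
    by apply/funext => x; rewrite -EFinM.
  have i2 : mu.-integrable setT (EFin \o (fun x => w * f w x)).
    rewrite (_ : _ \o _ = fun x : measurableTypeR R => w%:E * (f w x)%:E)%E.
      exact: (integrableZl measurableT _ (i_f w)).
    by apply/funext => x; rewrite -EFinM.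
  have dh' (x : R) : is_derive x 1 (fun x => e x * sin (w * x + phi))
      (2 * tau * f' w x + w * f w x).
    by apply: (is_derive_eq (dh w x)); rewrite /f'; ring.
  have H := integral_derive_eq0 dh'.
  have : 2 * tau * (\int[mu]_x f' w x) + w * F w = 0.
    rewrite /F -!RintegralZl// -RintegralD//.
    rewrite /Rintegral H//.
    + by move=> x; apply: cvgD; apply: cvgMr; [exact: cf' | exact: cf].
    + rewrite (_ : _ \o _ = ((EFin \o (fun x => 2 * tau * f' w x)%R) \+ (EFin \o (fun x => w * f w x)%R))%E).
        by apply: integrableD => //.
      by apply/funext => x /=; rewrite -EFinD.
    + by apply: hlim => n; rewrite ger0_norm.
    + by apply: hlim => n; rewrite normrN ger0_norm.
  have t0' : tau != 0 by rewrite gt_eqF.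
  move=> H2; apply: (@mulfI _ (2 * tau)); first by rewrite mulf_neq0.
  have -> : 2 * tau * (- (w / (2 * tau)) * F w) = - (w * F w) by field.
  by move: H2; lra.
(* the differential equation says that this function is constant *)
pose K w := F w * expR (w ^+ 2 / (4 * tau)).
have dK (w : R) : is_derive w 1 K 0.
  have dE : is_derive w 1 (fun w : R => expR (w ^+ 2 / (4 * tau)))
      (w / (2 * tau) * expR (w ^+ 2 / (4 * tau))).
    by apply: is_derive_eq; rewrite /GRing.scale/=; field; rewrite gt_eqF.
  by apply: (is_derive_eq (is_deriveM (dF w) dE)); rewrite /GRing.scale/=; ring.
have KE : K z = K 0.
  by apply: is_derive_0_is_cst.
have F0 : F 0 = cos phi * Num.sqrt (pi / tau).
  rewrite /F /f /Rintegral.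
  rewrite (eq_integral (fun x : measurableTypeR R => (cos phi)%:E * (expR (- (tau * (x - 0) ^+ 2)))%:E)%E); last first.
    by move=> x _; rewrite mul0r add0r mulrC EFinM /e subr0.
  rewrite integralZl//; first by rewrite integral_gauss.
  by under eq_fun do rewrite subr0; exact: integrable_gauss.
have -> : (\int[mu]_x (expR (- (tau * x ^+ 2)) * cos (z * x + phi))%:E)%E = (F z)%:E.
  by rewrite /F /Rintegral fineK//; exact: (integrable_fin_num measurableT (i_f z)).
rewrite -F0 mulNr; congr EFin; move: KE.
rewrite /K expr0n mul0r expR0 mulr1 => <-.
by rewrite -mulrA -expRD subrr expR0 mulr1.
Qed.
End real_line.

(** * Lebesgue integrals over n-tuples *)

Section lebesgue_tuples.
Context {R : realType}.
Local Notation mu := (@lebesgue_measure R).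
Local Notation TR := (measurableTypeR R).
Local Notation leb n := (@lebesgue R n).

Lemma lebesgue_sigma_finite n : sigma_finite setT (leb n).
Proof. exact/completed_measure_extension_sigma_finite/sigma_finiteT. Qed.

HB.instance Definition _ n := Measure_isSigmaFinite.Build _ _ _ (leb n) (lebesgue_sigma_finite n).

(** The identity, from the Caratheodory sigma-algebra to the Borel one: integrals of Borel
    functions for the completed measure are computed on the product measure through it. *)
Definition borel_of n (x : Rn R n) : n.-tuple TR := x.

Lemma measurable_borel_of n : measurable_fun setT (@borel_of n).
Proof.
move=> _ B mB; rewrite setTI; apply: caratheodory_measurable_mu_ext mB.
Qed.

Lemma pushforward_borel_of n (A : set (n.-tuple TR)) : measurable A ->
  borel_lebesgue R n A = pushforward (leb n) (@borel_of n) A.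
Proof. by move=> mA; rewrite /pushforward /lebesgue /completed_measure_extension measurable_mu_extE. Qed.

Lemma ge0_integral_lebesgue n (f : n.-tuple TR -> \bar R) :
  measurable_fun setT f -> (forall x, 0 <= f x)%E ->
  (\int[leb n]_x f x = \int[borel_lebesgue R n]_x f x)%E.
Proof.
move=> mf f0.
pose m : {measure set (n.-tuple TR) -> \bar R} := pushforward (leb n) (@borel_of n).
transitivity (\int[m (@measurable_borel_of n)]_x f x)%E; last first.
  apply: eq_measure_integral => A mA _; exact/esym/pushforward_borel_of.
exact/esym/(ge0_integral_pushforward (@measurable_borel_of n)).
Qed.

Lemma ge0_integral_lebesgueS n (f : n.+1.-tuple TR -> \bar R) :
  measurable_fun setT f -> (forall x, 0 <= f x)%E ->
  (\int[leb n.+1]_x f x = \int[mu]_a \int[leb n]_x f (cons_pair (a, x)))%E.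
Proof.
move=> mf f0.
have mc := @measurable_cons_pair _ TR n.
have mfc : measurable_fun setT (f \o @cons_pair _ TR n) by exact: measurableT_comp.
rewrite ge0_integral_lebesgue//.
transitivity (\int[(mu \x borel_lebesgue R n)%E]_p (f \o @cons_pair _ TR n) p)%E.
  exact: (ge0_integral_pushforward mc).
rewrite fubini_tonelli1//; last by move=> p /=.
apply: eq_integral => a _; rewrite /fubini_F [RHS](@ge0_integral_lebesgue n (fun x => f (cons_pair (a, x))))//.
exact: (measurableT_comp mfc (measurable_pair1 _)).
Qed.

Lemma ge0_integral_lebesgue0 (f : 0.-tuple TR -> \bar R) :
  (forall x, 0 <= f x)%E -> (\int[leb 0]_x f x = f [tuple])%E.
Proof.
move=> f0.
have fE : f = cst (f [tuple]) by apply/funext => x /=; rewrite (tuple0 x).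
have mf : measurable_fun setT f by rewrite fE.
rewrite ge0_integral_lebesgue// /= integral_dirac// diracT mul1e//.
Qed.

Lemma inner_cons n (z : n.+1.-tuple R) (a : R) (x : n.-tuple R) :
  inner z (cons_pair (a, x)) = tnth z ord0 * a + inner [tuple of behead z] x.
Proof.
rewrite /inner big_ord_recl tnth0; congr (_ + _); apply: eq_bigr => i _.
by rewrite tnth_behead tnthS (_ : inord i.+1 = lift ord0 i)//; apply/val_inj; rewrite /= inordK// ltnS ltn_ord.
Qed.

Lemma inner_cons_self n (a : R) (x : n.-tuple R) :
  inner (cons_pair (a, x)) (cons_pair (a, x)) = a ^+ 2 + inner x x.
Proof.
rewrite inner_cons tnth0 expr2; congr (_ + inner _ _).
by apply: val_inj.
Qed.

Lemma measurable_inner d (T : measurableType d) n (u v : T -> n.-tuple R) :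
  (forall i, measurable_fun setT (fun x => tnth (u x) i)) ->
  (forall i, measurable_fun setT (fun x => tnth (v x) i)) ->
  measurable_fun setT (fun x => inner (u x) (v x)).
Proof.
move=> mu_ mv; rewrite /inner.
apply: (@measurable_sum _ _ R setT _ (index_enum _) (fun i x => tnth (u x) i * tnth (v x) i)).
by move=> i; exact: measurable_funM.
Qed.

Lemma measurable_tnth_tuple n (i : 'I_n) : measurable_fun setT (fun x : n.-tuple TR => tnth x i : R).
Proof. exact: measurable_tnth. Qed.

Lemma measurable_tnth_Rn n (i : 'I_n) : measurable_fun setT (fun x : Rn R n => tnth x i : R).
Proof. exact: (measurableT_comp (@measurable_tnth_tuple n i) (@measurable_borel_of n)). Qed.

Lemma measurable_inner_tuple n (z : n.-tuple R) :
  measurable_fun setT (fun x : n.-tuple TR => inner z x).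
Proof. by apply: measurable_inner => i //; exact: measurable_tnth_tuple. Qed.

Lemma measurable_sqnorm_tuple n :
  measurable_fun setT (fun x : n.-tuple TR => inner x x : R).
Proof. by apply: measurable_inner => i //; exact: measurable_tnth_tuple. Qed.

Lemma measurable_cos : measurable_fun setT (@cos R).
Proof. by apply: continuous_measurable_fun; exact: continuous_cos. Qed.

(** Adding 1 to the cosine makes the integrand nonnegative, so that Tonelli's theorem
    applies at each step of the induction on the dimension; integrating out one
    coordinate only changes the phase. *)
Lemma integral_gauss1cos n (tau phi : R) (z : n.-tuple R) : 0 < tau ->
  (\int[leb n]_x (expR (- (tau * inner x x)) * (1 + cos (inner z x + phi)))%:E =
   (Num.sqrt (pi / tau) ^+ n * (1 + cos phi * expR (- inner z z / (4 * tau))))%:E)%E.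
Proof.
move=> t0.
have g0 m (y : m.-tuple R) ph (x : m.-tuple TR) :
    (0 <= (expR (- (tau * inner x x)) * (1 + cos (inner y x + ph)))%:E)%E.
  rewrite lee_fin mulr_ge0 ?expR_ge0//.
have mg m (y : m.-tuple R) ph : measurable_fun setT (fun x : m.-tuple TR =>
    (expR (- (tau * inner x x)) * (1 + cos (inner y x + ph)))%:E).
  apply/measurable_EFinP; apply: measurable_funM.
    by do 2 apply: measurableT_comp => //; apply: measurable_funM => //; exact: measurable_sqnorm_tuple.
  apply: measurable_funD => //; apply: (measurableT_comp measurable_cos).
  by apply: measurable_funD => //; exact: measurable_inner_tuple.
elim: n phi z => [|n IH] phi z.
  by rewrite ge0_integral_lebesgue0// /inner !big_ord0 mulr0 oppr0 mul0r add0r expR0 mul1r mulr1 expr0 mul1r.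
pose z' : n.-tuple R := [tuple of behead z].
pose z0 := tnth z ord0.
pose E := expR (- inner z' z' / (4 * tau)).
pose C := Num.sqrt (pi / tau).
have zz : inner z z = z0 ^+ 2 + inner z' z'.
  have -> : z = cons_pair (z0, z').
    by apply: val_inj; rewrite /= /z0 [in LHS](tuple_eta z) /thead.
  by rewrite inner_cons_self.
rewrite ge0_integral_lebesgueS//.
transitivity (\int[mu]_a ((C ^+ n)%:E * ((expR (- (tau * a ^+ 2)))%:E + E%:E * (expR (- (tau * a ^+ 2)) * cos (z0 * a + phi))%:E)))%E.
  apply: eq_integral => a _.
  transitivity (\int[leb n]_x ((expR (- (tau * a ^+ 2)))%:E *
     (expR (- (tau * inner x x)) * (1 + cos (inner z' x + (z0 * a + phi))))%:E))%E.
    apply: eq_integral => x _.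
    rewrite inner_cons_self inner_cons (mulrDr tau) opprD expRD -EFinM -[in LHS]mulrA.
    by congr (_ * (_ * (1 + cos _)))%:E; rewrite /z0 /z'; ring.
  have mgR : measurable_fun setT (fun x : Rn R n =>
      (expR (- (tau * inner x x)) * (1 + cos (inner z' x + (z0 * a + phi))))%:E).
    exact: (measurableT_comp (mg n z' _) (@measurable_borel_of n)).
  rewrite ge0_integralZl//; [|by rewrite lee_fin expR_ge0..].
  by rewrite IH -(EFinM E) -EFinD -!EFinM; congr EFin; rewrite -/C -/E; ring.
have ig := integrable_gauss t0.
have ic : mu.-integrable setT (fun a : TR => (expR (- (tau * a ^+ 2)) * cos (z0 * a + phi))%:E).
  apply: le_integrable ig => //.
    apply/measurable_EFinP; apply: measurable_funM.
      by do 2 apply: measurableT_comp => //; apply: measurable_funM => //; exact: measurable_funX.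
    apply: (measurableT_comp measurable_cos).
    by apply: measurable_funD => //; apply: measurable_funM.
  move=> a _; rewrite /= lee_fin normrM -[leRHS]mulr1 ler_pM// ?cos_max//.
have iE : mu.-integrable setT (fun a : TR => E%:E * (expR (- (tau * a ^+ 2)) * cos (z0 * a + phi))%:E)%E.
  exact: integrableZl.
rewrite integralZl//=; last exact: integrableD.
rewrite integralD//= integralZl// gauss_fourier//.
have := integral_gauss 0 t0.
rewrite (eq_integral (fun x : TR => (expR (- (tau * x ^+ 2)))%:E)); last by move=> a _; rewrite subr0.
move=> ->; rewrite -(EFinM E) -EFinD -EFinM; congr EFin.
rewrite zz -/C (exprSr C).
have -> : - (z0 ^+ 2 + inner z' z') / (4 * tau) = - z0 ^+ 2 / (4 * tau) + - inner z' z' / (4 * tau) by ring.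
by rewrite expRD -/E; ring.
Qed.

Lemma ge0_integral_lebesgue_prod n (u : 'I_n -> R -> R) (I : 'I_n -> R) :
  (forall i, measurable_fun setT (u i)) -> (forall i a, 0 <= u i a) ->
  (forall i, \int[mu]_a (u i a)%:E = (I i)%:E)%E ->
  (\int[leb n]_x (\prod_(i < n) u i (tnth x i))%:E = (\prod_(i < n) I i)%:E)%E.
Proof.
elim: n u I => [|n IH] u I mui u0 uI.
  by rewrite ge0_integral_lebesgue0; [rewrite !big_ord0|move=> x; rewrite big_ord0].
have mP m (v : 'I_m -> R -> R) : (forall i, measurable_fun setT (v i)) ->
    measurable_fun setT (fun x : m.-tuple TR => (\prod_(i < m) v i (tnth x i))%:E).
  move=> mv; apply/measurable_EFinP.
  apply: (@measurable_prod _ _ R setT _ (index_enum _) (fun i (x : m.-tuple TR) => v i (tnth x i))) => i _.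
  exact: (measurableT_comp (mv i) (@measurable_tnth_tuple m i)).
rewrite ge0_integral_lebesgueS//; last 2 first.
- exact: mP.
- by move=> x; rewrite lee_fin prodr_ge0.
pose u' i := u (lift ord0 i); pose I' i := I (lift ord0 i).
transitivity (\int[mu]_a ((\prod_(i < n) I' i)%:E * (u ord0 a)%:E))%E.
  apply: eq_integral => a _.
  transitivity (\int[leb n]_x ((u ord0 a)%:E * (\prod_(i < n) u' i (tnth x i))%:E))%E.
    apply: eq_integral => x _; rewrite -EFinM big_ord_recl tnth0.
    congr (_ * _)%:E; apply: eq_bigr => i _.
    by rewrite tnthS.
  have mu' i : measurable_fun setT (u' i) by exact: mui.
  have mu'R := measurableT_comp (mP n u' mu') (@measurable_borel_of n).
  rewrite ge0_integralZl//; [|by move=> x _; rewrite lee_fin prodr_ge0//= => i _; exact: u0|by rewrite lee_fin].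
  by rewrite (IH u' I') -?EFinM 1?mulrC// => i *; [exact: u0|exact: uI].
rewrite ge0_integralZl//=.
- by rewrite uI -EFinM big_ord_recl mulrC.
- by apply/measurable_EFinP; exact: mui.
- by move=> x _; rewrite lee_fin.
- rewrite lee_fin prodr_ge0// => i _.
  by rewrite -lee_fin -uI; apply: integral_ge0 => a _; rewrite lee_fin.
Qed.

(** * The Gaussian heat kernel *)

(** The Gaussian density of variance [2 * tau], as a function of the square [q] of
    the distance: time integrals are taken at a fixed [q], where only the one-variable
    scaling of this profile matters. *)
Definition gaussq n (tau q : R) : R := (Num.sqrt (4 * pi * tau)) ^- n * expR (- q / (4 * tau)).

Definition gaussk n (tau : R) (z : n.-tuple R) : R := gaussq n tau (inner z z).

Lemma gaussk_prod n tau (z : n.-tuple R) :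
  gaussk tau z = \prod_(i < n) ((Num.sqrt (4 * pi * tau))^-1 * expR (- (tnth z i ^+ 2 / (4 * tau)))).
Proof.
rewrite /gaussk /gaussq big_split/= prodr_const card_ord exprVn; congr (_ * _).
rewrite -expR_sum; congr expR; rewrite /inner mulNr mulr_suml sumrN; congr (- _).
Qed.

Lemma integral_gaussk1 (tau m : R) : 0 < tau ->
  (\int[mu]_a ((Num.sqrt (4 * pi * tau))^-1 * expR (- ((a - m) ^+ 2 / (4 * tau))))%:E = 1)%E.
Proof.
move=> t0; have p0 := pi_gt0 R.
have k0 : 0 < (4 * tau)^-1 by rewrite invr_gt0 mulr_gt0.
transitivity (\int[mu]_a (((Num.sqrt (4 * pi * tau))^-1)%:E * (expR (- ((4 * tau)^-1 * (a - m) ^+ 2)))%:E))%E.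
  by apply: eq_integral => a _; rewrite -EFinM mulrC mulrC (mulrC (4 * tau)^-1).
rewrite ge0_integralZl//=; last first.
  apply/measurable_EFinP; do 2 apply: measurableT_comp => //; apply: measurable_funM => //.
  by apply: measurable_funX; exact: measurable_funB.
rewrite integral_gauss// -EFinM; congr EFin.
rewrite (_ : pi / (4 * tau)^-1 = 4 * pi * tau); last by rewrite invrK mulrCA mulrA.
by rewrite mulVf// gt_eqF// sqrtr_gt0 !mulr_gt0.
Qed.

(** Completing the square in [w]. *)
Lemma gaussk1_conv (sigma tau a b : R) : 0 < sigma -> 0 < tau ->
  (\int[mu]_w ((Num.sqrt (4 * pi * sigma))^-1 * expR (- ((a - w) ^+ 2 / (4 * sigma))) *
     ((Num.sqrt (4 * pi * tau))^-1 * expR (- ((w - b) ^+ 2 / (4 * tau)))))%:E =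
   ((Num.sqrt (4 * pi * (sigma + tau)))^-1 * expR (- ((a - b) ^+ 2 / (4 * (sigma + tau)))))%:E)%E.
Proof.
move=> s0 t0; have p0 := pi_gt0 R.
have st0 : 0 < sigma + tau by rewrite addr_gt0.
pose k := sigma * tau / (sigma + tau).
have k0 : 0 < k by rewrite divr_gt0// mulr_gt0.
(* the minimum of the quadratic form in the exponent *)
pose m := (tau * a + sigma * b) / (sigma + tau).
pose C := (Num.sqrt (4 * pi * (sigma + tau)))^-1 * expR (- ((a - b) ^+ 2 / (4 * (sigma + tau)))).
transitivity (\int[mu]_w (C%:E * ((Num.sqrt (4 * pi * k))^-1 * expR (- ((w - m) ^+ 2 / (4 * k))))%:E))%E.
  apply: eq_integral => w _; rewrite -EFinM /C; congr EFin.
  rewrite [LHS]mulrACA [RHS]mulrACA.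
  rewrite -!invfM -!sqrtrM ?mulr_ge0 ?(ltW p0)// ?ltW// -!expRD.
  congr ((Num.sqrt _)^-1 * expR _).
    by rewrite /k; field; rewrite gt_eqF.
  by rewrite /k /m; field; rewrite !gt_eqF.
rewrite ge0_integralZl//=; last first.
- by rewrite lee_fin mulr_ge0 ?expR_ge0// invr_ge0 sqrtr_ge0.
- apply/measurable_EFinP; apply: measurable_funM => //; do 2 apply: measurableT_comp => //; apply: measurable_funM => //.
  by apply: measurable_funX; exact: measurable_funB.
by rewrite integral_gaussk1// mule1.
Qed.

Lemma integral_gaussk n (tau : R) (w : n.-tuple R) : 0 < tau ->
  (\int[leb n]_x (gaussk tau (vsub x w))%:E = 1)%E.
Proof.
move=> t0.
pose u (i : 'I_n) (a : R) := (Num.sqrt (4 * pi * tau))^-1 * expR (- ((a - tnth w i) ^+ 2 / (4 * tau))).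
have := @ge0_integral_lebesgue_prod n u (fun _ => 1).
rewrite big1// => <-//.
- by apply: eq_integral => x _; rewrite gaussk_prod; congr EFin; apply: eq_bigr => i _; rewrite tnth_mktuple.
- move=> i; apply: measurable_funM => //; do 2 apply: measurableT_comp => //; apply: measurable_funM => //.
  by apply: measurable_funX; exact: measurable_funB.
- by move=> i a; rewrite mulr_ge0 ?expR_ge0// invr_ge0 sqrtr_ge0.
- by move=> i; exact: integral_gaussk1.
Qed.

Lemma gaussk_conv n (sigma tau : R) (x y : n.-tuple R) : 0 < sigma -> 0 < tau ->
  (\int[leb n]_w (gaussk sigma (vsub x w) * gaussk tau (vsub w y))%:E =
   (gaussk (sigma + tau) (vsub x y))%:E)%E.
Proof.
move=> s0 t0.
pose v (a tau : R) := (Num.sqrt (4 * pi * tau))^-1 * expR (- (a ^+ 2 / (4 * tau))).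
have v0 a t : 0 <= v a t by rewrite mulr_ge0 ?expR_ge0// invr_ge0 sqrtr_ge0.
pose u (i : 'I_n) (a : R) := v (tnth x i - a) sigma * v (a - tnth y i) tau.
have := @ge0_integral_lebesgue_prod n u (fun i => v (tnth x i - tnth y i) (sigma + tau)).
have -> : \prod_(i < n) v (tnth x i - tnth y i) (sigma + tau) = gaussk (sigma + tau) (vsub x y).
  by rewrite gaussk_prod; apply: eq_bigr => i _; rewrite tnth_mktuple.
move=> <-//.
- apply: eq_integral => w _; rewrite !gaussk_prod -big_split/=.
  by congr EFin; apply: eq_bigr => i _; rewrite !tnth_mktuple.
- move=> i; apply: measurable_funM; apply: measurable_funM => //;
    do 2 apply: measurableT_comp => //; apply: measurable_funM => //;
    by apply: measurable_funX; exact: measurable_funB.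
- by move=> i a; exact: mulr_ge0.
- by move=> i; exact: gaussk1_conv.
Qed.

Lemma measurable_Rn n d (T : measurableType d) (f : n.-tuple TR -> T) :
  measurable_fun setT f -> measurable_fun setT (fun x : Rn R n => f x).
Proof. by move=> mf; exact: (measurableT_comp mf (@measurable_borel_of n)). Qed.

Lemma integrable_gauss_lebesgue n (tau : R) : 0 < tau ->
  (leb n).-integrable setT (fun x => (expR (- (tau * inner x x)))%:E) /\
  (\int[leb n]_x (expR (- (tau * inner x x)))%:E = (Num.sqrt (pi / tau) ^+ n)%:E)%E.
Proof.
move=> t0.
have E : (\int[leb n]_x (expR (- (tau * inner x x)))%:E = (Num.sqrt (pi / tau) ^+ n)%:E)%E.
  have := @ge0_integral_lebesgue_prod n (fun _ a => expR (- (tau * a ^+ 2))) (fun _ => Num.sqrt (pi / tau)).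
  rewrite prodr_const card_ord => <-//.
  - apply: eq_integral => x _; rewrite -expR_sum sumrN mulr_sumr; congr (expR (- _))%:E.
  - move=> i; do 2 apply: measurableT_comp => //; apply: measurable_funM => //; exact: measurable_funX.
  - move=> i; rewrite -(integral_gauss 0 t0); apply: eq_integral => a _; by rewrite subr0.
split => //; apply/integrableP; split.
  apply: measurable_Rn; apply/measurable_EFinP; do 2 apply: measurableT_comp => //.
  by apply: measurable_funM => //; exact: measurable_sqnorm_tuple.
rewrite (eq_integral (fun x : Rn R n => (expR (- (tau * inner x x)))%:E)); first by rewrite E ltry.
by move=> x _; rewrite gee0_abs// lee_fin expR_ge0.
Qed.

Lemma integral_gauss_fourier n (tau : R) (z : n.-tuple R) : 0 < tau ->
  (\int[leb n]_x (expR (- (tau * inner x x)) * cos (inner z x))%:E =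
   ((2 * pi) ^+ n * gaussk tau z)%:E)%E.
Proof.
move=> t0; have p0 := pi_gt0 R.
have [ig Eg] := integrable_gauss_lebesgue n t0.
have mc : measurable_fun setT (fun x : Rn R n => cos (inner z x)).
  exact: (measurable_Rn (measurableT_comp measurable_cos (measurable_inner_tuple z))).
have ic : (leb n).-integrable setT (fun x => (expR (- (tau * inner x x)) * cos (inner z x))%:E).
  apply: (le_integrable measurableT _ _ ig).
    apply/measurable_EFinP; apply: (measurable_funM _ mc).
    by apply/measurable_EFinP; exact: (measurable_int _ ig).
  by move=> x _; rewrite /= lee_fin normrM -[leRHS]mulr1 ler_pM ?normr_ge0 ?cos_max.
have := integral_gauss1cos 0 z t0.
rewrite (eq_integral (fun x : Rn R n => (expR (- (tau * inner x x)))%:E + (expR (- (tau * inner x x)) * cos (inner z x))%:E)%E); last first.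
  by move=> x _; rewrite -EFinD addr0 mulrDr mulr1.
rewrite (integralD measurableT ig ic) Eg cos0 mulrDr mulr1 mul1r EFinD.
move/(congr1 (fun y => y - (Num.sqrt (pi / tau) ^+ n)%:E)%E).
rewrite addeAC subee// add0e addeAC subee// add0e => ->.
rewrite /gaussk /gaussq mulrA -exprVn -exprMn; congr (_ ^+ _ * _)%:E.
have sq0 : 0 < Num.sqrt (4 * pi * tau) by rewrite sqrtr_gt0 !mulr_gt0.
apply: (mulIf (lt0r_neq0 sq0)); rewrite divfK ?gt_eqF// -sqrtrM ?divr_ge0 ?ltW//.
rewrite (_ : pi / tau * (4 * pi * tau) = (2 * pi) ^+ 2); last by field; rewrite gt_eqF.
by rewrite sqrtr_sqr ger0_norm// mulr_ge0// ltW.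
Qed.

Lemma enorm_powR n (x : n.-tuple R) (s : R) : enorm x `^ (2 * s) = inner x x `^ s.
Proof.
have i0 : 0 <= inner x x by rewrite sumr_ge0// => i _; rewrite -expr2 sqr_ge0.
rewrite /enorm -powR12_sqrt// -powRrM; by congr (_ `^ _); field.
Qed.

Lemma inner_ge0 n (x : n.-tuple R) : 0 <= inner x x.
Proof. by rewrite sumr_ge0// => i _; rewrite -expr2 sqr_ge0. Qed.

(** The exponential series dominates any power of its argument, in particular one above [a ^+ 2]. *)
Lemma expR_powR_le_oneDsqrV (c s : R) : 0 < c -> 0 < s ->
  exists C, 0 <= C /\ forall a : R, expR (- (c * (a ^+ 2) `^ s)) <= C * (oneDsqr a)^-1.
Proof.
move=> c0 s0.
pose k := Num.trunc s^-1.
have sk : 1 <= s * k.+1%:R.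
  rewrite -ler_pdivrMl// mulr1; apply/ltW/truncnS_gt.
exists (2 + 2 * (k.+1)`!%:R / c ^+ k.+1); split.
  by rewrite addr_ge0// divr_ge0// exprn_ge0// ltW.
move=> a; rewrite -ler_pdivrMr ?invr_gt0 ?oneDsqr_gt0// invrK.
set u := c * _; have u0 : 0 <= u by rewrite mulr_ge0 ?powR_ge0// ltW.
rewrite mulrC expRN ler_pdivrMr ?expR_gt0//.
apply: (@le_trans _ _ ((2 + 2 * (k.+1)`!%:R / c ^+ k.+1) * (1 + u ^+ k.+1 / (k.+1)`!%:R))); last first.
  by rewrite ler_wpM2l ?expR_ge1Dxn// addr_ge0// divr_ge0// exprn_ge0// ltW.
have F0 : (0 : R) < (k.+1)`!%:R by rewrite ltr0n fact_gt0.
have cu : u ^+ k.+1 = c ^+ k.+1 * (a ^+ 2) `^ (s * k.+1%:R).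
  by rewrite /u exprMn -(powR_mulrn _ (powR_ge0 _ _)) -powRrM.
have -> : (2 + 2 * (k.+1)`!%:R / c ^+ k.+1) * (1 + u ^+ k.+1 / (k.+1)`!%:R) =
   2 + 2 * (a ^+ 2) `^ (s * k.+1%:R) + (2 * (u ^+ k.+1 / (k.+1)`!%:R) + 2 * (k.+1)`!%:R / c ^+ k.+1).
  by rewrite cu; field; rewrite expf_neq0 ?gt_eqF.
rewrite ler_wpDr//.
  by rewrite addr_ge0// ?divr_ge0 ?exprn_ge0 ?(ltW c0)// mulr_ge0// divr_ge0// exprn_ge0.
rewrite /oneDsqr.
have [a1|/ltW a1] := leP (a ^+ 2) 1.
  have := powR_ge0 (a ^+ 2) (s * k.+1%:R); lra.
have : a ^+ 2 <= (a ^+ 2) `^ (s * k.+1%:R).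
  by rewrite -[leLHS]powRr1 ?sqr_ge0// ler_powR.
have := sqr_ge0 a; lra.
Qed.

Lemma integrable_expR_powR (c s : R) : 0 < c -> 0 < s ->
  mu.-integrable setT (fun a => (expR (- (c * (a ^+ 2) `^ s)))%:E).
Proof.
move=> c0 s0; have [C [C0 HC]] := expR_powR_le_oneDsqrV c0 s0.
have iC : mu.-integrable setT (fun a : TR => C%:E * ((oneDsqr (a : R))^-1)%:E)%E.
  exact: (integrableZl measurableT _ integrable_oneDsqrV).
apply: (le_integrable measurableT _ _ iC).
  apply/measurable_EFinP; do 2 apply: measurableT_comp => //; apply: measurable_funM => //.
  by apply: (measurableT_comp (measurable_powR s)); exact: measurable_funX.
move=> a _; rewrite -EFinM /= lee_fin ger0_norm ?expR_ge0//.
by apply: le_trans (HC a) _; rewrite ler_norm.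
Qed.

(** Each squared coordinate is at most the squared norm, so the symbol is bounded by a
    product of functions of one coordinate, each with the [n]-th part of the exponent. *)
Lemma integrable_stable_symbol n (t s : R) : (0 < n)%N -> 0 < t -> 0 < s ->
  (leb n).-integrable setT (fun x => (expR (- (t * inner x x `^ s)))%:E).
Proof.
move=> n0 t0 s0.
have nR : (0 : R) < n%:R by rewrite ltr0n.
pose w (a : R) := expR (- (t / n%:R * (a ^+ 2) `^ s)).
have mw : measurable_fun setT w.
  do 2 apply: measurableT_comp => //; apply: measurable_funM => //.
  by apply: (measurableT_comp (measurable_powR s)); exact: measurable_funX.
have iw : mu.-integrable setT (fun a => (w a)%:E).
  by apply: integrable_expR_powR => //; rewrite divr_gt0.
have Iw : (\int[mu]_a (w a)%:E = (\int[mu]_a w a)%R%:E)%E.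
  by rewrite /Rintegral fineK//; exact: (integrable_fin_num measurableT iw).
have := @ge0_integral_lebesgue_prod n (fun=> w) (fun=> \int[mu]_a w a)%R (fun=> mw) (fun _ a => expR_ge0 _) (fun=> Iw).
move=> EP.
have mP : measurable_fun setT (fun x : n.-tuple TR => (\prod_(i < n) w (tnth x i))).
  apply: (@measurable_prod _ _ R setT _ (index_enum _) (fun i (x : n.-tuple TR) => w (tnth x i))) => i _.
  exact: (measurableT_comp mw (@measurable_tnth_tuple n i)).
have P0 (x : Rn R n) : 0 <= \prod_(i < n) w (tnth x i).
  by apply: prodr_ge0 => i _; exact: expR_ge0.
have iP : (leb n).-integrable setT (fun x => (\prod_(i < n) w (tnth x i))%:E).
  apply/integrableP; split.
    by apply: (@measurable_Rn n); apply/measurable_EFinP.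
  rewrite (eq_integral (fun x : Rn R n => (\prod_(i < n) w (tnth x i))%:E)).
    by rewrite EP ltry.
  by move=> x _; rewrite gee0_abs ?lee_fin ?P0.
apply: (le_integrable measurableT _ _ iP).
  apply: (@measurable_Rn n); apply/measurable_EFinP.
  do 2 apply: measurableT_comp => //; apply: measurable_funM => //.
  by apply: (measurableT_comp (measurable_powR s)); exact: measurable_sqnorm_tuple.
move=> x _; rewrite /= lee_fin ger0_norm ?expR_ge0// (ger0_norm (P0 x)).
rewrite -expR_sum ler_expR sumrN lerN2 -mulr_sumr mulrAC -mulrA ler_wpM2l ?(ltW t0)//.
rewrite ler_pdivrMr//.
apply: (@le_trans _ _ (\sum_(i < n) inner x x `^ s)); last first.
  by rewrite sumr_const card_ord mulr_natr.
apply: ler_sum => i _; rewrite ge0_ler_powR ?nnegrE ?sqr_ge0 ?inner_ge0 ?(ltW s0)//.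
rewrite /inner (bigD1 i)//= expr2 lerDl sumr_ge0// => j _.
by rewrite -expr2 sqr_ge0.
Qed.

End lebesgue_tuples.

(** * Admissible symbols *)

(** Fatou's lemma, with bounds that converge. *)
Lemma integral_le_lim d (T : measurableType d) (R : realType) (m : {measure set T -> \bar R})
    (D : set T) (f_ : nat -> T -> \bar R) (f : T -> \bar R) (B : nat -> \bar R) (l : \bar R) :
  measurable D -> (forall n, measurable_fun D (f_ n)) ->
  (forall n x, D x -> (0 <= f_ n x)%E) ->
  (forall x, D x -> f_ n x @[n --> \oo] --> f x) ->
  (forall n, \int[m]_(x in D) f_ n x <= B n)%E -> B n @[n --> \oo] --> l ->
  (\int[m]_(x in D) f x <= l)%E.
Proof.
move=> mD mf f0 ff fB Bl.
have -> : (\int[m]_(x in D) f x = \int[m]_(x in D) limn_einf (f_ ^~ x))%E.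
  apply: eq_integral => x; rewrite inE => Dx.
  by rewrite (cvg_limn_einf_sup (ff x Dx)).1.
apply: le_trans (fatou m mD mf f0) _.
rewrite -(cvg_limn_einf_sup Bl).1 !limn_einf_lim.
apply: lee_lim; [exact: is_cvg_einfs|exact: is_cvg_einfs|].
apply: nearW => n; apply: le_ereal_inf_tmp => _ [k nk <-].
apply: le_trans (fB k); apply: ereal_inf_lbound; by exists k.
Qed.

Section mixtures.
Context {R : realType}.
Context dX (X : measurableType dX) (m : {sigma_finite_measure set X -> \bar R}).
Context (D : set X) (mD : measurable D).
Context dK (K : measurableType dK) (mu : {sigma_finite_measure set K -> \bar R}).
Context (q : K -> R) (c : X -> K -> R).
Hypotheses (mq : measurable_fun setT q) (q0 : forall k, 0 <= q k).
Hypothesis iq : forall d : R, 0 < d -> mu.-integrable setT (fun k => (expR (- (d * q k)))%:E).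
Hypotheses (mc : measurable_fun setT (fun p : X * K => c p.1 p.2)) (c1 : forall x k, `|c x k| <= 1).

(** The Fourier transform of [f] in the application: [K] is the frequency space, [x] a pair
    of points of the space and [c x k] the cosine of the phase between their difference
    and the frequency [k]. *)
Definition transform (f : K -> R) (x : X) : R := \int[mu]_k (f k * c x k).

Definition damp (d : R) (f : K -> R) (k : K) : R := expR (- (d * q k)) * f k.

Lemma measurable_phase_section x : measurable_fun setT (c x).
Proof. exact: (measurableT_comp mc (measurable_pair1 x)). Qed.

Lemma measurable_damp d (f : K -> R) : measurable_fun setT f -> measurable_fun setT (damp d f).
Proof.
move=> mf; apply: measurable_funM => //; do 2 apply: measurableT_comp => //.
exact: measurable_funM.
Qed.

Definition bounded_mfun (f : K -> R) (C : R) := measurable_fun setT f /\ (forall k, `|f k| <= C).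

Lemma integrable_damp d (f : K -> R) C : 0 < d -> bounded_mfun f C ->
  mu.-integrable setT (fun k => (damp d f k)%:E).
Proof.
move=> d0 [mf fC].
have := integrableZl measurableT C (iq d0); apply: le_integrable => //.
  by apply/measurable_EFinP; exact: measurable_damp.
move=> k _; rewrite -EFinM /= lee_fin /damp normrM mulrC (normrM C).
rewrite ler_wpM2r//; exact: le_trans (fC k) (ler_norm _).
Qed.

Lemma integrable_transform (f : K -> R) x :
  mu.-integrable setT (fun k => (f k)%:E) -> mu.-integrable setT (fun k => (f k * c x k)%:E).
Proof.
move=> intf; apply: (le_integrable _ _ _ intf) => //.
  apply/measurable_EFinP; apply: measurable_funM; last exact: measurable_phase_section.
  by apply/measurable_EFinP; exact: measurable_int intf.
by move=> k _; rewrite /= lee_fin normrM -[leRHS]mulr1 ler_pM.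
Qed.

Lemma EFin_transform (f : K -> R) x : mu.-integrable setT (fun k => (f k)%:E) ->
  (transform f x)%:E = (\int[mu]_k (f k * c x k)%:E)%E.
Proof.
move=> intf; rewrite /transform /Rintegral fineK//.
exact: (integrable_fin_num measurableT (integrable_transform x intf)).
Qed.

Lemma measurable_parametric dY (Y : measurableType dY) (F : Y * K -> R) :
  measurable_fun setT F -> measurable_fun setT (fun y => \int[mu]_k F (y, k)).
Proof.
move=> mF; apply: (measurableT_comp (fine_measurable measurableT)).
have mE : measurable_fun setT (EFin \o F) by exact/measurable_EFinP.
rewrite (_ : (fun y => _) = (fun y => (\int[mu]_k ((EFin \o F)^\+ (y, k)) - \int[mu]_k ((EFin \o F)^\- (y, k)))%E)); last first.
  apply/funext => y; rewrite [LHS]integralE.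
  by congr (_ - _)%E; apply: eq_integral => k _; rewrite ?funeposE ?funenegE.
apply: emeasurable_funB.
- apply: (@measurable_fun_fubini_tonelli_F _ _ Y K R mu) => //; first exact: measurable_funepos.
- apply: (@measurable_fun_fubini_tonelli_F _ _ Y K R mu) => //; first exact: measurable_funeneg.
Qed.

Lemma measurable_transform (f : K -> R) : measurable_fun setT f -> measurable_fun setT (transform f).
Proof.
move=> mf; apply: (@measurable_parametric _ X (fun p => f p.2 * c p.1 p.2)).
by apply: measurable_funM => //; exact: measurableT_comp.
Qed.

Lemma cvg_transform (f_ : nat -> K -> R) (f G : K -> R) x :
  (forall n, measurable_fun setT (f_ n)) -> (forall k, f_ n k @[n --> \oo] --> f k) ->
  mu.-integrable setT (fun k => (G k)%:E) -> (forall n k, `|f_ n k| <= G k) ->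
  transform (f_ n) x @[n --> \oo] --> transform f x.
Proof.
move=> mf ff iG fG.
have mfc n : measurable_fun setT (fun k => (f_ n k * c x k)%:E).
  by apply/measurable_EFinP; apply: measurable_funM => //; exact: measurable_phase_section.
have cfc k : [set: K] k -> (f_ n k * c x k)%:E @[n --> \oo] --> (f k * c x k)%:E.
  by move=> _; apply: cvg_EFin; [exact: nearW | apply: cvgMl; exact: ff].
have fcG n k : [set: K] k -> (`|(f_ n k * c x k)%:E| <= (G k)%:E)%E.
  by move=> _; rewrite /= lee_fin normrM -[leRHS]mulr1 ler_pM.
have mfl : measurable_fun setT (fun k => (f k * c x k)%:E).
  exact: (emeasurable_fun_cvg _ _ mfc cfc).
have [ifl _ cI] := dominated_convergence measurableT mfc mfl (aeW _ cfc) iG (aeW _ (fun k n => fcG n k)).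
apply: fine_cvg; rewrite fineK//; exact: (integrable_fin_num measurableT ifl).
Qed.

Lemma transformD (f1 f2 : K -> R) x :
  mu.-integrable setT (fun k => (f1 k)%:E) -> mu.-integrable setT (fun k => (f2 k)%:E) ->
  transform (fun k => f1 k + f2 k) x = transform f1 x + transform f2 x.
Proof.
move=> i1 i2; rewrite /transform -RintegralD//; try exact: integrable_transform.
by apply: eq_Rintegral => k _; rewrite mulrDl.
Qed.

Lemma transformZ (a : R) (f : K -> R) x :
  mu.-integrable setT (fun k => (f k)%:E) ->
  transform (fun k => a * f k) x = a * transform f x.
Proof.
move=> i1; rewrite /transform -RintegralZl//; last exact: integrable_transform.
by apply: eq_Rintegral => k _; rewrite mulrA.
Qed.

Variable g : R -> R.

(** Nonnegativity is required at every point of [X] and the bound on [D] only. With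
    [D] empty and [g = 0] the class describes the symbols of nonnegative kernels. *)
Definition admissible (f : K -> R) (A M : R) :=
  [/\ measurable_fun setT f, exists C : R, forall k, `|f k| <= C,
     (forall (d : R) x, 0 < d -> 0 <= transform (damp d f) x) &
     (forall d : R, 0 < d -> (\int[m]_(x in D) (transform (damp d f) x)%:E <= (A * g d + M)%:E)%E)].

Hypothesis g0 : forall d, 0 <= g d.

Lemma admissible_le f A M A' M' : A <= A' -> M <= M' -> admissible f A M -> admissible f A' M'.
Proof.
move=> AA MM [mf Cf pf If]; split=> // d d0; apply: le_trans (If d d0) _.
by rewrite lee_fin lerD// ler_wpM2r.
Qed.

Lemma admissible_integrable_damp d f A M : 0 < d -> admissible f A M ->
  mu.-integrable setT (fun k => (damp d f k)%:E).
Proof. by move=> d0 [mf [C fC] _ _]; apply: (@integrable_damp d f C). Qed.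

Lemma admissibleD f1 f2 A1 A2 M1 M2 : admissible f1 A1 M1 -> admissible f2 A2 M2 ->
  admissible (fun k => f1 k + f2 k) (A1 + A2) (M1 + M2).
Proof.
move=> a1 a2; have [mf1 [C1 fC1] p1 I1] := a1; have [mf2 [C2 fC2] p2 I2] := a2.
have E (d : R) x : 0 < d -> transform (damp d (fun k => f1 k + f2 k)) x =
     transform (damp d f1) x + transform (damp d f2) x.
  move=> d0; rewrite -transformD; [|exact: admissible_integrable_damp a1|exact: admissible_integrable_damp a2].
  by congr (transform _ x); apply/funext => k; rewrite /damp mulrDr.
split.
- exact: measurable_funD.
- by exists (C1 + C2) => k; apply: le_trans (ler_normD _ _) _; rewrite lerD.
- by move=> d x d0; rewrite E// addr_ge0// ?p1 ?p2.
- move=> d d0; under eq_integral do rewrite E// EFinD.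
  rewrite ge0_integralD//=.
  + rewrite (_ : _ + _ = (A1 * g d + M1) + (A2 * g d + M2)); last by ring.
    by rewrite EFinD; exact: leeD (I1 d d0) (I2 d d0).
  + by move=> x _; rewrite lee_fin p1.
  + apply/measurable_EFinP/measurable_funTS; apply: measurable_transform; exact: measurable_damp.
  + by move=> x _; rewrite lee_fin p2.
  + apply/measurable_EFinP/measurable_funTS; apply: measurable_transform; exact: measurable_damp.
Qed.

Lemma admissibleZ a f A M : 0 <= a -> admissible f A M -> admissible (fun k => a * f k) (a * A) (a * M).
Proof.
move=> a0 af; have [mf [C fC] p If] := af.
have E (d : R) x : 0 < d -> transform (damp d (fun k => a * f k)) x = a * transform (damp d f) x.
  move=> d0; rewrite -transformZ; last exact: admissible_integrable_damp af.
  by congr (transform _ x); apply/funext => k; rewrite /damp mulrCA.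
split.
- exact: measurable_funM.
- by exists (a * C) => k; rewrite normrM (ger0_norm a0) ler_wpM2l.
- by move=> d x d0; rewrite E// mulr_ge0// p.
- move=> d d0; under eq_integral do rewrite E// EFinM.
  rewrite ge0_integralZl//=.
  + rewrite -mulrA -mulrDr EFinM; apply: lee_wpmul2l; [by rewrite lee_fin|exact: If].
  + apply/measurable_EFinP/measurable_funTS; apply: measurable_transform; exact: measurable_damp.
  + by move=> x _; rewrite lee_fin p.
Qed.

(** The damping dominates all the symbols at once, so the transforms converge; positivity
    passes to the limit and Fatou's lemma keeps the bound. *)
Lemma admissible_lim (f_ : nat -> K -> R) (f : K -> R) (A M C : R) :
  (forall n, admissible (f_ n) A M) -> (forall n k, `|f_ n k| <= C) ->
  (forall k, f_ n k @[n --> \oo] --> f k) -> admissible f A M.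
Proof.
move=> af fC ff.
have mf_ n : measurable_fun setT (f_ n) by case: (af n).
have cT (d : R) x : 0 < d -> transform (damp d (f_ n)) x @[n --> \oo] --> transform (damp d f) x.
  move=> d0; apply: (@cvg_transform _ _ (fun k => C * expR (- (d * q k)))).
  - by move=> n; exact: measurable_damp.
  - by move=> k; apply: cvgMr; exact: ff.
  - by have := integrableZl measurableT C (iq d0).
  - by move=> n k; rewrite /damp normrM mulrC ler_pM// ger0_norm ?expR_ge0.
split.
- apply/measurable_EFinP; apply: (emeasurable_fun_cvg (fun n k => (f_ n k)%:E)).
    by move=> n; apply/measurable_EFinP.
  by move=> k _; apply: cvg_EFin; [exact: nearW|exact: ff].
- exists C => k; have cn : `|f_ n k| @[n --> \oo] --> `|f k| by apply: cvg_norm; exact: ff.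
  by rewrite -(cvg_lim _ cn)//; apply: limr_le; [apply/cvg_ex; exists (`|f k|) | exact: nearW].
- move=> d x d0; rewrite -(cvg_lim _ (cT d x d0))//.
  apply: limr_ge; [by apply/cvg_ex; exists (transform (damp d f) x); exact: cT|].
  by apply: nearW => n; case: (af n) => _ _ + _; exact.
- move=> d d0.
  apply: (@integral_le_lim _ _ _ m D (fun n x => (transform (damp d (f_ n)) x)%:E) _ (cst (A * g d + M)%:E)) => //.
  + move=> n; apply/measurable_EFinP/measurable_funTS; apply: measurable_transform; exact: measurable_damp.
  + by move=> n x _; rewrite lee_fin; case: (af n) => _ _ + _; exact.
  + by move=> x _; apply: cvg_EFin; [exact: nearW|exact: cT].
  + by move=> n; case: (af n) => _ _ _; exact.
  + exact: cvg_cst.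
Qed.

Context dT (T : measurableType dT) (nu : {sigma_finite_measure set T -> \bar R}).
Variable theta : T -> R.
Hypotheses (mtheta : measurable_fun setT theta) (theta0 : forall y, 0 < theta y).
Hypotheses (mg : measurable_fun setT g)
  (gD : forall d tau : R, 0 < d -> 0 < tau -> g (d + tau) <= g d + g tau).

(** The Laplace transform of a random time: [theta y] is the time and [w], up to its mass, the
    density of [y]. *)
Definition mixture (w : T -> R) (k : K) : R := \int[nu]_y (w y * expR (- (theta y * q k))).

Lemma expR_theta_le1 y k : 0 <= expR (- (theta y * q k)) <= 1.
Proof.
by rewrite expR_ge0 -expR0 ler_expR oppr_le0 mulr_ge0// ltW.
Qed.

Section fixed_weight.
Variables (w : T -> R) (a : R).
Hypotheses (mw : measurable_fun setT w) (w0 : forall y, 0 <= w y)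
  (wa : (\int[nu]_y (w y)%:E = a%:E)%E).

Lemma integrable_weight : nu.-integrable setT (fun y => (w y)%:E).
Proof.
apply/integrableP; split; first exact/measurable_EFinP.
rewrite (eq_integral (fun y => (w y)%:E)); first by rewrite wa ltry.
by move=> y _; rewrite gee0_abs// lee_fin.
Qed.

Lemma measurable_weighted_expR k : measurable_fun setT (fun y => w y * expR (- (theta y * q k))).
Proof.
apply: measurable_funM => //; do 2 apply: measurableT_comp => //; exact: measurable_funM.
Qed.

Lemma integrable_weighted_expR k : nu.-integrable setT (fun y => (w y * expR (- (theta y * q k)))%:E).
Proof.
apply: (le_integrable _ _ _ integrable_weight) => //.
  exact/measurable_EFinP/measurable_weighted_expR.
move=> y _; have /andP[e0 e1] := expR_theta_le1 y k.
by rewrite /= lee_fin ger0_norm ?mulr_ge0// ger0_norm// -[leRHS]mulr1 ler_pM.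
Qed.

Lemma mixture_ge0 k : 0 <= mixture w k.
Proof.
by apply: Rintegral_ge0 => y _; rewrite mulr_ge0// expR_ge0.
Qed.

Lemma mixture_le k : mixture w k <= a.
Proof.
rewrite -lee_fin -wa /mixture /Rintegral fineK; last first.
  exact: (integrable_fin_num measurableT (integrable_weighted_expR k)).
apply: ge0_le_integral => //.
- by move=> y _; rewrite lee_fin mulr_ge0// expR_ge0.
- exact/measurable_EFinP/measurable_weighted_expR.
- exact/measurable_EFinP.
- move=> y _; have /andP[e0 e1] := expR_theta_le1 y k.
  by rewrite lee_fin -[leRHS]mulr1 ler_pM.
Qed.

Lemma measurable_mixture : measurable_fun setT (mixture w).
Proof.
apply: (measurableT_comp (fine_measurable measurableT)).
apply: (@measurable_fun_fubini_tonelli_F _ _ K T R nu (fun p => (w p.2 * expR (- (theta p.2 * q p.1)))%:E)).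
- apply/measurable_EFinP; apply: measurable_funM; first exact: measurableT_comp.
  do 2 apply: measurableT_comp => //; apply: measurable_funM; exact: measurableT_comp.
- by move=> p; rewrite lee_fin mulr_ge0// expR_ge0.
Qed.

(** By Fubini's theorem, to multiply by a mixture is to add the time [theta y] to the damping and
    to average over [y]. *)
Lemma transform_mixture (f : K -> R) (C d : R) x : 0 < d -> bounded_mfun f C ->
  (transform (damp d (fun k => mixture w k * f k)) x)%:E =
  (\int[nu]_y (w y * transform (damp (d + theta y) f) x)%:E)%E.
Proof.
move=> d0 [mf fC].
have mdf : measurable_fun setT (damp d f) by exact: measurable_damp.
pose H (p : K * T) : R := (w p.2 * expR (- (theta p.2 * q p.1))) * (damp d f p.1 * c x p.1).
have mH : measurable_fun setT H.
  apply: measurable_funM.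
    apply: measurable_funM; first exact: measurableT_comp.
    do 2 apply: measurableT_comp => //; apply: measurable_funM; exact: measurableT_comp.
  apply: measurable_funM; first exact: measurableT_comp.
  exact: (measurableT_comp (measurable_phase_section x)).
have HB k y : `|H (k, y)| <= `|C| * expR (- (d * q k)) * w y.
  have /andP[e0 e1] := expR_theta_le1 y k.
  rewrite /H /= /damp !normrM (ger0_norm (w0 y)) (ger0_norm e0) (ger0_norm (expR_ge0 (- (d * q k)))).
  rewrite mulrC ler_pM ?mulr_ge0 ?expR_ge0//; last by rewrite -[leRHS]mulr1 ler_wpM2l.
  rewrite -[leRHS]mulr1 ler_pM ?mulr_ge0 ?expR_ge0// mulrC ler_wpM2r ?expR_ge0//.
  exact: le_trans (fC k) (ler_norm C).
have iH : (mu \x nu)%E.-integrable setT (fun p => (H p)%:E).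
  apply/integrable12ltyP; first exact/measurable_EFinP.
  apply: (@le_lt_trans _ _ (\int[mu]_k (a%:E * (`|C| * expR (- (d * q k)))%:E))%E).
    apply: ge0_le_integral => //.
    - by move=> k _; apply: integral_ge0.
    - apply: (@measurable_fun_fubini_tonelli_F _ _ K T R nu (fun p => `|(H p)%:E|%E)) => //.
      by apply: measurableT_comp => //; exact/measurable_EFinP.
    - apply/measurable_EFinP; do 2 apply: measurable_funM => //.
      by do 2 apply: measurableT_comp => //; exact: measurable_funM.
    - move=> k _.
      apply: (@le_trans _ _ (\int[nu]_y ((`|C| * expR (- (d * q k)))%:E * (w y)%:E))%E).
        apply: ge0_le_integral => //.
        + apply: measurableT_comp => //; apply/measurable_EFinP.
          exact: (measurableT_comp mH (measurable_pair1 k)).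
        + by apply/measurable_EFinP; exact: measurable_funM.
        + by move=> y _; rewrite -EFinM /= lee_fin.
      rewrite ge0_integralZl//=; first by rewrite wa muleC.
        exact/measurable_EFinP.
      by move=> y _; rewrite lee_fin.
  have iC := integrableZl measurableT `|C| (iq d0).
  have iCa := integrableZl measurableT a iC.
  have /integrableP[_ lty] := iCa; apply: le_lt_trans lty.
  apply: ge0_le_integral => //=.
  - move=> k _; rewrite -EFinM lee_fin mulr_ge0 ?mulr_ge0 ?expR_ge0//.
    by rewrite -lee_fin -wa integral_ge0// => y _; rewrite lee_fin.
  - exact: measurable_int iCa.
  - exact: (measurable_int _ (integrable_abse iCa)).
  - by move=> k _; rewrite -!EFinM lee_fin ler_norm.
have idx (e : R) : 0 < e -> mu.-integrable setT (fun k => (damp e f k * c x k)%:E).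
  by move=> e0; apply: integrable_transform; exact: (@integrable_damp e f C).
have FH := Fubini iH.
transitivity (\int[mu]_k \int[nu]_y (H (k, y))%:E)%E.
  rewrite EFin_transform; last first.
    apply: (@integrable_damp d _ (a * `|C|)) => //; split.
      by apply: measurable_funM => //; exact: measurable_mixture.
    move=> k; rewrite normrM (ger0_norm (mixture_ge0 k)) ler_pM ?mixture_ge0 ?mixture_le//.
    exact: le_trans (fC k) (ler_norm C).
  apply: eq_integral => k _.
  transitivity (\int[nu]_y ((damp d f k * c x k)%:E * (w y * expR (- (theta y * q k)))%:E))%E.
    rewrite integralZl//; last exact: integrable_weighted_expR.
    rewrite -[X in (_ * X)%E]fineK; last exact: (integrable_fin_num measurableT (integrable_weighted_expR k)).
    by rewrite -EFinM; congr EFin; rewrite /damp /mixture /Rintegral; ring.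
  by apply: eq_integral => y _; rewrite -EFinM /H /= mulrC.
rewrite FH; apply: eq_integral => y _.
transitivity (\int[mu]_k ((w y)%:E * (damp (d + theta y) f k * c x k)%:E))%E.
  apply: eq_integral => k _; rewrite -EFinM /H /= /damp; congr EFin.
  have -> : - ((d + theta y) * q k) = - (theta y * q k) + - (d * q k) by ring.
  by rewrite expRD; ring.
have dt0 : 0 < d + theta y by rewrite addr_gt0.
rewrite integralZl//; last exact: idx.
by rewrite EFinM EFin_transform//; exact: (@integrable_damp _ f C).
Qed.

End fixed_weight.

Lemma measurable_transform_damp (f : K -> R) (tau : T -> R) :
  measurable_fun setT f -> measurable_fun setT tau ->
  measurable_fun setT (fun p : X * T => transform (damp (tau p.2) f) p.1).
Proof.
move=> mf mtau.
apply: (@measurable_parametric _ (X * T)%type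
  (fun r => damp (tau r.1.2) f r.2 * c r.1.1 r.2)).
have m12 : measurable_fun setT (fun r : X * T * K => r.1.2) by exact: measurableT_comp.
have m11 : measurable_fun setT (fun r : X * T * K => r.1.1) by exact: measurableT_comp.
have m2 : measurable_fun setT (fun r : X * T * K => r.2) by exact: measurable_snd.
apply: measurable_funM; last first.
  apply: (measurableT_comp mc (g := fun r : X * T * K => (r.1.1, r.2))).
  exact/measurable_fun_pair.
apply: measurable_funM; last exact: (measurableT_comp mf m2).
do 2 apply: measurableT_comp => //; apply: measurable_funM.
  exact: (measurableT_comp mtau m12).
exact: (measurableT_comp mq m2).
Qed.

Lemma measurable_indic_fst : measurable_fun setT (fun p : X * T => (\1_D p.1 : R)%:E).
Proof.
have mI : measurable_fun setT (\1_D : X -> R) by exact: measurable_indic.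
apply/measurable_EFinP; exact: (measurableT_comp mI measurable_fst).
Qed.

Lemma domain_indicator (h : X * T -> \bar R) x y :
  ((\1_D x : R)%:E * h (x, y))%E = ((fun x => h (x, y)) \_ D) x.
Proof. by rewrite patchE indicE; case: ifPn => xD; rewrite ?mul1e ?mul0e. Qed.

Lemma measurable_indicator_mul (h : X * T -> \bar R) : measurable_fun setT h ->
  measurable_fun setT (fun p => (\1_D p.1 : R)%:E * h p)%E.
Proof. by move=> mh; apply: emeasurable_funM => //; exact: measurable_indic_fst. Qed.

Lemma measurable_domain_integral (h : X * T -> \bar R) :
  measurable_fun setT h -> (forall p, 0 <= h p)%E ->
  measurable_fun setT (fun y => \int[m]_(x in D) h (x, y))%E.
Proof.
move=> mh h0.
rewrite (_ : (fun y => _) = fubini_G m (fun p => (\1_D p.1 : R)%:E * h p)%E); last first.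
  apply/funext => y; rewrite integral_mkcond; apply: eq_integral => x _.
  exact/esym/domain_indicator.
apply: measurable_fun_fubini_tonelli_G; first exact: measurable_indicator_mul.
by move=> p; rewrite mule_ge0// lee_fin.
Qed.

Lemma tonelli_domain (h : X * T -> \bar R) : measurable_fun setT h -> (forall p, 0 <= h p)%E ->
  (\int[m]_(x in D) \int[nu]_y h (x, y) = \int[nu]_y \int[m]_(x in D) h (x, y))%E.
Proof.
move=> mh h0; pose h' (p : X * T) := ((\1_D p.1 : R)%:E * h p)%E.
transitivity (\int[m]_x \int[nu]_y h' (x, y))%E.
  rewrite integral_mkcond; apply: eq_integral => x _; rewrite patchE.
  under [RHS]eq_integral do rewrite /h' domain_indicator patchE.
  by case: ifPn => xD //; rewrite integral0.
rewrite fubini_tonelli.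
- apply: eq_integral => y _; rewrite [RHS]integral_mkcond.
  by apply: eq_integral => x _; rewrite /h' domain_indicator.
- exact: measurable_indicator_mul.
- by move=> p; rewrite mule_ge0// lee_fin.
Qed.

(** The bound at the time [d + theta y] splits by subadditivity of [g]: the part [g d] is
    multiplied by the mass [a] of the weight, the part [g (theta y)] integrates to [G]. *)
Lemma admissible_mixture (f : K -> R) (w : T -> R) (A M a G : R) :
  measurable_fun setT w -> (forall y, 0 <= w y) ->
  (\int[nu]_y (w y)%:E = a%:E)%E ->
  (\int[nu]_y (w y * g (theta y))%:E <= G%:E)%E ->
  0 <= A -> 0 <= M ->
  admissible f A M -> admissible (fun k => mixture w k * f k) (a * A) (a * M + A * G).
Proof.
move=> mw w0 wa wG A0 M0 [mf [C fC] pf If].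
have a0 : 0 <= a by rewrite -lee_fin -wa integral_ge0// => y _; rewrite lee_fin.
have E (d : R) x : 0 < d -> (transform (damp d (fun k => mixture w k * f k)) x)%:E =
   (\int[nu]_y (w y * transform (damp (d + theta y) f) x)%:E)%E.
  by move=> d0; apply: (transform_mixture mw w0 wa x d0 (conj mf fC)).
have dt (d : R) y : 0 < d -> 0 < d + theta y by move=> d0; rewrite addr_gt0.
split.
- by apply: measurable_funM => //; exact: (measurable_mixture mw w0).
- exists (a * `|C|) => k.
  rewrite normrM (ger0_norm (mixture_ge0 w0 k)) ler_pM ?(mixture_ge0 w0) ?(mixture_le mw w0 wa)//.
  exact: le_trans (fC k) (ler_norm C).
- move=> d x d0; rewrite -lee_fin E//.
  by apply: integral_ge0 => y _; rewrite lee_fin mulr_ge0// pf// dt.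
move=> d d0; under eq_integral do rewrite E//.
pose h (p : X * T) := (w p.2 * transform (damp (d + theta p.2) f) p.1)%:E.
have mdt : measurable_fun setT (fun y => d + theta y) by exact: measurable_funD.
have mh : measurable_fun setT h.
  apply/measurable_EFinP; apply: measurable_funM; first exact: measurableT_comp.
  exact: (measurable_transform_damp mf mdt).
have h0 p : (0 <= h p)%E by rewrite lee_fin mulr_ge0// pf// dt.
rewrite (tonelli_domain mh h0).
have mT (e : R) : measurable_fun D (fun x => (transform (damp e f) x)%:E).
  by apply/measurable_EFinP/measurable_funTS; apply: measurable_transform; exact: measurable_damp.
have mgt : measurable_fun setT (fun y => g (theta y)) by exact: measurableT_comp.
apply: (@le_trans _ _ (\int[nu]_y ((A * g d + M)%:E * (w y)%:E + A%:E * (w y * g (theta y))%:E))%E).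
  apply: ge0_le_integral => //.
  - by move=> y _; apply: integral_ge0 => x _; rewrite lee_fin mulr_ge0// pf// dt.
  - exact: measurable_domain_integral.
  - apply/measurable_EFinP; apply: measurable_funD; first exact: measurable_funM.
    by apply: measurable_funM => //; exact: measurable_funM.
  - move=> y _; rewrite /h /=.
    under eq_integral do rewrite EFinM.
    rewrite ge0_integralZl//=; last 2 first.
    + by move=> x _; rewrite lee_fin pf// dt.
    + by rewrite lee_fin.
    apply: (@le_trans _ _ ((w y)%:E * (A * g (d + theta y) + M)%:E)%E).
      by apply: lee_wpmul2l; [rewrite lee_fin|exact: If (dt d y d0)].
    rewrite -!EFinM -EFinD lee_fin.
    apply: (@le_trans _ _ (w y * (A * (g d + g (theta y)) + M))).
      by rewrite ler_wpM2l// lerD2r ler_wpM2l// gD.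
    by rewrite le_eqVlt; apply/orP; left; apply/eqP; ring.
rewrite ge0_integralD//=.
- rewrite ge0_integralZl//=; first last.
  + by rewrite lee_fin addr_ge0// mulr_ge0.
  + by move=> y _; rewrite lee_fin.
  + exact/measurable_EFinP.
  rewrite ge0_integralZl//=; first last.
  + by move=> y _; rewrite lee_fin mulr_ge0.
  + by apply/measurable_EFinP; exact: measurable_funM.
  rewrite wa; apply: (@le_trans _ _ ((A * g d + M)%:E * a%:E + A%:E * G%:E)%E).
    by apply: leeD => //; apply: lee_wpmul2l => //; rewrite lee_fin.
  rewrite -!EFinM -EFinD lee_fin le_eqVlt; apply/orP; left; apply/eqP; ring.
- by move=> y _; rewrite -EFinM lee_fin mulr_ge0// addr_ge0// mulr_ge0.
- by apply/measurable_EFinP; exact: measurable_funM.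
- by move=> y _; rewrite -EFinM lee_fin !mulr_ge0.
- by apply/measurable_EFinP; apply: measurable_funM => //; exact: measurable_funM.
Qed.

Lemma sum_exp_coeff_le (x : R) (P : pred nat) N : 0 <= x ->
  \sum_(j < N | P j) exp_coeff x j <= expR x.
Proof.
move=> x0.
have e0 j : 0 <= exp_coeff x j by rewrite /exp_coeff divr_ge0// exprn_ge0.
apply: (@le_trans _ _ (\sum_(j < N) exp_coeff x j)).
  by rewrite [leRHS](bigID (fun j : 'I_N => P j))/= lerDl sumr_ge0.
rewrite /expR -(big_mkord xpredT (exp_coeff x)).
apply: (@nondecreasing_cvgn_le _ (series (exp_coeff x))).
  by apply: nondecreasing_series => n _ _; exact: e0.
exact: is_cvg_series_exp_coeff.
Qed.

Lemma sum_ord_recr_cond (P : pred nat) (F : nat -> R) N :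
  \sum_(j < N.+1 | P j) F j = \sum_(j < N | P j) F j + (if P N then F N else 0).
Proof. by rewrite big_mkcond big_ord_recr/= -big_mkcond. Qed.

Section exponential.
Variables (w : T -> R) (a G t : R).
Hypotheses (mw : measurable_fun setT w) (w0 : forall y, 0 <= w y).
Hypotheses (wa : (\int[nu]_y (w y)%:E = a%:E)%E).
Hypothesis (wG : (\int[nu]_y (w y * g (theta y))%:E <= G%:E)%E).
Hypothesis t0 : 0 <= t.

Let a0 : 0 <= a.
Proof. by rewrite -lee_fin -wa integral_ge0// => y _; rewrite lee_fin. Qed.

Let G0 : 0 <= G.
Proof.
rewrite -lee_fin; apply: le_trans wG.
by apply: integral_ge0 => y _; rewrite lee_fin mulr_ge0.
Qed.

(** Each factor multiplies both constants by [a] and adds to the second one [G] times the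
    first, whence the derivative of [a ^+ j]. *)
Lemma admissible_mixture_exprn f A M j : 0 <= A -> 0 <= M -> admissible f A M ->
  admissible (fun k => mixture w k ^+ j * f k) (a ^+ j * A)
    (a ^+ j * M + j%:R * a ^+ j.-1 * A * G).
Proof.
move=> A0 M0 af; elim: j => [|j IH].
  rewrite !expr0 !mul1r !mul0r addr0; rewrite (_ : (fun k => _) = f)//.
  by apply/funext => k; rewrite mul1r.
have := admissible_mixture mw w0 wa wG _ _ IH.
rewrite (_ : (fun k => mixture w k * _) = (fun k => mixture w k ^+ j.+1 * f k)); last first.
  by apply/funext => k; rewrite mulrA -exprS.
rewrite mulrA -exprS (_ : a * (_ + _) + _ = a ^+ j.+1 * M + j.+1%:R * a ^+ j.+1.-1 * A * G).
  by apply; rewrite ?addr_ge0 ?mulr_ge0 ?exprn_ge0.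
case: j {IH} => [|j]; rewrite /= ?expr0 ?expr1; first by ring.
by rewrite !exprS -[j.+2%:R]natr1; ring.
Qed.

(** The predicate [P] selects terms of the exponential series. All terms have nonnegative
    coefficients, so the constants are bounded by those of the whole series. *)
Lemma admissible_exp_partial f A M (P : pred nat) N : 0 <= A -> 0 <= M -> admissible f A M ->
  admissible (fun k => (\sum_(j < N | P j) exp_coeff (t * mixture w k) j) * f k)
    (A * expR (t * a)) (M * expR (t * a) + t * A * G * expR (t * a)).
Proof.
move=> A0 M0 af.
pose b (j : nat) : R := t ^+ j / j`!%:R.
have b0 j : 0 <= b j by rewrite divr_ge0// exprn_ge0.
have ec j : b j * a ^+ j = exp_coeff (t * a) j by rewrite /b /exp_coeff/= exprMn; ring.
have : admissible (fun k => (\sum_(j < N | P j) exp_coeff (t * mixture w k) j) * f k)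
    (\sum_(j < N | P j) b j * (a ^+ j * A))
    (\sum_(j < N | P j) b j * (a ^+ j * M + j%:R * a ^+ j.-1 * A * G)).
  elim: N => [|N IH].
    rewrite !big_ord0; have := admissibleZ (lexx 0) af; rewrite !mul0r.
    by congr admissible; apply/funext => k; rewrite big_ord0 !mul0r.
  rewrite (sum_ord_recr_cond P (fun j => b j * (a ^+ j * A))).
  rewrite (sum_ord_recr_cond P (fun j => b j * (a ^+ j * M + j%:R * a ^+ j.-1 * A * G))).
  have fE k := sum_ord_recr_cond P (exp_coeff (t * mixture w k)) N.
  under eq_fun do rewrite fE.
  case: ifPn => PN; last by rewrite !addr0; under eq_fun do rewrite addr0.
  have := admissibleD IH (admissibleZ (b0 N) (admissible_mixture_exprn N A0 M0 af)).
  congr admissible; apply/funext => k; rewrite mulrDl; congr (_ + _).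
  by rewrite /b /exp_coeff/= exprMn; ring.
apply: admissible_le.
  rewrite (eq_bigr (fun j : 'I_N => exp_coeff (t * a) j * A)); last first.
    by move=> j _; rewrite mulrA ec.
  by rewrite -mulr_suml mulrC ler_wpM2l// sum_exp_coeff_le// mulr_ge0.
under eq_bigr do rewrite mulrDr.
rewrite big_split/= lerD//.
  rewrite (eq_bigr (fun j : 'I_N => exp_coeff (t * a) j * M)); last first.
    by move=> j _; rewrite mulrA ec.
  by rewrite -mulr_suml mulrC ler_wpM2l// sum_exp_coeff_le// mulr_ge0.
apply: (@le_trans _ _ (\sum_(j < N) b j * (j%:R * a ^+ j.-1 * A * G))).
  rewrite [leRHS](bigID (fun j : 'I_N => P j))/= lerDl sumr_ge0// => j _.
  by rewrite !mulr_ge0// exprn_ge0.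
case: N => [|N].
  by rewrite big_ord0 !mulr_ge0// expR_ge0.
rewrite big_ord_recl/= !mul0r mulr0 add0r.
rewrite (eq_bigr (fun j : 'I_N => exp_coeff (t * a) j * (t * A * G))).
  rewrite -mulr_suml mulrC ler_wpM2l ?mulr_ge0//.
  by rewrite (sum_exp_coeff_le xpredT)// mulr_ge0.
move=> j _; rewrite /b /exp_coeff/= exprMn exprS factS natrM /bump/= add1n.
field; by rewrite pnatr_eq0 -lt0n fact_gt0 /=.
Qed.

Lemma admissible_exp_lim f A M (P : pred nat) (L : R -> R) : 0 <= A -> 0 <= M ->
  (forall x, \sum_(j < N | P j) exp_coeff x j @[N --> \oo] --> L x) ->
  admissible f A M ->
  admissible (fun k => L (t * mixture w k) * f k)
    (A * expR (t * a)) (M * expR (t * a) + t * A * G * expR (t * a)).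
Proof.
move=> A0 M0 cL af; have [mf [C fC] _ _] := af.
apply: (@admissible_lim (fun N k => (\sum_(j < N | P j) exp_coeff (t * mixture w k) j) * f k) _ _ _ (expR (t * a) * C)).
- by move=> N; exact: admissible_exp_partial.
- move=> N k; have u0 : 0 <= t * mixture w k by rewrite mulr_ge0// mixture_ge0.
  have s0 : 0 <= \sum_(j < N | P j) exp_coeff (t * mixture w k) j.
    by apply: sumr_ge0 => j _; rewrite /exp_coeff/= divr_ge0// exprn_ge0.
  rewrite normrM (ger0_norm s0) ler_pM//.
  apply: le_trans (sum_exp_coeff_le _ _ u0) _.
  by rewrite ler_expR ler_wpM2l//; exact: mixture_le.
- by move=> k; apply: cvgMl; exact: cL.
Qed.

Lemma admissible_expR f A M : 0 <= A -> 0 <= M -> admissible f A M ->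
  admissible (fun k => expR (t * mixture w k) * f k)
    (A * expR (t * a)) (M * expR (t * a) + t * A * G * expR (t * a)).
Proof.
move=> A0 M0; apply: (@admissible_exp_lim _ _ _ xpredT) => // x.
rewrite (_ : (fun N => _) = series (exp_coeff x)); first exact: is_cvg_series_exp_coeff.
by apply/funext => N; rewrite -(big_mkord xpredT (exp_coeff x)).
Qed.

(** The exponential series without its term of degree 1. *)
Lemma admissible_expR_sub f A M : 0 <= A -> 0 <= M -> admissible f A M ->
  admissible (fun k => (expR (t * mixture w k) - t * mixture w k) * f k)
    (A * expR (t * a)) (M * expR (t * a) + t * A * G * expR (t * a)).
Proof.
move=> A0 M0; apply: (@admissible_exp_lim _ _ _ (predC1 1%N) (fun x => expR x - x)) => // x.
have cx : series (exp_coeff x) n - x @[n --> \oo] --> expR x - x.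
  by apply: cvgB; [exact: is_cvg_series_exp_coeff|exact: cvg_cst].
apply: cvg_trans cx; apply: near_eq_cvg.
exists 2%N => // N /= N2.
have e1 : exp_coeff x 1 = x by rewrite /exp_coeff/= expr1 factS fact0 muln1 divr1.
rewrite /series/= big_mkord (bigD1 (Ordinal N2))//= e1 [LHS]addrC addKr.
by apply: eq_bigl => j; rewrite -val_eqE.
Qed.

End exponential.

Definition one (_ : K) : R := 1.

Hypothesis one_ge0 : forall (d : R) x, 0 < d -> 0 <= transform (damp d one) x.
Hypothesis one_le : forall d : R, 0 < d ->
  (\int[m]_(x in D) (transform (damp d one) x)%:E <= (g d)%:E)%E.

Lemma measurable_one : measurable_fun setT one.
Proof. exact: measurable_cst. Qed.

Lemma admissible_one : admissible one 1 0.
Proof.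
split; [exact: measurable_cst|by exists 1 => k; rewrite /one normr1|exact: one_ge0|].
by move=> d d0; rewrite mul1r addr0; exact: one_le.
Qed.

(** The symbol is the limit of [e^(-t a N) e^(t mixture (v N))]. As the mass [b N] of the
    weight is at most [a N], the first factor cancels the growth [e^(t b N)] of the
    constants, and [t * G] is what remains, uniformly in [N]. *)
Lemma admissible_expRN (v : nat -> T -> R) (b a : nat -> R) (Psi : K -> R) (G t : R) :
  (forall N, measurable_fun setT (v N)) -> (forall N y, 0 <= v N y) ->
  (forall N, \int[nu]_y (v N y)%:E = (b N)%:E)%E ->
  (forall N, \int[nu]_y (v N y * g (theta y))%:E <= G%:E)%E ->
  (forall N, b N <= a N) ->
  (forall k, a N - mixture (v N) k @[N --> \oo] --> Psi k) -> 0 <= t ->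
  admissible (fun k => expR (- (t * Psi k))) 1 (t * G).
Proof.
move=> mv v0 vb vG ba cPsi t0.
have G0 : 0 <= G.
  rewrite -lee_fin; apply: le_trans (vG 0%N).
  by apply: integral_ge0 => y _; rewrite lee_fin mulr_ge0.
pose F N k := expR (- (t * a N)) * (expR (t * mixture (v N) k) * one k).
have FE N k : F N k = expR (- (t * (a N - mixture (v N) k))).
  by rewrite /F /one mulr1 -expRD; congr expR; ring.
apply: (@admissible_lim F _ _ _ 1).
- move=> N.
  have := admissibleZ (expR_ge0 (- (t * a N)))
    (admissible_expR (mv N) (v0 N) (vb N) (vG N) t0 ler01 (lexx 0) admissible_one).
  have eb : expR (- (t * a N)) * expR (t * b N) <= 1.
    rewrite -expRD -[leRHS]expR0 ler_expR addrC subr_le0 ler_wpM2l//.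
  apply: admissible_le; rewrite ?mul1r ?mul0r ?add0r ?mulr1//.
  rewrite mulrCA -[leRHS]mulr1 ler_wpM2l// mulr_ge0//.
- move=> N k; rewrite FE ger0_norm ?expR_ge0// -expR0 ler_expR oppr_le0 mulr_ge0// subr_ge0.
  by apply: le_trans (ba N); exact: mixture_le.
- move=> k; rewrite (_ : F ^~ k = (fun N => expR (- (t * (a N - mixture (v N) k))))); last first.
    by apply/funext => N; exact: FE.
  apply: continuous_cvg; first exact: continuous_expR.
  by apply: cvgN; apply: cvgMr; exact: cPsi.
Qed.

Lemma cvg_damp (f : K -> R) x : measurable_fun setT f ->
  mu.-integrable setT (fun k => (f k)%:E) ->
  transform (damp (harmonic n) f) x @[n --> \oo] --> transform f x.
Proof.
move=> mf intf.
apply: (@cvg_transform _ _ (fun k => `|f k|)).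
- by move=> n; exact: measurable_damp.
- move=> k; rewrite -[X in _ --> X]mul1r; apply: cvgMl.
  rewrite -expR0; apply: continuous_cvg; first exact: continuous_expR.
  rewrite -oppr0; apply: cvgN; rewrite -(mul0r (q k)); apply: cvgMl.
  exact: cvg_harmonic.
- exact: (integrable_abse intf).
- move=> n k; rewrite /damp normrM -[leRHS]mul1r ler_wpM2r// ger0_norm ?expR_ge0//.
  by rewrite -expR0 ler_expR oppr_le0 mulr_ge0// harmonic_ge0.
Qed.

Lemma admissible_transform_ge0 f A M x : admissible f A M ->
  mu.-integrable setT (fun k => (f k)%:E) -> 0 <= transform f x.
Proof.
move=> [mf _ pf _] intf; have cf := @cvg_damp _ x mf intf.
rewrite -(cvg_lim _ cf)//; apply: limr_ge.
  by apply/cvg_ex; exists (transform f x).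
by apply: nearW => n; apply: pf; exact: harmonic_gt0.
Qed.

Lemma admissible_transform_le f A M : admissible f A M ->
  mu.-integrable setT (fun k => (f k)%:E) ->
  g (harmonic n) @[n --> \oo] --> (0 : R) ->
  (\int[m]_(x in D) (transform f x)%:E <= M%:E)%E.
Proof.
move=> [mf _ pf If] intf g0'.
apply: (@integral_le_lim _ _ _ m D (fun n x => (transform (damp (harmonic n) f) x)%:E) _
  (fun n => (A * g (harmonic n) + M)%:E)) => //.
- move=> n; apply/measurable_EFinP/measurable_funTS; apply: measurable_transform; exact: measurable_damp.
- by move=> n x _; rewrite lee_fin pf// harmonic_gt0.
- by move=> x _; apply: cvg_EFin; [exact: nearW|exact: cvg_damp].
- by move=> n; apply: If; exact: harmonic_gt0.
- apply: cvg_EFin; first exact: nearW.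
  rewrite -[X in _ --> X]add0r; apply: cvgD; last exact: cvg_cst.
  by rewrite -(mulr0 A); apply: cvgMr.
Qed.

Lemma integrable_mixture (w : T -> R) (a e : R) :
  measurable_fun setT w -> (forall y, 0 <= w y) ->
  (\int[nu]_y (w y)%:E = a%:E)%E -> 0 < e -> (forall y, w y != 0 -> e <= theta y) ->
  mu.-integrable setT (fun k => (mixture w k)%:E).
Proof.
move=> mw w0 wa e0 we.
have := integrableZl measurableT a (iq e0); apply: le_integrable => //.
  by apply/measurable_EFinP; exact: measurable_mixture.
move=> k _; rewrite -EFinM /= lee_fin (ger0_norm (mixture_ge0 w0 k)).
apply: le_trans (ler_norm _).
rewrite -lee_fin EFinM -wa /mixture /Rintegral fineK; last first.
  exact: (integrable_fin_num measurableT (integrable_weighted_expR mw w0 wa k)).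
rewrite muleC -ge0_integralZl//; [|exact/measurable_EFinP|by move=> y _; rewrite lee_fin].
apply: ge0_le_integral => //.
- by move=> y _; rewrite lee_fin mulr_ge0// expR_ge0.
- exact/measurable_EFinP/measurable_weighted_expR.
- by apply/measurable_EFinP; exact: measurable_funM.
- move=> y _; rewrite -EFinM lee_fin mulrC.
  have [->|wy] := eqVneq (w y) 0; first by rewrite !mulr0.
  by rewrite ler_wpM2r// ler_expR lerN2 ler_wpM2r// we.
Qed.

(** [transform_mixture] with a vanishing damping, and Fatou's lemma in [y]. *)
Lemma transform_mixture_ge (w : T -> R) (a e : R) x :
  measurable_fun setT w -> (forall y, 0 <= w y) ->
  (\int[nu]_y (w y)%:E = a%:E)%E -> 0 < e -> (forall y, w y != 0 -> e <= theta y) ->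
  (\int[nu]_y (w y * transform (damp (theta y) one) x)%:E <= (transform (mixture w) x)%:E)%E.
Proof.
move=> mw w0 wa e0 we.
have im := integrable_mixture mw w0 wa e0 we.
apply: (@integral_le_lim _ _ _ nu setT
  (fun n y => (w y * transform (damp (harmonic n + theta y) one) x)%:E) _
  (fun n => (transform (damp (harmonic n) (mixture w)) x)%:E)) => //.
- move=> n; apply/measurable_EFinP; apply: measurable_funM => //.
  have mt : measurable_fun setT (fun y => harmonic n + theta y : R) by exact: measurable_funD.
  exact: (measurableT_comp (measurable_transform_damp measurable_one mt) (measurable_pair1 x)).
- by move=> n y _; rewrite lee_fin mulr_ge0// one_ge0// addr_gt0// harmonic_gt0.
- move=> y _; apply: cvg_EFin; first exact: nearW.
  apply: cvgMr.
  have E n : transform (damp (harmonic n + theta y) one) x =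
     transform (damp (harmonic n) (damp (theta y) one)) x.
    congr (transform _ x); apply/funext => k; rewrite /damp /one !mulr1 -expRD; congr expR; ring.
  under eq_fun do rewrite /= E.
  apply: cvg_damp; first exact: (measurable_damp _ measurable_one).
  rewrite (_ : (fun k => _) = (fun k => (expR (- (theta y * q k)))%:E)); first exact: iq.
  by apply/funext => k; rewrite /damp mulr1.
- move=> n; have b1 : bounded_mfun one 1.
    by split; [exact: measurable_cst|move=> k; rewrite /one normr1].
  rewrite -(transform_mixture mw w0 wa x (harmonic_gt0 n) b1).
  rewrite (_ : (fun k => mixture w k * one k) = mixture w)//.
  by apply/funext => k; rewrite mulr1.
- by apply: cvg_EFin; [exact: nearW|exact: (@cvg_damp _ x (measurable_mixture mw w0))].
Qed.

End mixtures.

(** * The stable change of time *)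

Section stable_time.
Context {R : realType}.
Local Notation mu := (@lebesgue_measure R).
Local Notation TR := (measurableTypeR R).
Variable s : R.
Hypotheses (s0 : 0 < s) (s2 : s <= 2^-1).

(** [x^(-1/s)] for positive [x], written so as to be positive everywhere. *)
Definition stable_time (x : R) : R := expR (- (ln x / s)).

Lemma stable_time_gt0 x : 0 < stable_time x.
Proof. exact: expR_gt0. Qed.

Lemma measurable_stable_time : measurable_fun setT stable_time.
Proof. do 2 apply: measurableT_comp => //; apply: measurable_funM => //; exact: measurable_ln. Qed.

Lemma stable_timeM c x : 0 < c -> 0 < x -> stable_time (c * x) = stable_time c * stable_time x.
Proof. by move=> c0 x0; rewrite /stable_time lnM ?posrE// -expRD; congr expR; ring. Qed.

Lemma stable_time_powR l : 0 < l -> stable_time (l `^ s)^-1 = l.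
Proof.
move=> l0; rewrite /stable_time lnV ?posrE ?powR_gt0// ln_powR mulNr opprK mulrAC divff ?gt_eqF// mul1r.
by rewrite lnK ?posrE.
Qed.

Lemma stable_time_le x y : 0 < x -> x <= y -> stable_time y <= stable_time x.
Proof.
move=> x0 xy; rewrite ler_expR lerN2 ler_pM2r ?invr_gt0// ler_ln ?posrE//.
exact: lt_le_trans xy.
Qed.

Lemma stable_time1 : stable_time 1 = 1.
Proof. by rewrite /stable_time ln1 mul0r oppr0 expR0. Qed.

Definition positives : set TR := `]0, +oo[%classic.

Lemma positivesE (x : R) : \1_positives x = (0 < x)%R%:R :> R.
Proof. by rewrite indicE /positives mem_setE/= in_itv/= andbT. Qed.

Lemma measurable_positives : measurable_fun setT (\1_positives : TR -> R).
Proof. by apply: measurable_indic; exact: measurable_itv. Qed.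

(** The substitution [x := l^(-s) x] absorbs the factor [l]; the powers [l `^ s] come
    from it. *)
Lemma stable_time_scale (l : R) (F : R -> R) : 0 < l -> measurable_fun setT F ->
  (forall t, 0 <= F t) ->
  (\int[mu]_x (\1_positives x * F (l * stable_time x))%:E =
   (l `^ s)%:E * \int[mu]_x (\1_positives x * F (stable_time x))%:E)%E.
Proof.
move=> l0 mF F0; pose c := (l `^ s)^-1.
have c0 : 0 < c by rewrite invr_gt0 powR_gt0.
have := @ge0_integral_affine _ c 0 (fun x => (\1_positives x * F (stable_time x))%:E) c0.
rewrite invrK => <-.
- apply: eq_integral => x _; rewrite !positivesE addr0 pmulr_rgt0//.
  have [x0|] := boolP (0 < x); last by rewrite !mul0r.
  by rewrite stable_timeM// stable_time_powR.
- apply/measurable_EFinP; apply: measurable_funM; first exact: measurable_positives.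
  exact: (measurableT_comp mF measurable_stable_time).
- by move=> x; rewrite lee_fin positivesE mulr_ge0.
Qed.

Lemma integral_gt0_itv (F : R -> R) (e : R) : measurable_fun setT F ->
  (forall x, 0 <= F x) -> 0 < e -> (forall x, 1 < x <= 2 -> e <= F x) ->
  (e%:E <= \int[mu]_x (F x)%:E)%E.
Proof.
move=> mF F0 e0 Fe.
have -> : e%:E = (\int[mu]_x (e%:E * (\1_(`]1, 2]%classic : set TR) x)%:E))%E.
  rewrite ge0_integralZl//; last by rewrite lee_fin ltW.
    rewrite integral_indic//= setIT lebesgue_measure_itv/= lte_fin ltr1n -EFinB -EFinM.
    by congr EFin; ring.
  by apply/measurable_EFinP; apply: measurable_indic; exact: measurable_itv.
apply: ge0_le_integral => //.
- by move=> x _; rewrite -EFinM lee_fin mulr_ge0// ltW.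
- by apply/measurable_EFinP; apply: measurable_funM.
- exact/measurable_EFinP.
- move=> x _; rewrite -EFinM lee_fin indicE mem_setE/= in_itv/=.
  by have [/Fe|_] := boolP (1 < x <= 2); rewrite ?mulr1// mulr0.
Qed.

Lemma integral_fin_num_dominated (F : R -> R) (C : R) : measurable_fun setT F ->
  (forall x, 0 <= F x) -> (forall x, F x <= C * (oneDsqr x)^-1) ->
  (\int[mu]_x (F x)%:E)%E \is a fin_num.
Proof.
move=> mF F0 F2.
rewrite ge0_fin_numE ?integral_ge0//; last by move=> x _; rewrite lee_fin.
have iC := integrableZl measurableT C (@integrable_oneDsqrV R).
have /integrableP[_] := iC; apply: le_lt_trans; apply: ge0_le_integral => //.
- by move=> x _; rewrite lee_fin.
- exact/measurable_EFinP.
- exact: (measurable_int _ (integrable_abse iC)).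
- by move=> x _; rewrite -EFinM /= lee_fin (le_trans (F2 x))// ler_norm.
Qed.

(** Near infinity the integrand is at most [stable_time x = x^(-1/s)], hence at most [x^(-2)]
    as [s <= 1/2]; near zero it is at most 1. *)
Lemma exists_bernstein_constant : exists kappa : R, 0 < kappa /\
  (\int[mu]_x (\1_positives x * (1 - expR (- stable_time x)))%:E = kappa%:E)%E.
Proof.
pose F (x : R) := \1_positives x * (1 - expR (- stable_time x)).
have e0 x : 0 <= 1 - expR (- stable_time x).
  by rewrite subr_ge0 -expR0 ler_expR oppr_le0 ltW// stable_time_gt0.
have F0 x : 0 <= F x by rewrite /F positivesE mulr_ge0.
have mF : measurable_fun setT F.
  apply: measurable_funM; first exact: measurable_positives.
  apply: measurable_funB => //; do 2 apply: measurableT_comp => //; exact: measurable_stable_time.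
have F2 x : F x <= 2 * (oneDsqr x)^-1.
  rewrite ler_pdivlMr ?oneDsqr_gt0//.
  have [x1|x1] := leP x 1.
    rewrite /F positivesE; have [x0|] := boolP (0 < x); last by rewrite !mul0r.
    rewrite mul1r -[leRHS]mul1r ler_pM ?oneDsqr_ge0//.
    by rewrite /oneDsqr -[leRHS]/(1 + 1) lerD2l expr_le1// ltW.
  have x0 : 0 < x := lt_trans ltr01 x1.
  have tx : stable_time x <= (x ^+ 2)^-1.
    rewrite -[x ^+ 2]lnK ?posrE ?exprn_gt0// -expRN ler_expR lerN2 lnXn//.
    rewrite -mulr_natr ler_pdivlMr// -mulrA -[leRHS]mulr1 ler_wpM2l ?ln_ge0 ?(ltW x1)//.
    by move: s2; lra.
  rewrite /F positivesE x0 mul1r.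
  apply: (@le_trans _ _ ((x ^+ 2)^-1 * (2 * x ^+ 2))).
    rewrite ler_pM ?oneDsqr_ge0//.
      apply: le_trans tx; rewrite lerBlDr addrC -lerBlDr.
      exact: expR_ge1Dx.
    rewrite /oneDsqr mulr_natl mulr2n lerD2r.
    by rewrite -(expr1n _ 2) ler_sqr ?nnegrE ?ltW.
  by rewrite mulrCA mulVf ?mulr1// gt_eqF// exprn_gt0.
have F1 : 0 < 1 - expR (- stable_time 2).
  by rewrite subr_gt0 -expR0 ltr_expR oppr_lt0 stable_time_gt0.
have lF := @integral_gt0_itv F _ mF F0 F1.
have I0 := integral_fin_num_dominated mF F0 F2.
exists (fine (\int[mu]_x (F x)%:E)%E); split; last by rewrite fineK.
rewrite -lte_fin fineK//; apply: lt_le_trans (lF _); first by rewrite lte_fin.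
move=> x /andP[x1 x2]; rewrite /F positivesE (lt_trans ltr01 x1) mul1r.
rewrite lerD2l lerN2 ler_expR lerN2; apply: stable_time_le => //.
exact: lt_trans x1.
Qed.

Lemma powR_expR_bound (b c : R) : 0 <= b -> 0 < c ->
  exists C : R, 0 <= C /\ forall u : R, 0 <= u -> u `^ b * expR (- (c * u)) <= C.
Proof.
move=> b0 c0; pose k := Num.trunc b.
have F0 : (0 : R) < (k.+1)`!%:R by rewrite ltr0n fact_gt0.
have ck0 : 0 < c ^+ k.+1 by rewrite exprn_gt0.
exists (1 + (k.+1)`!%:R / c ^+ k.+1); split; first by rewrite addr_ge0// divr_ge0// ltW.
move=> u u0; rewrite expRN ler_pdivrMr ?expR_gt0//.
have cu0 : 0 <= c * u by rewrite mulr_ge0// ltW.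
apply: (@le_trans _ _ ((1 + (k.+1)`!%:R / c ^+ k.+1) * (1 + (c * u) ^+ k.+1 / (k.+1)`!%:R))); last first.
  by rewrite ler_wpM2l ?expR_ge1Dxn// addr_ge0// divr_ge0// ltW.
have -> : (1 + (k.+1)`!%:R / c ^+ k.+1) * (1 + (c * u) ^+ k.+1 / (k.+1)`!%:R) =
   1 + u ^+ k.+1 + ((c * u) ^+ k.+1 / (k.+1)`!%:R + (k.+1)`!%:R / c ^+ k.+1).
  by rewrite exprMn; field; rewrite !gt_eqF.
rewrite ler_wpDr//; first by rewrite addr_ge0// divr_ge0 ?exprn_ge0// ltW.
have [u1|/ltW u1] := leP u 1.
  rewrite ler_wpDr ?exprn_ge0//.
  have [->|b1] := eqVneq b 0; first by rewrite powRr0.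
  have -> : (1 : R) = 1 `^ b by rewrite powR1.
  by rewrite ge0_ler_powR// nnegrE.
rewrite ler_wpDl// -powR_mulrn// ler_powR//; exact/ltW/truncnS_gt.
Qed.

Section symbol.
Variable kappa : R.
Hypothesis kappaE : (\int[mu]_x (\1_positives x * (1 - expR (- stable_time x)))%:E = kappa%:E)%E.

Lemma bernstein (l : R) : 0 <= l ->
  (\int[mu]_x (\1_positives x * (1 - expR (- (stable_time x * l))))%:E = (kappa * l `^ s)%:E)%E.
Proof.
rewrite le_eqVlt => /predU1P[<-|l0].
  rewrite powR0 ?gt_eqF// mulr0 integral0_eq// => x _.
  by rewrite mulr0 oppr0 expR0 subrr mulr0.
have H := @stable_time_scale l (fun t => `|1 - expR (- t)|) l0.
have E (t : R) : 0 < t -> `|1 - expR (- t)| = 1 - expR (- t).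
  by move=> t0; rewrite ger0_norm// subr_ge0 -expR0 ler_expR oppr_le0 ltW.
rewrite [RHS](_ : _ = ((l `^ s)%:E * \int[mu]_x (\1_positives x * `|1 - expR (- stable_time x)|)%:E)%E).
  rewrite -H//.
  - apply: eq_integral => x _; rewrite E ?mulr_gt0 ?stable_time_gt0//.
    by rewrite (mulrC l).
  - by apply: measurableT_comp => //; apply: measurable_funB => //; do 2 apply: measurableT_comp => //.
rewrite EFinM muleC -kappaE; congr (_ * _)%E; apply: eq_integral => x _.
by rewrite E// stable_time_gt0.
Qed.

(** The weights of the mixtures. Windows have finite mass, contrary to the half-line, and
    start at a variable [M] so that the first part of the time axis can be left out. *)
Definition window (M N : nat) (x : R) : R := \1_(`]M%:R, (M + N)%:R]%classic : set TR) x.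

Lemma windowE M N (x : R) : window M N x = (M%:R < x <= (M + N)%:R)%R%:R.
Proof. by rewrite /window indicE mem_setE/= in_itv. Qed.

Lemma window_ge0 M N x : 0 <= window M N x.
Proof. by rewrite windowE. Qed.

Lemma measurable_window M N : measurable_fun setT (window M N : TR -> R).
Proof. by apply: measurable_indic; exact: measurable_itv. Qed.

Lemma integral_window M N : (\int[mu]_x (window M N x)%:E = N%:R%:E)%E.
Proof.
rewrite integral_indic//= setIT lebesgue_measure_itv/= lte_fin natrD.
case: N => [|N]; first by rewrite addr0 ltxx.
by rewrite ltrDl ltr0n/= -EFinB addrAC subrr add0r.
Qed.

Lemma window_split M N x : window 0 (M + N) x = window 0 M x + window M N x.
Proof.
rewrite !windowE !add0n -natrD; congr (_%:R).
have [xM|xM] := leP x M%:R; rewrite ?andbT ?andbF ?addn0/=.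
  by rewrite (le_trans xM) ?ler_nat ?leq_addr// andbT.
by rewrite (le_lt_trans _ xM)// ler0n.
Qed.

Definition laplace (w : R -> R) (l : R) : R := \int[mu]_x (w x * expR (- (stable_time x * l))).

Lemma integrable_window M N (F : R -> R) : measurable_fun setT F -> (forall x, 0 <= F x <= 1) ->
  mu.-integrable setT (fun x => (window M N x * F x)%:E).
Proof.
move=> mF F01; have mw := @measurable_window M N.
have iw : mu.-integrable setT (fun x => (window M N x)%:E).
  apply/integrableP; split; first exact/measurable_EFinP.
  rewrite (eq_integral (fun x : TR => (window M N x)%:E)); first by rewrite integral_window ltry.
  by move=> x _; rewrite gee0_abs// lee_fin window_ge0.
apply: (le_integrable measurableT _ _ iw); first by apply/measurable_EFinP; exact: measurable_funM.
move=> x _; have /andP[F0 F1] := F01 x; rewrite /= lee_fin normrM -[leRHS]mulr1.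
by rewrite ler_wpM2l// ger0_norm.
Qed.

Lemma expR_stable_time01 l x : 0 <= l -> 0 <= expR (- (stable_time x * l)) <= 1.
Proof.
by move=> l0; rewrite expR_ge0 -expR0 ler_expR oppr_le0 mulr_ge0// ltW// stable_time_gt0.
Qed.

Lemma measurable_expR_stable_time l : measurable_fun setT (fun x : TR => expR (- (stable_time x * l))).
Proof.
by do 2 apply: measurableT_comp => //; apply: measurable_funM => //; exact: measurable_stable_time.
Qed.

Lemma laplace_window_split M N l : 0 <= l ->
  laplace (window 0 (M + N)) l = laplace (window 0 M) l + laplace (window M N) l.
Proof.
move=> l0; rewrite /laplace -RintegralD//; first last.
- by apply: integrable_window => [|x]; [exact: measurable_expR_stable_time|exact: expR_stable_time01].
- by apply: integrable_window => [|x]; [exact: measurable_expR_stable_time|exact: expR_stable_time01].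
by apply: eq_Rintegral => x _; rewrite window_split mulrDl.
Qed.

Lemma cvg_laplace_window0 l : 0 <= l ->
  N%:R - laplace (window 0 N) l @[N --> \oo] --> kappa * l `^ s.
Proof.
move=> l0.
have me1 : measurable_fun setT (fun x : TR => 1 - expR (- (stable_time x * l))).
  by apply: measurable_funB => //; exact: measurable_expR_stable_time.
have e01 x : 0 <= 1 - expR (- (stable_time x * l)) <= 1.
  by have /andP[? ?] := expR_stable_time01 x l0; apply/andP; split; lra.
pose F N x := window 0 N x * (1 - expR (- (stable_time x * l))).
have FE N : (N%:R - laplace (window 0 N) l)%:E = (\int[mu]_x (F N x)%:E)%E.
  have i1 : mu.-integrable setT (fun x => (window 0 N x * 1)%:E).
    by apply: integrable_window => // x; rewrite ler01 lexx.
  have i2 : mu.-integrable setT (fun x => (window 0 N x * expR (- (stable_time x * l)))%:E).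
    by apply: integrable_window => [|x]; [exact: measurable_expR_stable_time|exact: expR_stable_time01].
  rewrite (_ : N%:R = \int[mu]_x (window 0 N x * 1)); last first.
    rewrite /Rintegral; under eq_integral do rewrite mulr1.
    by rewrite integral_window.
  rewrite /laplace -RintegralB// /Rintegral fineK; last first.
    exact: (integrable_fin_num measurableT (integrableB measurableT i1 i2)).
  by apply: eq_integral => x _; rewrite /F; congr EFin; ring.
have pF x : 0 <= \1_positives x * (1 - expR (- (stable_time x * l))) :> R.
  by rewrite positivesE mulr_ge0//; case/andP : (e01 x).
have ip : mu.-integrable setT (fun x => (\1_positives x * (1 - expR (- (stable_time x * l))))%:E).
  apply/integrableP; split.
    by apply/measurable_EFinP; apply: measurable_funM => //; exact: measurable_positives.
  rewrite (eq_integral (fun x : TR => (\1_positives x * (1 - expR (- (stable_time x * l))))%:E)).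
    by rewrite bernstein// ltry.
  by move=> x _; rewrite gee0_abs// lee_fin pF.
have H : (\int[mu]_x (F N x)%:E)%E @[N --> \oo] --> (kappa * l `^ s)%:E.
  rewrite -bernstein//.
  apply: (@dominated_cvg _ _ _ mu setT measurableT _ _
    (fun x => (\1_positives x * (1 - expR (- (stable_time x * l))))%:E)) => //.
  - by move=> N; apply/measurable_EFinP; apply: measurable_funM => //; exact: measurable_window.
  - move=> x _; apply: cvg_near_cst.
    exists (Num.trunc x).+1 => // N /= xN.
    rewrite /F windowE positivesE add0n; have [x0|] := boolP (0 < x); rewrite ?andbF//=.
    rewrite (_ : x <= N%:R = true)//; apply: (@le_trans _ _ (Num.trunc x).+1%:R).
      exact/ltW/truncnS_gt.
    by rewrite ler_nat.
  - move=> N x _; have /andP[e0 _] := e01 x.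
    rewrite /= lee_fin /F ger0_norm ?mulr_ge0 ?window_ge0//.
    rewrite ler_wpM2r// windowE positivesE ler_nat.
    by have [x0|] := boolP (0 < x) => //=; rewrite leq_b1.
apply: (@fine_cvg _ _ _ _ (fun N => (N%:R - laplace (window 0 N) l)%:E)).
by under eq_fun do rewrite FE.
Qed.

Lemma cvg_laplace_window M l : 0 <= l ->
  (M + N)%:R - laplace (window M N) l @[N --> \oo] --> kappa * l `^ s + laplace (window 0 M) l.
Proof.
move=> l0.
have E N : (M + N)%:R - laplace (window M N) l =
   ((M + N)%:R - laplace (window 0 (M + N)) l) + laplace (window 0 M) l.
  by rewrite (laplace_window_split M N l0); ring.
under eq_fun do rewrite E.
apply: cvgD; last exact: cvg_cst.
have := cvg_laplace_window0 l0; rewrite -(cvg_shiftn M).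
by under eq_fun do rewrite addnC.
Qed.

End symbol.

Lemma powR_invl (q b : R) : 0 < q -> q^-1 `^ b = (q `^ b)^-1.
Proof. by move=> q0; rewrite /powR invr_eq0 gt_eqF// lnV ?posrE// mulrN expRN. Qed.

Lemma gaussq_ge0 n (tau q : R) : 0 <= gaussq n tau q.
Proof. by rewrite mulr_ge0 ?expR_ge0// invr_ge0 exprn_ge0// sqrtr_ge0. Qed.

Lemma measurable_sqrtr : measurable_fun setT (@Num.sqrt R).
Proof. by apply: continuous_measurable_fun; exact: sqrt_continuous. Qed.

Lemma measurable_invr : measurable_fun setT (fun x : R => x^-1).
Proof.
rewrite (_ : (fun x => _) = (fun x : R => x * (x ^+ 2) `^ (- 1))).
  apply: measurable_funM => //; apply: (measurableT_comp (measurable_powR (- 1))).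
  exact: measurable_funX.
apply/funext => x; rewrite powR_inv1 ?sqr_ge0//.
have [->|x0] := eqVneq x 0; first by rewrite invr0 mul0r.
by rewrite expr2 invfM mulrA divff// mul1r.
Qed.

Lemma measurable_gaussq n : measurable_fun setT (fun p : R * R => gaussq n p.1 p.2).
Proof.
have m1 : measurable_fun setT (fun p : R * R => p.1) by exact: measurable_fst.
have m2 : measurable_fun setT (fun p : R * R => p.2) by exact: measurable_snd.
have inv := measurable_invr.
apply: measurable_funM.
  apply: (measurableT_comp inv); apply: measurable_funX.
  apply: (measurableT_comp measurable_sqrtr); exact: measurable_funM.
apply: measurableT_comp => //; apply: measurable_funM; first exact: measurableT_comp.
by apply: (measurableT_comp inv); exact: measurable_funM.
Qed.

Lemma gaussq_scale n (tau q : R) : 0 < tau -> 0 < q ->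
  gaussq n tau q = (Num.sqrt q ^+ n)^-1 * gaussq n (q^-1 * tau) 1.
Proof.
move=> t0 q0; have p0 := pi_gt0 R.
rewrite /gaussq mulrA -!invfM -exprMn -sqrtrM ?ltW//; congr (Num.sqrt _ ^- _ * expR _).
  by field; rewrite gt_eqF.
by field; rewrite !gt_eqF.
Qed.

(** In the variable [t^-1] the profile is a power times [expR (- t^-1 / 4)]. Half of the
    exponent absorbs the powers and the other half remains, which makes the bound integrable
    after the change of time below. *)
Lemma gaussq1_bound n (b : R) : 0 <= b -> exists C : R, 0 <= C /\ forall t : R, 0 < t ->
  t^-1 `^ b * gaussq n t 1 <= C * expR (- (8^-1 * t^-1)).
Proof.
move=> b0; have p0 := pi_gt0 R.
have [C [C0 HC]] := @powR_expR_bound (b + n%:R / 2) 8^-1 (addr_ge0 b0 (divr_ge0 (ler0n _ n) (ler0n _ 2))) ltac:(by rewrite invr_gt0).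
exists (Num.sqrt (4 * pi) ^- n * C); split.
  by rewrite mulr_ge0// invr_ge0 exprn_ge0// sqrtr_ge0.
move=> t t0; have t1 : 0 < t^-1 by rewrite invr_gt0.
have := HC _ (ltW t1); set u := t^-1 in t1 * => Hu.
have -> : gaussq n t 1 = Num.sqrt (4 * pi) ^- n * (u `^ (n%:R / 2) * (expR (- (8^-1 * u)) * expR (- (8^-1 * u)))).
  rewrite /gaussq sqrtrM ?mulr_ge0// ?ltW// exprMn invfM [RHS]mulrA; congr (_ * _ * _).
    rewrite -exprVn -sqrtrV ?ltW// -/u -powR12_sqrt ?ltW// -powR_mulrn ?powR_ge0// -powRrM.
    by congr (_ `^ _); ring.
  by rewrite -expRD; congr expR; rewrite /u; field; rewrite gt_eqF.
have -> : u `^ b * (Num.sqrt (4 * pi) ^- n * (u `^ (n%:R / 2) * (expR (- (8^-1 * u)) * expR (- (8^-1 * u))))) =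
   Num.sqrt (4 * pi) ^- n * (u `^ (b + n%:R / 2) * expR (- (8^-1 * u))) * expR (- (8^-1 * u)).
  have -> : u `^ (b + n%:R / 2) = u `^ b * u `^ (n%:R / 2).
    by rewrite powRD// [u == 0]gt_eqF// implybT.
  move: (_ ^- n) (u `^ b) (u `^ (n%:R / 2)) (expR _) => x1 x2 x3 x4; ring.
by rewrite ler_wpM2r ?expR_ge0// ler_wpM2l// invr_ge0 exprn_ge0// sqrtr_ge0.
Qed.

(** By [gaussq_scale] and the scaling of the time, the integral at [q] is a power of [q] times
    its value at 1, which is finite by [gaussq1_bound] and not zero. *)
Lemma exists_jump_constant n : exists CJ : R, 0 < CJ /\ forall q : R, 0 < q ->
  (\int[mu]_x (\1_positives x * gaussq n (stable_time x) q)%:E =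
   (CJ * (Num.sqrt q ^+ n * q `^ s)^-1)%:E)%E.
Proof.
have p0 := pi_gt0 R.
pose F (x : R) := \1_positives x * gaussq n (stable_time x) 1.
have mG1 : measurable_fun setT (fun t : R => gaussq n t 1).
  apply: (measurableT_comp (@measurable_gaussq n) (g := fun t : R => (t, 1 : R))).
  by apply/measurable_fun_pair; [exact: measurable_id|exact: measurable_cst].
have mF : measurable_fun setT F.
  apply: measurable_funM; first exact: measurable_positives.
  exact: (measurableT_comp mG1 measurable_stable_time).
have F0 x : 0 <= F x by rewrite /F positivesE mulr_ge0// gaussq_ge0.
have [C [C0 HC]] := @gaussq1_bound n 0 (lexx 0).
have [C' [C'0 HC']] := @expR_powR_le_oneDsqrV R 8^-1 (2 * s)^-1 ltac:(by rewrite invr_gt0) ltac:(by rewrite invr_gt0 mulr_gt0).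
have F2 x : F x <= (C * C') * (oneDsqr x)^-1.
  rewrite /F positivesE; have [x0|] := boolP (0 < x); last first.
    by rewrite mul0r !mulr_ge0// invr_ge0 oneDsqr_ge0.
  rewrite mul1r; have := HC _ (stable_time_gt0 x); rewrite powRr0 mul1r => /le_trans; apply.
  rewrite -mulrA ler_wpM2l//; apply: le_trans (HC' x).
  rewrite (_ : (stable_time x)^-1 = (x ^+ 2) `^ (2 * s)^-1)//.
  rewrite /stable_time expRN invrK /powR gt_eqF ?exprn_gt0//; congr expR.
  by rewrite lnXn//; field; rewrite gt_eqF.
have I0 := integral_fin_num_dominated mF F0 F2.
pose e := Num.sqrt (4 * pi) ^- n * expR (- 1 / (4 * stable_time 2)).
have e0 : 0 < e.
  by rewrite mulr_gt0 ?expR_gt0// invr_gt0 exprn_gt0// sqrtr_gt0 mulr_gt0.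
exists (fine (\int[mu]_x (F x)%:E)%E); split.
  rewrite -lte_fin fineK//; apply: (@lt_le_trans _ _ e%:E); first by rewrite lte_fin.
  apply: integral_gt0_itv => // x /andP[x1 x2].
  have x0 := lt_trans ltr01 x1.
  rewrite /F positivesE x0 mul1r /e /gaussq.
  have t0 := stable_time_gt0 x.
  rewrite ler_pM ?expR_ge0 ?invr_ge0 ?exprn_ge0 ?sqrtr_ge0//.
    rewrite lef_pV2 ?posrE ?exprn_gt0 ?sqrtr_gt0 ?mulr_gt0//.
    rewrite lerXn2r ?nnegrE ?sqrtr_ge0//; apply: ler_wsqrtr.
    rewrite -[leRHS]mulr1 ler_wpM2l ?mulr_ge0 ?(ltW p0)//.
    by rewrite -stable_time1 stable_time_le// (ltW x1).
  rewrite ler_expR !mulN1r lerN2 lef_pV2 ?posrE ?mulr_gt0 ?stable_time_gt0//.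
  by rewrite ler_pM2l// stable_time_le.
move=> q q0; have qV0 : 0 < q^-1 by rewrite invr_gt0.
have H := @stable_time_scale _ (fun t => gaussq n t 1) qV0 mG1 (fun t => gaussq_ge0 n t 1).
transitivity (((Num.sqrt q ^+ n)^-1)%:E * \int[mu]_x (\1_positives x * gaussq n (q^-1 * stable_time x) 1)%:E)%E.
  rewrite -ge0_integralZl//=.
  - apply: eq_integral => x _; rewrite -EFinM gaussq_scale ?stable_time_gt0//.
    by congr EFin; ring.
  - apply/measurable_EFinP; apply: measurable_funM; first exact: measurable_positives.
    apply: (measurableT_comp mG1); apply: measurable_funM => //; exact: measurable_stable_time.
  - by move=> x _; rewrite lee_fin positivesE mulr_ge0// gaussq_ge0.
rewrite H -[X in (_ * (_ * X))%E](fineK I0) -!EFinM; congr EFin.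
by rewrite invfM powR_invl// mulrCA [RHS]mulrA mulrC; ring.
Qed.

Lemma gaussq_le_power n : exists C : R, 0 <= C /\ forall d q : R, 0 < d -> 0 < q ->
  gaussq n d q <= C * d `^ s * (Num.sqrt q ^+ n * q `^ s)^-1.
Proof.
have [C [C0 HC]] := @gaussq1_bound n s (ltW s0).
exists C; split=> // d q d0 q0.
have qd : 0 < q^-1 * d by rewrite mulr_gt0// invr_gt0.
have := HC _ qd => H.
have {}H : (q^-1 * d)^-1 `^ s * gaussq n (q^-1 * d) 1 <= C.
  apply: le_trans H _; rewrite -[leRHS]mulr1 ler_wpM2l// -expR0 ler_expR oppr_le0.
  by rewrite mulr_ge0 ?invr_ge0// ltW.
rewrite gaussq_scale// [leRHS](_ : _ = (Num.sqrt q ^+ n)^-1 * (C * d `^ s * (q `^ s)^-1)); last first.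
  by rewrite invfM; ring.
rewrite ler_wpM2l ?invr_ge0 ?exprn_ge0 ?sqrtr_ge0//.
have qs0 : 0 < q `^ s by rewrite powR_gt0.
have ds0 : 0 < d `^ s by rewrite powR_gt0.
move: H; rewrite invfM invrK powRM ?invr_ge0 ?(ltW q0) ?(ltW d0)// powR_invl//.
rewrite mulrAC ler_pdivrMr// mulrC -ler_pdivlMr// => /le_trans; exact.
Qed.

End stable_time.

(** * Heat content and perimeter as integrals over pairs *)

Lemma ge0_integral_setX d1 d2 (T1 : measurableType d1) (T2 : measurableType d2) (R : realType)
    (m1 : {sigma_finite_measure set T1 -> \bar R}) (m2 : {sigma_finite_measure set T2 -> \bar R})
    (E : set T1) (F : set T2) (h : T1 * T2 -> \bar R) :
  measurable E -> measurable F -> measurable_fun setT h -> (forall p, 0 <= h p)%E ->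
  (\int[(m1 \x m2)%E]_(p in E `*` F) h p = \int[m1]_(x in E) \int[m2]_(y in F) h (x, y))%E.
Proof.
move=> mE mF mh h0.
have mEF : measurable (E `*` F) by exact: measurableX.
rewrite integral_mkcond fubini_tonelli1; last 2 first.
- by apply/(measurable_restrictT _ mEF); exact: measurable_funTS.
- by move=> p; rewrite patchE; case: ifPn.
rewrite [RHS]integral_mkcond; apply: eq_integral => x _; rewrite /fubini_F patchE.
case: ifPn => xE.
  rewrite [RHS]integral_mkcond; apply: eq_integral => y _; rewrite !patchE.
  by rewrite in_setX xE.
by apply: integral0_eq => y _; rewrite patchE in_setX (negbTE xE).
Qed.

Section pairs.
Context {R : realType} {n : nat}.
Local Notation leb := (@lebesgue R n).
Local Notation pair_type := (Rn R n * Rn R n)%type.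
Local Notation pairs := (leb \x leb)%E.
Implicit Types (p : pair_type) (E : set (Rn R n)).

Definition diff p : n.-tuple R := vsub p.1 p.2.

Lemma measurable_tnth_diff d (S : measurableType d) (u : S -> pair_type) i :
  measurable_fun setT u -> measurable_fun setT (fun x => tnth (diff (u x)) i).
Proof.
move=> mu; rewrite (_ : (fun x => _) = (fun x => tnth (u x).1 i - tnth (u x).2 i)); last first.
  by apply/funext => x; rewrite tnth_mktuple.
apply: measurable_funB.
- exact: (measurableT_comp (measurable_tnth_Rn i) (measurableT_comp measurable_fst mu)).
- exact: (measurableT_comp (measurable_tnth_Rn i) (measurableT_comp measurable_snd mu)).
Qed.

Definition sqdist p : R := inner (diff p) (diff p).

Lemma measurable_sqdist : measurable_fun setT sqdist.
Proof.
by apply: measurable_inner => i; exact: (measurable_tnth_diff i (@measurable_id _ _ setT)).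
Qed.

Lemma sqdist_ge0 p : 0 <= sqdist p.
Proof. exact: inner_ge0. Qed.

Lemma sqdist_gt0 p : p.1 != p.2 :> n.-tuple R -> 0 < sqdist p.
Proof.
move=> xy; rewrite lt_neqAle sqdist_ge0 andbT eq_sym.
apply: contra xy; rewrite /sqdist /inner psumr_eq0; last by move=> i _; rewrite -expr2 sqr_ge0.
move=> /allP H; apply/eqP/eq_from_tnth => i.
have := H i (mem_index_enum i); rewrite /diff tnth_mktuple mulf_eq0 orbb subr_eq0.
by move/eqP.
Qed.

Lemma sqdist_swap (x y : Rn R n) : sqdist (x, y) = sqdist (y, x).
Proof.
by rewrite /sqdist /inner; apply: eq_bigr => i _; rewrite !tnth_mktuple; ring.
Qed.

Definition phase p (xi : Rn R n) : R := cos (inner (diff p) xi).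

Lemma measurable_phase : measurable_fun setT (fun r : pair_type * Rn R n => phase r.1 r.2).
Proof.
apply: (measurableT_comp measurable_cos).
apply: (@measurable_inner R _ (pair_type * Rn R n)%type n (fun r => diff r.1) (fun r => r.2)) => i.
- exact: (measurable_tnth_diff i (measurable_fst)).
- exact: (measurableT_comp (measurable_tnth_Rn i) measurable_snd).
Qed.

Lemma phase_le1 p xi : `|phase p xi| <= 1.
Proof. exact: cos_max. Qed.

Definition sqnorm (xi : Rn R n) : R := inner xi xi.

Lemma measurable_sqnorm : measurable_fun setT sqnorm.
Proof. exact: (measurable_Rn (@measurable_sqnorm_tuple R n)). Qed.

Lemma sqnorm_ge0 xi : 0 <= sqnorm xi.
Proof. exact: inner_ge0. Qed.

Lemma integrable_expR_sqnorm (d : R) : 0 < d ->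
  leb.-integrable setT (fun xi => (expR (- (d * sqnorm xi)))%:E).
Proof. by move=> d0; have [] := integrable_gauss_lebesgue n d0. Qed.

Lemma gaussian_transform (d : R) p : 0 < d ->
  transform leb phase (damp sqnorm d (@one R _ _)) p = (2 * pi) ^+ n * gaussq n d (sqdist p).
Proof.
move=> d0; rewrite /transform /Rintegral.
rewrite (eq_integral (fun xi : Rn R n => (expR (- (d * inner xi xi)) * cos (inner (diff p) xi))%:E)); last first.
  by move=> xi _; rewrite /damp /one mulr1.
by rewrite (integral_gauss_fourier _ d0).
Qed.

Definition off_diagonal E : set pair_type := E `*` ~` E.

Lemma measurable_off_diagonal E : measurable E -> measurable (off_diagonal E).
Proof. by move=> mE; apply: measurableX => //; exact: measurableC. Qed.

Lemma off_diagonal_sqdist E p : off_diagonal E p -> 0 < sqdist p.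
Proof.
move=> [p1 p2]; apply: sqdist_gt0; apply/eqP => p12.
by apply: p2; rewrite -[p.2]p12.
Qed.

(** Without the factor [(2 * pi) ^- n], so as to be an instance of [transform]. *)
Definition heat s (t : R) p : R :=
  transform leb phase (fun xi => expR (- (t * sqnorm xi `^ s))) p.

Lemma heat_kernelE s t p :
  heat_kernel s (diff p : Rn R n) t = (2 * pi) ^- n * heat s t p.
Proof.
rewrite /heat_kernel /cintegral /heat /transform /=.
rewrite mul0r subr0; congr (_ * _).
apply: eq_Rintegral => xi _ /=.
by rewrite mul0r subr0 enorm_powR mulNr.
Qed.

Lemma measurable_stable_symbol (t s : R) :
  measurable_fun setT (fun xi : Rn R n => expR (- (t * sqnorm xi `^ s))).
Proof.
have m1 : measurable_fun setT (fun q : R => expR (- (t * q `^ s))).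
  by do 2 apply: measurableT_comp => //; apply: measurable_funM.
exact: (measurableT_comp m1 measurable_sqnorm).
Qed.

Lemma measurable_heat (s t : R) : measurable_fun setT (heat s t).
Proof. exact: (measurable_transform leb measurable_phase (measurable_stable_symbol t s)). Qed.

Lemma heat_contentE (s t : R) E : measurable E -> (forall p, 0 <= heat s t p) ->
  heat_content s t E =
  (((2 * pi) ^- n)%:E * \int[pairs]_(p in off_diagonal E) (heat s t p)%:E)%E.
Proof.
move=> mE h0.
have c0 : 0 <= (2 * pi : R) ^- n by rewrite invr_ge0 exprn_ge0// mulr_ge0// pi_ge0.
have mh : measurable_fun setT (fun p => (heat s t p)%:E) by apply/measurable_EFinP; exact: measurable_heat.
rewrite -(ge0_integralZl _ (measurable_off_diagonal mE)); last 3 first.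
- exact: measurable_funTS.
- by move=> p _; rewrite lee_fin.
- by rewrite lee_fin.
have mh' : measurable_fun setT (fun p => ((2 * pi) ^- n)%:E * (heat s t p)%:E)%E.
  exact: measurable_funeM.
have h0' p : (0 <= ((2 * pi) ^- n)%:E * (heat s t p)%:E)%E by rewrite mule_ge0 ?lee_fin.
rewrite (ge0_integral_setX _ _ mE (measurableC mE) mh' h0').
apply: eq_integral => x _; apply: eq_integral => y _.
by rewrite -EFinM -(heat_kernelE s t (x, y)).
Qed.

Definition jump (s : R) p : R := (Num.sqrt (sqdist p) ^+ n * sqdist p `^ s)^-1.

Lemma jump_ge0 s p : 0 <= jump s p.
Proof. by rewrite invr_ge0 mulr_ge0 ?powR_ge0// exprn_ge0// sqrtr_ge0. Qed.

Lemma measurable_jump s : measurable_fun setT (jump s).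
Proof.
have m1 : measurable_fun setT (fun q : R => (Num.sqrt q ^+ n * q `^ s)^-1).
  apply: (measurableT_comp measurable_invr); apply: measurable_funM => //.
  by apply: measurable_funX; exact: measurable_sqrtr.
exact: (measurableT_comp m1 measurable_sqdist).
Qed.

Lemma fractional_perimeterE (s : R) E : measurable E ->
  fractional_perimeter s E = (\int[pairs]_(p in off_diagonal E) (jump s p)%:E)%E.
Proof.
move=> mE.
have mj : measurable_fun setT (fun p => (jump s p)%:E) by apply/measurable_EFinP; exact: measurable_jump.
have j0 p : (0 <= (jump s p)%:E)%E by rewrite lee_fin jump_ge0.
rewrite (ge0_integral_setX _ _ mE (measurableC mE) mj j0).
apply: eq_integral => x xE; apply: eq_integral => y yE.
have q0 : 0 < sqdist (x, y) by apply: (@off_diagonal_sqdist E); split; apply/set_mem.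
rewrite /jump div1r; congr ((_)^-1)%:E.
have -> : enorm (vsub y x) = Num.sqrt (sqdist (x, y)) by rewrite sqdist_swap.
rewrite powRD; last by apply/implyP => _; rewrite gt_eqF// sqrtr_gt0.
rewrite powR_mulrn ?sqrtr_ge0//; congr (_ * _).
rewrite -powR12_sqrt ?ltW// -powRrM; congr (_ `^ _); by field.
Qed.
End pairs.

(** * Subadditivity of the Gaussian content *)

Lemma integral_indicator d (T : measurableType d) (R : realType) (m : {measure set T -> \bar R})
    (E : set T) (f : T -> \bar R) :
  (\int[m]_(x in E) f x = \int[m]_x ((\1_E x : R)%:E * f x))%E.
Proof.
rewrite integral_mkcond; apply: eq_integral => x _.
by rewrite patchE indicE; case: ifPn => xE; rewrite ?mul1e ?mul0e.
Qed.

Section crossing.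
Local Open Scope ereal_scope.
Context d (T : measurableType d) (R : realType) (m : {sigma_finite_measure set T -> \bar R}).
Variables (a b : T * T -> \bar R) (e e' : T -> \bar R).
Hypotheses (ma : measurable_fun setT a) (mb : measurable_fun setT b).
Hypotheses (a0 : forall p, 0 <= a p) (b0 : forall p, 0 <= b p).
Hypotheses (me : measurable_fun setT e) (me' : measurable_fun setT e').
Hypotheses (e0 : forall x, 0 <= e x) (e'0 : forall x, 0 <= e' x) (ee' : forall x, e x + e' x = 1).
Hypotheses (a1 : forall w, \int[m]_x a (x, w) <= 1) (b1 : forall w, \int[m]_y b (w, y) <= 1).

Let e1 x : e x <= 1. Proof. by rewrite -(ee' x) leeDl. Qed.
Let e'1 x : e' x <= 1. Proof. by rewrite -(ee' x) leeDr. Qed.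

Let msect1 (f : T * T -> \bar R) x : measurable_fun setT f -> measurable_fun setT (fun y => f (x, y)).
Proof. by move=> mf; exact: (measurableT_comp mf (measurable_pair1 x)). Qed.

Let msect2 (f : T * T -> \bar R) y : measurable_fun setT f -> measurable_fun setT (fun x => f (x, y)).
Proof. by move=> mf; exact: (measurableT_comp mf (measurable_pair2 y)). Qed.

(** For [e] and [e'] the indicators of a set and its complement: a path [x, w, y] with [x] in
    the set and [y] outside either has [w] outside, and its first step crosses, or [w] inside, and its
    second step crosses. The integral of the other step is at most 1. *)
Lemma crossing_le :
  \int[m]_x (e x * \int[m]_y (e' y * \int[m]_w (a (x, w) * b (w, y)))) <=
  \int[m]_x (e x * \int[m]_y (e' y * a (x, y))) + \int[m]_x (e x * \int[m]_y (e' y * b (x, y))).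
Proof.
pose B w := \int[m]_y (e' y * b (w, y)).
have mB : measurable_fun setT B.
  apply: (@measurable_fun_fubini_tonelli_F _ _ T T R m (fun p => e' p.2 * b p)).
    by apply: emeasurable_funM => //; exact: measurableT_comp.
  by move=> p; rewrite mule_ge0.
have B0 w : 0 <= B w by apply: integral_ge0 => y _; rewrite mule_ge0.
have B1 w : B w <= 1.
  apply: le_trans (b1 w); apply: ge0_le_integral => //.
  - by move=> y _; rewrite mule_ge0.
  - by apply: emeasurable_funM => //; exact: msect1.
  - exact: msect1.
  - by move=> y _; rewrite -[leRHS]mul1e; exact: lee_wpmul2r.
have inner x : \int[m]_y (e' y * \int[m]_w (a (x, w) * b (w, y))) = \int[m]_w (a (x, w) * B w).
  transitivity (\int[m]_y \int[m]_w (e' y * (a (x, w) * b (w, y)))).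
    apply: eq_integral => y _; rewrite ge0_integralZl//.
    - by apply: emeasurable_funM; [exact: msect1|exact: msect2].
    - by move=> w _; rewrite mule_ge0.
  rewrite (@fubini_tonelli _ _ T T R m m (fun p => e' p.1 * (a (x, p.2) * b (p.2, p.1)))).
  - apply: eq_integral => w _ /=.
    rewrite /B -ge0_integralZl//.
    + by apply: eq_integral => y _; rewrite muleCA.
    + by apply: emeasurable_funM => //; exact: msect1.
    + by move=> y _; rewrite mule_ge0.
  - apply: emeasurable_funM; first exact: measurableT_comp.
    apply: emeasurable_funM.
      exact: (measurableT_comp (msect1 x ma) measurable_snd).
    apply: (measurableT_comp mb (g := fun p : T * T => (p.2, p.1))).
    by apply/measurable_fun_pair; [exact: measurable_snd|exact: measurable_fst].
  - by move=> p; rewrite !mule_ge0.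
under eq_integral do rewrite inner.
have split x : \int[m]_w (a (x, w) * B w) <=
    \int[m]_w (e' w * a (x, w)) + \int[m]_w (e w * (a (x, w) * B w)).
  rewrite -ge0_integralD//.
  - apply: ge0_le_integral => //.
    + by move=> w _; rewrite mule_ge0.
    + by apply: emeasurable_funM => //; exact: msect1.
    + apply: emeasurable_funD; apply: emeasurable_funM => //; first exact: msect1.
      by apply: emeasurable_funM => //; exact: msect1.
    + move=> w _; rewrite -[leLHS]mul1e -(ee' w) addeC ge0_muleDl//.
      rewrite leeD2r// lee_wpmul2l// -[leRHS]mule1 lee_wpmul2l//.
  - by move=> w _; rewrite mule_ge0.
  - by apply: emeasurable_funM => //; exact: msect1.
  - by move=> w _; rewrite !mule_ge0.
  - by apply: emeasurable_funM => //; apply: emeasurable_funM => //; exact: msect1.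
have mA : measurable_fun setT (fun x => \int[m]_w (e' w * a (x, w))).
  apply: (@measurable_fun_fubini_tonelli_F _ _ T T R m (fun p => e' p.2 * a p)).
    by apply: emeasurable_funM => //; exact: measurableT_comp.
  by move=> p; rewrite mule_ge0.
have mC : measurable_fun setT (fun p : T * T => e p.2 * (a p * B p.2)).
  apply: emeasurable_funM; first exact: measurableT_comp.
  by apply: emeasurable_funM => //; exact: measurableT_comp.
have mC1 : measurable_fun setT (fun x => \int[m]_w (e w * (a (x, w) * B w))).
  apply: (@measurable_fun_fubini_tonelli_F _ _ T T R m (fun p => e p.2 * (a p * B p.2))) => //.
  by move=> p; rewrite !mule_ge0.
have A0 x : 0 <= \int[m]_w (e' w * a (x, w)) by apply: integral_ge0 => w _; rewrite mule_ge0.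
have C0 x : 0 <= \int[m]_w (e w * (a (x, w) * B w)).
  by apply: integral_ge0 => w _; rewrite !mule_ge0.
apply: (@le_trans _ _ (\int[m]_x (e x * (\int[m]_w (e' w * a (x, w)) + \int[m]_w (e w * (a (x, w) * B w)))))).
  apply: ge0_le_integral => //.
  - by move=> x _; rewrite mule_ge0// integral_ge0// => w _; rewrite mule_ge0.
  - apply: emeasurable_funM => //.
    apply: (@measurable_fun_fubini_tonelli_F _ _ T T R m (fun p => a p * B p.2)).
      by apply: emeasurable_funM => //; exact: measurableT_comp.
    by move=> p; rewrite mule_ge0.
  - by apply: emeasurable_funM => //; exact: emeasurable_funD.
  - by move=> x _; rewrite lee_wpmul2l.
under eq_integral do rewrite ge0_muleDr//.
rewrite (ge0_integralD _ measurableT); last 4 first.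
- by move=> x _; rewrite mule_ge0.
- exact: emeasurable_funM.
- by move=> x _; rewrite mule_ge0.
- exact: emeasurable_funM.
apply: leeD2l.
have -> : \int[m]_x (e x * \int[m]_w (e w * (a (x, w) * B w))) =
    \int[m]_x \int[m]_w (e x * (e w * (a (x, w) * B w))).
  apply: eq_integral => x _; rewrite ge0_integralZl//.
  - exact: msect1 mC.
  - by move=> w _; rewrite !mule_ge0.
rewrite (@fubini_tonelli _ _ T T R m m (fun p => e p.1 * (e p.2 * (a p * B p.2)))); last 2 first.
- by apply: emeasurable_funM => //; exact: measurableT_comp.
- by move=> p; rewrite !mule_ge0.
apply: ge0_le_integral => //.
- by move=> w _; apply: integral_ge0 => x _; rewrite !mule_ge0.
- apply: (@measurable_fun_fubini_tonelli_G _ _ T T R m (fun p => e p.1 * (e p.2 * (a p * B p.2)))).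
    by apply: emeasurable_funM => //; exact: measurableT_comp.
  by move=> p; rewrite !mule_ge0.
- exact: emeasurable_funM.
- move=> w _.
  have -> : \int[m]_x (e x * (e w * (a (x, w) * B w))) = \int[m]_x ((e w * B w) * (e x * a (x, w))).
    by apply: eq_integral => x _; rewrite [in LHS]muleCA (muleC (a _)) !muleA (muleAC (e w)).
  rewrite ge0_integralZl//.
  + rewrite -/(B w) -[leRHS]mule1 lee_wpmul2l ?mule_ge0//.
    apply: le_trans (a1 w); apply: ge0_le_integral => //.
    * by move=> x _; rewrite mule_ge0.
    * by apply: emeasurable_funM => //; exact: msect2.
    * exact: msect2.
    * by move=> x _; rewrite -[leRHS]mul1e; exact: lee_wpmul2r.
  + by apply: emeasurable_funM => //; exact: msect2.
  + by move=> x _; rewrite mule_ge0.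
  + by rewrite mule_ge0.
Qed.

End crossing.

Section lebesgue_pairs.
Context {R : realType} {n : nat}.
Local Notation leb := (@lebesgue R n).
Local Notation pair_type := (Rn R n * Rn R n)%type.

(** A name for the product measure, to which the structure of sigma-finite measure is attached. *)
Definition lebesgue_pairs : set pair_type -> \bar R := (leb \x leb)%E.

HB.instance Definition _ := Measure.on lebesgue_pairs.

Let lebesgue_pairs_sigma_finite : sigma_finite setT lebesgue_pairs.
Proof.
have /sigma_finiteP[F [TF ndF Foo]] := sigma_finiteT leb.
exists (fun k => F k `*` F k).
  apply/esym; rewrite -subTset => -[x y] _.
  have [i _ Fi] : (\bigcup_i F i) x by rewrite -TF.
  have [j _ Gj] : (\bigcup_i F i) y by rewrite -TF.
  exists (maxn i j) => //; split => /=.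
  - by move: Fi; exact/subsetPset/ndF/leq_maxl.
  - by move: Gj; exact/subsetPset/ndF/leq_maxr.
move=> k; have [mF Fk] := Foo k; split; first exact: measurableX.
by rewrite /lebesgue_pairs product_measure1E// lte_mul_pinfty// ge0_fin_numE.
Qed.

HB.instance Definition _ := Measure_isSigmaFinite.Build _ _ _ lebesgue_pairs
  lebesgue_pairs_sigma_finite.
End lebesgue_pairs.

Section gaussian_content.
Context {R : realType} {n : nat}.
Local Notation leb := (@lebesgue R n).
Local Notation pair_type := (Rn R n * Rn R n)%type.
Local Notation pairs := (leb \x leb)%E.
Variable E : set (Rn R n).
Hypothesis mE : measurable E.

Lemma measurable_gaussq_sqdist (d : R) :
  measurable_fun setT (fun p : pair_type => (gaussq n d (sqdist p))%:E).
Proof.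
have m1 : measurable_fun setT (fun q : R => gaussq n d q).
  apply: (measurableT_comp (@measurable_gaussq R n) (g := fun q : R => (d, q))).
  by apply/measurable_fun_pair; [exact: measurable_cst|exact: measurable_id].
by apply/measurable_EFinP; exact: (measurableT_comp m1 measurable_sqdist).
Qed.

Definition gaussian_content (d : R) : \bar R :=
  (\int[pairs]_(p in off_diagonal E) (gaussq n d (sqdist p))%:E)%E.

Lemma gaussian_contentE d : gaussian_content d =
  (\int[leb]_x ((\1_E x : R)%:E * \int[leb]_y ((\1_(~` E) y : R)%:E * (gaussq n d (sqdist (x, y)))%:E)))%E.
Proof.
rewrite /gaussian_content (ge0_integral_setX _ _ mE (measurableC mE) (measurable_gaussq_sqdist d)); last first.
  by move=> p; rewrite lee_fin gaussq_ge0.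
by rewrite integral_indicator; apply: eq_integral => x _; rewrite integral_indicator.
Qed.

Lemma gaussian_content_subadditive (sigma tau : R) : 0 < sigma -> 0 < tau ->
  (gaussian_content (sigma + tau) <= gaussian_content sigma + gaussian_content tau)%E.
Proof.
move=> s0 t0; rewrite !gaussian_contentE.
pose a (d : R) (p : pair_type) := (gaussq n d (sqdist p))%:E.
have a0 d p : (0 <= a d p)%E by rewrite lee_fin gaussq_ge0.
have conv (x y : Rn R n) : (\int[leb]_w (a sigma (x, w) * a tau (w, y)) = a (sigma + tau)%R (x, y))%E.
  rewrite -[RHS](gaussk_conv x y s0 t0).
  by apply: eq_integral => w _; rewrite -EFinM.
have mI (F : set (Rn R n)) : measurable F -> measurable_fun setT (fun x => (\1_F x : R)%:E).
  by move=> mF; apply/measurable_EFinP; exact: measurable_indic.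
have := @crossing_le _ (Rn R n) R leb (a sigma) (a tau)
   (fun x => (\1_E x : R)%:E) (fun x => (\1_(~` E) x : R)%:E)
   (measurable_gaussq_sqdist sigma) (measurable_gaussq_sqdist tau) (a0 sigma) (a0 tau)
   (mI E mE) (mI _ (measurableC mE)).
move=> H; apply: le_trans (H _ _ _ _ _).
- rewrite le_eqVlt; apply/orP; left; apply/eqP.
  by apply: eq_integral => x _; congr (_ * _)%E; apply: eq_integral => y _; rewrite conv.
- by move=> x; rewrite lee_fin.
- by move=> x; rewrite lee_fin.
- move=> x; rewrite -EFinD !indicE; congr EFin.
  by rewrite in_setC; case: (x \in E); rewrite /= ?addr0 ?add0r.
- move=> w; rewrite le_eqVlt; apply/orP; left; apply/eqP.
  exact: (integral_gaussk w s0).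
- move=> w; rewrite le_eqVlt; apply/orP; left; apply/eqP.
  rewrite -[RHS](integral_gaussk w t0); apply: eq_integral => y _.
  by rewrite /a sqdist_swap.
Qed.

Lemma measurable_gaussian_content : measurable_fun setT gaussian_content.
Proof.
have mh : measurable_fun setT (fun r : pair_type * R => (gaussq n r.2 (sqdist r.1))%:E).
  apply/measurable_EFinP.
  apply: (measurableT_comp (@measurable_gaussq R n) (g := fun r : pair_type * R => (r.2, sqdist r.1))).
  apply/measurable_fun_pair; first exact: measurable_snd.
  exact: (measurableT_comp measurable_sqdist measurable_fst).
have h0 (r : pair_type * R) : (0 <= (gaussq n r.2 (sqdist r.1))%:E)%E by rewrite lee_fin gaussq_ge0.
exact: (@measurable_domain_integral R _ pair_type (@lebesgue_pairs R n) _ (measurable_off_diagonal mE) _ R _ mh h0).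
Qed.

End gaussian_content.

(** * The symbol of the fractional heat kernel *)

Section stable_admissible.
Context {R : realType} {n : nat}.
Local Notation leb := (@lebesgue R n).
Local Notation pair_type := (Rn R n * Rn R n)%type.
Local Notation pairs := (@lebesgue_pairs R n).
Variable s : R.
Hypotheses (s0 : 0 < s) (s2 : s <= 2^-1).

Lemma gaussian_transform_ge0 (d : R) (p : pair_type) : 0 < d ->
  0 <= transform leb (@phase R n) (damp (@sqnorm R n) d (@one R _ _)) p.
Proof.
move=> d0; rewrite (gaussian_transform p d0) mulr_ge0 ?gaussq_ge0//.
by rewrite exprn_ge0// mulr_ge0// pi_ge0.
Qed.

(** [admissible_expRN] for the windows starting at [M]. The part of the time axis up to [M] is missing
    from the mixtures, and reappears in the exponent with a minus sign. *)
Lemma admissible_stable (D : set pair_type) (g : R -> R) (kappa G t : R) (M : nat) :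
  measurable D -> (forall d, 0 <= g d) ->
  measurable_fun [set: measurableTypeR R] g ->
  (forall d tau : R, 0 < d -> 0 < tau -> g (d + tau) <= g d + g tau) ->
  (forall d : R, 0 < d -> (\int[pairs]_(p in D)
     (transform leb (@phase R n) (damp (@sqnorm R n) d (@one R _ _)) p)%:E <= (g d)%:E)%E) ->
  (forall N, (\int[lebesgue_measure]_y (window M N y * g (stable_time s y))%:E <= G%:E)%E) ->
  (\int[lebesgue_measure]_x (\1_(@positives R) x * (1 - expR (- stable_time s x)))%:E)%E = kappa%:E ->
  0 <= t ->
  admissible pairs D leb (@sqnorm R n) (@phase R n) g
    (fun xi => expR (- (t * (kappa * sqnorm xi `^ s + laplace s (window 0 M) (sqnorm xi))))) 1 (t * G).
Proof.
move=> mD g0 mg gD gle gG Hk t0.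
apply: (@admissible_expRN R _ pair_type pairs D mD _ (Rn R n) leb (@sqnorm R n) (@phase R n)
  (@measurable_sqnorm R n) (@sqnorm_ge0 R n) (@integrable_expR_sqnorm R n)
  (@measurable_phase R n) (@phase_le1 R n) g g0 _ (measurableTypeR R) lebesgue_measure (stable_time s)
  (measurable_stable_time s) (stable_time_gt0 s) mg gD gaussian_transform_ge0 gle
  (fun N => window M N) (fun N => N%:R) (fun N => (M + N)%:R)).
- by move=> N; exact: measurable_window.
- by move=> N y; exact: window_ge0.
- by move=> N; exact: integral_window.
- exact: gG.
- by move=> N; rewrite ler_nat leq_addl.
- by move=> xi; have := @cvg_laplace_window R s s0 kappa Hk M (sqnorm xi) (sqnorm_ge0 xi); apply.
- exact: t0.
Qed.

Lemma laplace_window0 (l : R) : laplace s (window 0 0) l = 0.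
Proof.
rewrite /laplace /Rintegral (eq_integral (fun=> 0%E)) ?integral0//.
move=> x _; rewrite windowE addn0; by case: ltP => //; rewrite mul0r.
Qed.

Lemma admissible_heat_symbol (D : set pair_type) (g : R -> R) (kappa G t : R) :
  measurable D -> (forall d, 0 <= g d) ->
  measurable_fun [set: measurableTypeR R] g ->
  (forall d tau : R, 0 < d -> 0 < tau -> g (d + tau) <= g d + g tau) ->
  (forall d : R, 0 < d -> (\int[pairs]_(p in D)
     (transform leb (@phase R n) (damp (@sqnorm R n) d (@one R _ _)) p)%:E <= (g d)%:E)%E) ->
  (forall N, (\int[lebesgue_measure]_y (window 0 N y * g (stable_time s y))%:E <= G%:E)%E) ->
  (\int[lebesgue_measure]_x (\1_(@positives R) x * (1 - expR (- stable_time s x)))%:E)%E = kappa%:E ->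
  0 < kappa -> 0 <= t ->
  admissible pairs D leb (@sqnorm R n) (@phase R n) g
    (fun xi => expR (- (t * sqnorm xi `^ s))) 1 (t / kappa * G).
Proof.
move=> mD g0 mg gD gle gG Hk k0 t0.
have := @admissible_stable D g kappa G (t / kappa) 0 mD g0 mg gD gle gG Hk (divr_ge0 t0 (ltW k0)).
rewrite (_ : (fun xi => _) = (fun xi => expR (- (t * sqnorm xi `^ s))))//.
apply/funext => xi; rewrite laplace_window0 addr0 mulrA divfK// gt_eqF//.
Qed.

(** With an empty domain, only the positivity of the transforms is left. *)
Lemma admissible_set0 (kappa t : R) (M : nat) :
  (\int[lebesgue_measure]_x (\1_(@positives R) x * (1 - expR (- stable_time s x)))%:E)%E = kappa%:E ->
  0 <= t ->
  admissible pairs set0 leb (@sqnorm R n) (@phase R n) (fun=> 0)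
    (fun xi => expR (- (t * (kappa * sqnorm xi `^ s + laplace s (window 0 M) (sqnorm xi))))) 1 0.
Proof.
move=> Hk t0; rewrite -[X in admissible _ _ _ _ _ _ _ _ X](mulr0 t).
apply: admissible_stable => //; last 2 first.
- by move=> d _; rewrite integral_set0.
- by move=> N; rewrite (eq_integral (fun=> 0%E)) ?integral0// => y _; rewrite mulr0.
Qed.

Lemma integrable_heat_symbol (t : R) : (0 < n)%N -> 0 < t ->
  leb.-integrable setT (fun xi => (expR (- (t * sqnorm xi `^ s)))%:E).
Proof. by move=> n0 t0; exact: integrable_stable_symbol. Qed.

Lemma heat_ge0 (t : R) (p : pair_type) : (0 < n)%N -> 0 < t -> 0 <= heat s t p.
Proof.
move=> n0 t0; have [kappa [k0 Hk]] := exists_bernstein_constant s0 s2.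
apply: (@admissible_transform_ge0 R _ pair_type pairs set0 _ (Rn R n) leb (@sqnorm R n) (@phase R n)
  (@measurable_sqnorm R n) (@sqnorm_ge0 R n) (@measurable_phase R n) (@phase_le1 R n)
  (fun=> 0) _ 1 0 p _ (integrable_heat_symbol n0 t0)).
rewrite -[X in admissible _ _ _ _ _ _ _ _ X](mulr0 (t / kappa)).
apply: admissible_heat_symbol => //.
- by move=> d _; rewrite integral_set0.
- by move=> N; rewrite (eq_integral (fun=> 0%E)) ?integral0// => y _; rewrite mulr0.
- exact: ltW.
Qed.
End stable_admissible.

(** * A finite perimeter bounds the heat content *)

Section gaussian_content_perimeter.
Context {R : realType} {n : nat}.
Local Notation leb := (@lebesgue R n).
Local Notation pair_type := (Rn R n * Rn R n)%type.
Local Notation pairs := (@lebesgue_pairs R n).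
Variable s : R.
Hypotheses (s0 : 0 < s).
Variable E : set (Rn R n).
Hypothesis mE : measurable E.

Let mD : measurable (off_diagonal E) := measurable_off_diagonal mE.

Let mj : measurable_fun (off_diagonal E) (fun p => (jump s p)%:E).
Proof. by apply: measurable_funTS; apply/measurable_EFinP; exact: measurable_jump. Qed.

Lemma gaussian_content_le_power : exists C : R, 0 <= C /\ forall d : R, 0 < d ->
  (gaussian_content E d <= (C * d `^ s)%:E * fractional_perimeter s E)%E.
Proof.
have [C [C0 HC]] := gaussq_le_power s0 n; exists C; split => // d d0.
rewrite (fractional_perimeterE _ mE).
have Cd0 : 0 <= C * d `^ s by rewrite mulr_ge0// powR_ge0.
rewrite -(ge0_integralZl _ mD); last 3 first.
- exact: mj.
- by move=> p _; rewrite lee_fin jump_ge0.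
- by rewrite lee_fin.
apply: (ge0_le_integral _ mD).
- by move=> p _; rewrite lee_fin gaussq_ge0.
- by apply: measurable_funTS; exact: measurable_gaussq_sqdist.
- by apply: measurable_funeM; exact: mj.
- by move=> p Dp; rewrite -EFinM lee_fin; exact: (HC d _ d0 (off_diagonal_sqdist Dp)).
Qed.

Lemma integral_gaussian_content (CJ : R) : 0 < CJ ->
  (forall q : R, 0 < q -> (\int[lebesgue_measure]_x
     (\1_(@positives R) x * gaussq n (stable_time s x) q)%:E)%E =
     (CJ / (Num.sqrt q ^+ n * q `^ s))%:E) ->
  (\int[lebesgue_measure]_y ((\1_(@positives R) y)%:E * gaussian_content E (stable_time s y))
   = CJ%:E * fractional_perimeter s E)%E.
Proof.
move=> CJ0 HJ; rewrite (fractional_perimeterE _ mE).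
rewrite -(ge0_integralZl _ mD); last 3 first.
- exact: mj.
- by move=> p _; rewrite lee_fin jump_ge0.
- by rewrite lee_fin ltW.
pose h (r : pair_type * measurableTypeR R) : \bar R :=
  (\1_(@positives R) r.2 * gaussq n (stable_time s r.2) (sqdist r.1))%:E.
have mh : measurable_fun setT h.
  apply/measurable_EFinP; apply: measurable_funM.
    exact: (measurableT_comp (@measurable_positives R) measurable_snd).
  apply: (measurableT_comp (@measurable_gaussq R n)
    (g := fun r : pair_type * measurableTypeR R => (stable_time s r.2, sqdist r.1))).
  apply/measurable_fun_pair.
    exact: (measurableT_comp (measurable_stable_time s) measurable_snd).
  exact: (measurableT_comp measurable_sqdist measurable_fst).
have h0 r : (0 <= h r)%E by rewrite lee_fin mulr_ge0// gaussq_ge0.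
have := @tonelli_domain R _ pair_type pairs _ mD _ (measurableTypeR R) lebesgue_measure h mh h0.
move=> T.
transitivity (\int[lebesgue_measure]_y \int[pairs]_(p in off_diagonal E) h (p, y))%E.
  apply: eq_integral => y _.
  rewrite -(ge0_integralZl _ mD).
  - by apply: eq_integral => p _; rewrite -EFinM.
  - by apply: measurable_funTS; exact: measurable_gaussq_sqdist.
  - by move=> p _; rewrite lee_fin gaussq_ge0.
  - by rewrite lee_fin.
rewrite -T; apply: eq_integral => p /set_mem Dp.
exact: (HJ _ (off_diagonal_sqdist Dp)).
Qed.

End gaussian_content_perimeter.

Section perimeter_to_heat.
Context {R : realType} {n : nat}.
Local Notation leb := (@lebesgue R n).
Local Notation pair_type := (Rn R n * Rn R n)%type.
Local Notation pairs := (@lebesgue_pairs R n).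
Variable s : R.
Hypotheses (n0 : (0 < n)%N) (s0 : 0 < s) (s2 : s <= 2^-1).
Variable E : set (Rn R n).
Hypothesis mE : measurable E.

Let mD : measurable (off_diagonal E) := measurable_off_diagonal mE.
Local Notation c := ((2 * pi : R) ^+ n).

Let c0 : 0 < c. Proof. by rewrite exprn_gt0// mulr_gt0// pi_gt0. Qed.

Lemma cvg_harmonic_powR : (@harmonic R k) `^ s @[k --> \oo] --> (0 : R).
Proof.
have /cvg_at_rightP := @powR_cvg0 R s s0; apply; split; last exact: cvg_harmonic.
by move=> k; exact: harmonic_gt0.
Qed.

Lemma gaussian_content_ge0 d : (0 <= gaussian_content E d)%E.
Proof. by apply: integral_ge0 => p _; rewrite lee_fin gaussq_ge0. Qed.

(** The bound [g] is the Gaussian content itself, finite and of order [d `^ s] by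
    [gaussian_content_le_power]; its integral along the stable times is a multiple of the perimeter
    by [integral_gaussian_content]. *)
Lemma heat_content_le_perimeter : (fractional_perimeter s E < +oo)%E ->
  exists K : R, forall t, 0 < t -> (heat_content s t E <= (t * K)%:E)%E.
Proof.
move=> Poo.
have P0 : (0 <= fractional_perimeter s E)%E.
  rewrite (fractional_perimeterE _ mE).
  by apply: integral_ge0 => p _; rewrite lee_fin jump_ge0.
have [p0 [p00 Pp]] : exists p0 : R, 0 <= p0 /\ fractional_perimeter s E = p0%:E.
  have Pf : fractional_perimeter s E \is a fin_num by rewrite ge0_fin_numE.
  by exists (fine (fractional_perimeter s E)); rewrite fine_ge0// fineK.
have [C [C0 HC]] := gaussian_content_le_power s0 mE.
have [CJ [CJ0 HJ]] := exists_jump_constant s0 n.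
have [kappa [k0 Hk]] := exists_bernstein_constant s0 s2.
have Gf d : 0 < d -> gaussian_content E d \is a fin_num.
  move=> d0; rewrite ge0_fin_numE ?gaussian_content_ge0//.
  by apply: le_lt_trans (HC _ d0) _; rewrite Pp -EFinM ltry.
pose g (d : R) : R := c * fine (gaussian_content E d).
have g0 (d : R) : 0 <= g d by rewrite mulr_ge0 ?(ltW c0)// fine_ge0// gaussian_content_ge0.
have mg : measurable_fun [set: measurableTypeR R] g.
  apply: measurable_funM; first exact: measurable_cst.
  apply: (measurableT_comp _ (measurable_gaussian_content mE)).
  exact: fine_measurable.
have gE d : 0 < d -> (g d)%:E = (c%:E * gaussian_content E d)%E.
  by move=> d0; rewrite EFinM fineK// Gf.
have gD d tau : 0 < d -> 0 < tau -> g (d + tau) <= g d + g tau.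
  move=> d0 tau0; rewrite -lee_fin EFinD !gE ?addr_gt0// -ge0_muleDr ?gaussian_content_ge0//.
  rewrite lee_wpmul2l ?lee_fin ?(ltW c0)//.
  exact: gaussian_content_subadditive.
have gle d : 0 < d -> (\int[pairs]_(p in off_diagonal E)
     (transform leb (@phase R n) (damp (@sqnorm R n) d (@one R _ _)) p)%:E <= (g d)%:E)%E.
  move=> d0; rewrite (gE _ d0) le_eqVlt; apply/orP; left; apply/eqP.
  rewrite -(ge0_integralZl _ mD).
  - by apply: eq_integral => p _; rewrite (gaussian_transform p d0) EFinM.
  - by apply: measurable_funTS; exact: measurable_gaussq_sqdist.
  - by move=> p _; rewrite lee_fin gaussq_ge0.
  - by rewrite lee_fin ltW.
pose G := c * (CJ * p0).
have gG N : (\int[lebesgue_measure]_y (window 0 N y * g (stable_time s y))%:E <= G%:E)%E.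
  rewrite /G !EFinM -Pp -(integral_gaussian_content mE CJ0 HJ).
  have mh : measurable_fun [set: measurableTypeR R]
      (fun y => ((\1_(@positives R) y)%:E * gaussian_content E (stable_time s y))%E).
    apply: emeasurable_funM.
      by apply/measurable_EFinP; exact: measurable_positives.
    exact: (measurableT_comp (measurable_gaussian_content mE) (measurable_stable_time s)).
  rewrite -ge0_integralZl//; last 2 first.
  - by move=> y _; rewrite mule_ge0 ?gaussian_content_ge0// lee_fin.
  - by rewrite lee_fin ltW.
  apply: (ge0_le_integral _ measurableT).
  - by move=> y _; rewrite lee_fin mulr_ge0// window_ge0.
  - apply/measurable_EFinP; apply: measurable_funM; first exact: measurable_window.
    exact: (measurableT_comp mg (measurable_stable_time s)).
  - by apply: emeasurable_funM; [exact: measurable_cst|exact: mh].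
  - move=> y _; rewrite EFinM gE ?stable_time_gt0// muleCA.
    rewrite lee_wpmul2l ?lee_fin ?(ltW c0)//.
    rewrite lee_wpmul2r ?gaussian_content_ge0// lee_fin windowE positivesE.
    by case: (0 < y); rewrite //= ler_nat leq_b1.
have gh : g (harmonic k) @[k --> \oo] --> (0 : R).
  apply: (@squeeze_cvgr _ _ _ _ (fun=> 0) (fun k => c * (C * p0) * harmonic k `^ s)).
  - near=> k; rewrite g0/= -lee_fin gE ?harmonic_gt0//.
    rewrite -(mulrA c) EFinM lee_wpmul2l ?lee_fin ?(ltW c0)//.
    rewrite (mulrAC C) EFinM -Pp; exact: (HC _ (harmonic_gt0 k)).
  - exact: cvg_cst.
  - rewrite -[X in _ --> X](mulr0 (c * (C * p0))).
    by apply: cvgM; [exact: cvg_cst|exact: cvg_harmonic_powR].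
exists (kappa^-1 * G * c^-1) => t t0.
have := @admissible_transform_le R _ pair_type pairs (off_diagonal E) mD _ (Rn R n) leb
  (@sqnorm R n) (@phase R n) (@measurable_sqnorm R n) (@sqnorm_ge0 R n) (@measurable_phase R n)
  (@phase_le1 R n) g _ _ _ (admissible_heat_symbol s0 mD g0 mg gD gle gG Hk k0 (ltW t0))
  (integrable_heat_symbol s0 n0 t0) gh.
move=> H.
rewrite (heat_contentE mE); last by move=> p; exact: heat_ge0.
apply: (@le_trans _ _ ((c^-1)%:E * (t / kappa * G)%:E)%E).
  by rewrite lee_wpmul2l// lee_fin invr_ge0 ltW.
by rewrite -EFinM lee_fin le_eqVlt; apply/orP; left; apply/eqP; ring.
Unshelve. all: by end_near. Qed.
End perimeter_to_heat.

(** * Small-time bounds on the heat content bound the perimeter *)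

Section heat_to_perimeter.
Context {R : realType} {n : nat}.
Local Notation leb := (@lebesgue R n).
Local Notation pair_type := (Rn R n * Rn R n)%type.
Local Notation pairs := (@lebesgue_pairs R n).
Local Notation fourier := (transform leb (@phase R n)).
Local Notation c := ((2 * pi : R) ^+ n).
Variables (s kappa : R).
Hypotheses (n0 : (0 < n)%N) (s0 : 0 < s) (s2 : s <= 2^-1).
Hypothesis kappa0 : 0 < kappa.
Hypothesis kappaE : (\int[lebesgue_measure]_x
  (\1_(@positives R) x * (1 - expR (- stable_time s x)))%:E)%E = kappa%:E.

Let c0 : 0 < c. Proof. by rewrite exprn_gt0// mulr_gt0// pi_gt0. Qed.

(** Its transform increases with [N] to a multiple of the kernel of the perimeter. *)
Definition jump_symbol (N : nat) : Rn R n -> R :=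
  mixture (@sqnorm R n) (@lebesgue_measure R) (stable_time s) (window 0 N).

Definition damped_jump_symbol (N : nat) (tau : R) (xi : Rn R n) : R :=
  jump_symbol N xi * expR (- (tau * (kappa * sqnorm xi `^ s + jump_symbol N xi))).

Let measurable_jump_symbol N : measurable_fun setT (jump_symbol N).
Proof.
exact: (@measurable_mixture R _ _ _ (@measurable_sqnorm R n) _ (measurableTypeR R) lebesgue_measure
  (stable_time s) (measurable_stable_time s) (window 0 N) (@measurable_window R 0 N) (@window_ge0 R 0 N)).
Qed.

Lemma jump_symbol_ge0 N xi : 0 <= jump_symbol N xi.
Proof.
exact: (@mixture_ge0 R _ _ (@sqnorm R n) _ (measurableTypeR R) lebesgue_measure (stable_time s)
  (window 0 N) (@window_ge0 R 0 N)).
Qed.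

Let window_stable_time N (y : measurableTypeR R) : window 0 N y != 0 -> stable_time s N%:R <= stable_time s y.
Proof.
rewrite windowE; have [y0|] := boolP ((0 < y) && (y <= (0 + N)%:R)); last by rewrite eqxx.
by move=> _; have /andP[y1 y2] := y0; apply: stable_time_le.
Qed.

Lemma integrable_jump_symbol N : leb.-integrable setT (fun xi => (jump_symbol N xi)%:E).
Proof.
exact: (@integrable_mixture R _ _ leb (@sqnorm R n) (@measurable_sqnorm R n) (@sqnorm_ge0 R n)
  (@integrable_expR_sqnorm R n) _ (measurableTypeR R) lebesgue_measure (stable_time s)
  (measurable_stable_time s) (stable_time_gt0 s) (window 0 N) _ _ (@measurable_window R 0 N)
  (@window_ge0 R 0 N) (@integral_window R 0 N) (stable_time_gt0 s N%:R) (@window_stable_time N)).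
Qed.

Let measurable_damped N tau : measurable_fun setT (damped_jump_symbol N tau).
Proof.
apply: measurable_funM; first exact: measurable_jump_symbol.
apply: (measurableT_comp (@measurable_expR R)); apply: measurable_funN.
apply: measurable_funM; first exact: measurable_cst.
apply: measurable_funD; last exact: measurable_jump_symbol.
apply: measurable_funM; first exact: measurable_cst.
exact: (measurableT_comp (@measurable_powR R s) (@measurable_sqnorm R n)).
Qed.

Let damped_le N tau xi : 0 <= tau -> `|damped_jump_symbol N tau xi| <= jump_symbol N xi.
Proof.
move=> tau0; rewrite ger0_norm ?mulr_ge0 ?expR_ge0 ?jump_symbol_ge0//.
rewrite -[leRHS]mulr1 ler_wpM2l ?jump_symbol_ge0// -expR0 ler_expR oppr_le0.
by rewrite mulr_ge0// addr_ge0 ?jump_symbol_ge0// mulr_ge0 ?powR_ge0// ltW.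
Qed.

Let integrable_damped N tau : 0 <= tau ->
  leb.-integrable setT (fun xi => (damped_jump_symbol N tau xi)%:E).
Proof.
move=> tau0; apply: (@le_integrable _ _ _ leb setT measurableT _ _ _ _ (integrable_jump_symbol N)).
  by apply/measurable_EFinP; exact: measurable_damped.
move=> xi _; rewrite /= lee_fin (le_trans (damped_le N xi tau0))// ler_norm//.
Qed.

Let window_mul0 N : (\int[lebesgue_measure]_y (window 0 N y * (fun=> 0) (stable_time s y))%:E <= (0 : R)%:E)%E.
Proof. by rewrite (eq_integral (fun=> 0%E)) ?integral0// => y _; rewrite mulr0. Qed.

Let mzero : measurable_fun [set: measurableTypeR R] (fun=> 0 : R).
Proof. exact: measurable_cst. Qed.

Let zeroD (d tau : R) : 0 < d -> 0 < tau -> (fun=> 0 : R) (d + tau) <= (fun=> 0) d + (fun=> 0) tau.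
Proof. by rewrite addr0. Qed.

(** The damped symbol is the product of a mixture with an admissible symbol for the empty
    domain. *)
Lemma damped_transform_ge0 N tau p : 0 <= tau -> 0 <= fourier (damped_jump_symbol N tau) p.
Proof.
move=> tau0.
have A0 := @admissible_set0 R n s s0 kappa _ N kappaE tau0.
have B := @admissible_mixture R _ pair_type pairs set0 measurable0 _ (Rn R n) leb (@sqnorm R n) (@phase R n)
  (@measurable_sqnorm R n) (@sqnorm_ge0 R n) (@integrable_expR_sqnorm R n) (@measurable_phase R n)
  (@phase_le1 R n) (fun=> 0) (fun=> lexx 0) _ (measurableTypeR R) lebesgue_measure (stable_time s)
  (measurable_stable_time s) (stable_time_gt0 s) mzero zeroD _ _ _ _ _ _ (@measurable_window R 0 N)
  (@window_ge0 R 0 N) (@integral_window R 0 N) (window_mul0 N) ler01 (lexx 0) A0.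
apply: (@admissible_transform_ge0 R _ pair_type pairs set0 _ (Rn R n) leb (@sqnorm R n) (@phase R n)
  (@measurable_sqnorm R n) (@sqnorm_ge0 R n) (@measurable_phase R n) (@phase_le1 R n)
  (fun=> 0) _ _ _ p B (integrable_damped N tau0)).
Qed.

(** With [u = tau * jump_symbol N], the factor [expR u - u] is admissible by
    [admissible_expR_sub], and multiplied by [expR (- u) * expR (- (tau * kappa * q `^ s))] it
    gives the symbol of the heat kernel at time [tau * kappa] minus [tau] times the damped
    symbol. *)
Lemma damped_transform_le_heat N tau p : 0 < tau ->
  tau * fourier (damped_jump_symbol N tau) p <= heat s (tau * kappa) p.
Proof.
move=> tau0.
have A0 := @admissible_set0 R n s s0 kappa _ N kappaE (ltW tau0).
have B := @admissible_expR_sub R _ pair_type pairs set0 measurable0 _ (Rn R n) leb (@sqnorm R n) (@phase R n)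
  (@measurable_sqnorm R n) (@sqnorm_ge0 R n) (@integrable_expR_sqnorm R n) (@measurable_phase R n)
  (@phase_le1 R n) (fun=> 0) (fun=> lexx 0) _ (measurableTypeR R) lebesgue_measure (stable_time s)
  (measurable_stable_time s) (stable_time_gt0 s) mzero zeroD _ _ _ _ (@measurable_window R 0 N)
  (@window_ge0 R 0 N) (@integral_window R 0 N) (window_mul0 N) (ltW tau0) _ _ _ ler01 (lexx 0) A0.
have i1 := @integrable_heat_symbol R n s s0 (tau * kappa) n0 (mulr_gt0 tau0 kappa0).
have i2 := integrableZl measurableT (- tau) (integrable_damped N (ltW tau0)).
have E : (fun xi => (expR (tau * mixture (@sqnorm R n) lebesgue_measure (stable_time s) (window 0 N) xi)
      - tau * mixture (@sqnorm R n) lebesgue_measure (stable_time s) (window 0 N) xi) *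
    expR (- (tau * (kappa * sqnorm xi `^ s + laplace s (window 0 N) (sqnorm xi))))) =
   (fun xi => expR (- (tau * kappa * sqnorm xi `^ s)) + (- tau) * damped_jump_symbol N tau xi).
  apply/funext => xi; rewrite mulrBl -expRD; congr (_ + _).
    by congr expR; rewrite /mixture /laplace; ring.
  by rewrite mulNr mulrA.
rewrite E in B.
have := @admissible_transform_ge0 R _ pair_type pairs set0 _ (Rn R n) leb (@sqnorm R n) (@phase R n)
  (@measurable_sqnorm R n) (@sqnorm_ge0 R n) (@measurable_phase R n) (@phase_le1 R n)
  (fun=> 0) _ _ _ p B.
rewrite (transformD (@measurable_phase R n) (@phase_le1 R n) p i1 i2).
rewrite (transformZ (@measurable_phase R n) (@phase_le1 R n) (- tau) p (integrable_damped N (ltW tau0))).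
rewrite mulNr subr_ge0; apply.
exact: (integrableD measurableT i1 i2).
Qed.


Lemma cvg_damped_transform N (u : nat -> R) (p : pair_type) : (forall k, 0 <= u k) ->
  u k @[k --> \oo] --> 0 ->
  fourier (damped_jump_symbol N (u k)) p @[k --> \oo] --> fourier (jump_symbol N) p.
Proof.
move=> u0 u_0.
apply: (@cvg_transform R _ _ _ _ leb (@phase R n) (@measurable_phase R n) (@phase_le1 R n)
  (fun k => damped_jump_symbol N (u k)) (jump_symbol N) (jump_symbol N) p
  (fun k => measurable_damped N (u k)) _ (integrable_jump_symbol N)); last by move=> k xi; exact: damped_le.
move=> xi; rewrite -[X in _ --> X]mulr1 -expR0.
apply: cvgM; first exact: cvg_cst.
apply: continuous_cvg; first exact: continuous_expR.
rewrite -oppr0; apply: cvgN; rewrite -[X in _ --> X](mul0r (kappa * sqnorm xi `^ s + jump_symbol N xi)).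
by apply: cvgM => //; exact: cvg_cst.
Qed.

Section content_bound.
Variables (E : set (Rn R n)) (eta K : R).
Hypotheses (mE : measurable E) (eta0 : 0 < eta).
Hypothesis content_le : forall t, 0 < t < eta -> (heat_content s t E <= (t * K)%:E)%E.

Let mD : measurable (off_diagonal E) := measurable_off_diagonal mE.

(** The damped transforms converge to the left-hand integrand as the time goes to 0, and are bounded by
    the heat kernel divided by the time; the bound on the heat contents is linear in time, and Fatou's
    lemma concludes. *)
Lemma integral_jump_symbol_le N :
  (\int[pairs]_(p in off_diagonal E) (fourier (jump_symbol N) p)%:E <= (c * kappa * K)%:E)%E.
Proof.
(* times [u k * kappa] tending to 0 and below [eta] *)
pose u k : R := eta / (2 * kappa) * harmonic k.
have u0 k : 0 < u k by rewrite mulr_gt0 ?harmonic_gt0// divr_gt0// mulr_gt0.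
have u_0 : u k @[k --> \oo] --> 0.
  rewrite -[X in _ --> X](mulr0 (eta / (2 * kappa))).
  by apply: cvgM; [exact: cvg_cst|exact: cvg_harmonic].
apply: (@integral_le_lim _ _ R pairs (off_diagonal E)
   (fun k p => (fourier (damped_jump_symbol N (u k)) p)%:E) _ (fun=> (c * kappa * K)%:E) _ mD).
- move=> k; apply: measurable_funTS; apply/measurable_EFinP.
  exact: (@measurable_transform R _ pair_type _ _ leb (@phase R n) (@measurable_phase R n) _ (measurable_damped N (u k))).
- by move=> k p _; rewrite lee_fin damped_transform_ge0// ltW.
- move=> p _; apply: cvg_EFin; first by near=> k.
  by apply: cvg_damped_transform => // k; exact: ltW.
- move=> k.
  have uk : 0 < u k * kappa < eta.
    rewrite mulr_gt0//= /u.
    have h1 : harmonic k <= 1 :> R by rewrite /harmonic/= invf_le1// ler1n.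
    have -> : eta / (2 * kappa) * harmonic k * kappa = eta * (harmonic k / 2).
      by field; rewrite gt_eqF.
    by rewrite gtr_pMr//; lra.
  have mh : measurable_fun (off_diagonal E) (fun p => (heat s (u k * kappa) p)%:E).
    by apply: measurable_funTS; apply/measurable_EFinP; exact: measurable_heat.
  have h0 (p : pair_type) : (0 <= (heat s (u k * kappa) p)%:E)%E.
    by rewrite lee_fin; apply: (heat_ge0 s0 s2) => //; exact: mulr_gt0.
  have := content_le uk; rewrite (heat_contentE mE); last first.
    by move=> p; rewrite -lee_fin.
  move=> H.
  apply: (@le_trans _ _ (\int[pairs]_(p in off_diagonal E) ((u k)^-1%:E * (heat s (u k * kappa) p)%:E))%E).
    apply: (ge0_le_integral _ mD).
    - by move=> p _; rewrite lee_fin damped_transform_ge0// ltW.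
    - apply: measurable_funTS; apply/measurable_EFinP.
      exact: (@measurable_transform R _ pair_type _ _ leb (@phase R n) (@measurable_phase R n) _ (measurable_damped N (u k))).
    - exact: measurable_funeM.
    - move=> p _; rewrite -EFinM lee_fin mulrC ler_pdivlMr// mulrC.
      exact: damped_transform_le_heat.
  rewrite (ge0_integralZl _ mD mh); last 2 first.
  - by move=> p _.
  - by rewrite lee_fin invr_ge0 ltW.
  have -> : (c * kappa * K)%:E = ((u k)^-1%:E * (c%:E * (u k * kappa * K)%:E))%E.
    by rewrite -!EFinM; congr EFin; field; rewrite gt_eqF.
  rewrite lee_wpmul2l ?lee_fin ?invr_ge0 ?(ltW (u0 k))//.
  rewrite -lee_pdivrMl//.
- exact: cvg_cst.
Unshelve. all: by end_near. Qed.

Lemma integral_window_content_le N :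
  (\int[lebesgue_measure]_y ((window 0 N y)%:E * gaussian_content E (stable_time s y))
     <= (kappa * K)%:E)%E.
Proof.
pose h (r : pair_type * measurableTypeR R) : \bar R :=
  (window 0 N r.2 * gaussq n (stable_time s r.2) (sqdist r.1))%:E.
have mh : measurable_fun setT h.
  apply/measurable_EFinP; apply: measurable_funM.
    exact: (measurableT_comp (@measurable_window R 0 N) measurable_snd).
  apply: (measurableT_comp (@measurable_gaussq R n)
    (g := fun r : pair_type * measurableTypeR R => (stable_time s r.2, sqdist r.1))).
  apply/measurable_fun_pair.
    exact: (measurableT_comp (measurable_stable_time s) measurable_snd).
  exact: (measurableT_comp measurable_sqdist measurable_fst).
have h0 r : (0 <= h r)%E by rewrite lee_fin mulr_ge0 ?window_ge0// gaussq_ge0.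
have T := @tonelli_domain R _ pair_type pairs _ mD _ (measurableTypeR R) lebesgue_measure h mh h0.
have -> : (\int[lebesgue_measure]_y ((window 0 N y)%:E * gaussian_content E (stable_time s y)) =
    \int[lebesgue_measure]_y \int[pairs]_(p in off_diagonal E) h (p, y))%E.
  apply: eq_integral => y _.
  rewrite -(ge0_integralZl _ mD).
  - by apply: eq_integral => p _; rewrite -EFinM.
  - by apply: measurable_funTS; exact: measurable_gaussq_sqdist.
  - by move=> p _; rewrite lee_fin gaussq_ge0.
  - by rewrite lee_fin window_ge0.
rewrite -T -(@lee_pmul2l _ c%:E)//.
rewrite -EFinM mulrA; apply: le_trans (integral_jump_symbol_le N).
have mI : measurable_fun setT (fun p => \int[lebesgue_measure]_y h (p, y))%E.
  exact: (@measurable_fun_fubini_tonelli_F _ _ pair_type (measurableTypeR R) R lebesgue_measure h mh h0).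
have I0 p : (0 <= \int[lebesgue_measure]_y h (p, y))%E by exact: integral_ge0.
rewrite -(ge0_integralZl _ mD).
- apply: (ge0_le_integral _ mD).
  + by move=> p _; rewrite mule_ge0 ?I0// lee_fin ltW.
  + by apply: measurable_funTS; exact: measurable_funeM.
  + apply: measurable_funTS; apply/measurable_EFinP.
    exact: (@measurable_transform R _ pair_type _ _ leb (@phase R n) (@measurable_phase R n) _
      (measurable_jump_symbol N)).
  + move=> p _.
    have := @transform_mixture_ge R _ pair_type _ (Rn R n) leb (@sqnorm R n) (@phase R n)
      (@measurable_sqnorm R n) (@sqnorm_ge0 R n) (@integrable_expR_sqnorm R n) (@measurable_phase R n)
      (@phase_le1 R n) _ (measurableTypeR R) lebesgue_measure (stable_time s) (measurable_stable_time s)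
      (stable_time_gt0 s) (@gaussian_transform_ge0 R n) (window 0 N) _ _ p (@measurable_window R 0 N)
      (@window_ge0 R 0 N) (@integral_window R 0 N) (stable_time_gt0 s N%:R) (@window_stable_time N).
    apply: le_trans.
    rewrite -ge0_integralZl//; last 2 first.
    * exact: (measurableT_comp mh (measurable_pair1 p)).
    * by rewrite lee_fin ltW.
    rewrite le_eqVlt; apply/orP; left; apply/eqP; apply: eq_integral => y _.
    by rewrite (gaussian_transform p (stable_time_gt0 s y)) -EFinM; congr EFin; ring.
- exact: measurable_funTS.
- by move=> p _; exact: I0.
- by rewrite lee_fin ltW.
Qed.

Lemma integral_positives_content_le :
  (\int[lebesgue_measure]_y ((\1_(@positives R) y)%:E * gaussian_content E (stable_time s y))
     <= (kappa * K)%:E)%E.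
Proof.
have mg : measurable_fun [set: measurableTypeR R] (fun y => gaussian_content E (stable_time s y)).
  exact: (measurableT_comp (measurable_gaussian_content mE) (measurable_stable_time s)).
apply: (@integral_le_lim _ (measurableTypeR R) R lebesgue_measure setT
  (fun N y => ((window 0 N y)%:E * gaussian_content E (stable_time s y))%E) _
  (fun=> (kappa * K)%:E) _ measurableT).
- move=> N; apply: emeasurable_funM => //.
  by apply/measurable_EFinP; exact: measurable_window.
- by move=> N y _; rewrite mule_ge0 ?gaussian_content_ge0// lee_fin window_ge0.
- move=> y _; apply: cvg_near_cst; near=> N.
  rewrite windowE positivesE add0n; congr (_%:R%:E * _)%E; congr nat_of_bool.
  have -> : y <= N%:R.
    rewrite (le_trans (ler_norm y))// (le_trans (ltW (archi_boundP (normr_ge0 y))))// ler_nat.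
    by near: N; exact: nbhs_infty_ge.
  by rewrite andbT.
- exact: integral_window_content_le.
- exact: cvg_cst.
Unshelve. all: by end_near. Qed.

(** Integrating the Gaussian contents over all stable times gives a positive multiple of the
    perimeter. *)
Lemma fractional_perimeter_lty : (fractional_perimeter s E < +oo)%E.
Proof.
have [CJ [CJ0 HJ]] := exists_jump_constant s0 n.
have := integral_positives_content_le; rewrite (integral_gaussian_content mE CJ0 HJ) => H.
have : (fractional_perimeter s E <= (CJ^-1 * (kappa * K))%:E)%E.
  by rewrite EFinM lee_pdivlMl.
by move/le_lt_trans; apply; rewrite ltry.
Qed.

End content_bound.
End heat_to_perimeter.


Theorem theorem3p2 (R : realType) (n : nat) (hn : (2 <= n)%N)
    (s : R) (hs0 : 0 < s) (hs : s < 1 / 2)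
    (E : set (Rn R n)) (mE : measurable E) :
  (limf_esup (fun t : R => (1 / t)%:E * heat_content s t E) 0^'+ < +oo)%E <->
  (fractional_perimeter s E < +oo)%E.
Proof.
have n0 : (0 < n)%N by exact: ltnW.
have s2 : s <= 2^-1 by rewrite -[leRHS]div1r ltW.
split=> [/ereal_inf_lt[_ [V nV <-] supV]|perE].
  have [K supK] : exists K : R, (ereal_sup ((fun t : R => (1 / t)%:E * heat_content s t E)%E @` V) <= K%:E)%E.
    move: supV; case: (ereal_sup _) => [r| |] // _; first by exists r.
    by exists 0; rewrite leNye.
  have [eta /= eta0 etaV] := nV.
  have [kappa [kappa0 kappaE]] := exists_bernstein_constant hs0 s2.
  apply: (@fractional_perimeter_lty R n s kappa n0 hs0 s2 kappa0 kappaE E eta K mE eta0).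
  move=> t /andP[t0 teta].
  rewrite EFinM -lee_pdivrMl// -div1r.
  apply: le_trans supK; apply: ereal_sup_ubound; exists t => //.
  by apply: etaV => //=; rewrite sub0r normrN gtr0_norm.
have [K heatK] := heat_content_le_perimeter n0 hs0 s2 mE perE.
apply: (@le_lt_trans _ _ K%:E); last exact: ltry.
apply: ge_ereal_inf; exists (ereal_sup ((fun t : R => (1 / t)%:E * heat_content s t E)%E @` [set t | 0 < t])).
  by exists [set t : R | 0 < t] => //; exact: nbhs_right_gt.
apply: ge_ereal_sup => _ [t /= t0 <-].
by rewrite div1r lee_pdivrMl// -EFinM; exact: heatK.
Qed.
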